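(* Fix an integer $N\ge2$. A bounded sequence $(c_\nu)_{\nu\in\mathbb Z}$ of complex numbers is the sequence of Fourier coefficients of a (uniquely determined) $N$-invariant special measure if and only if the following conditions hold: (i) $c_{-\nu}=\overline{c_\nu}$ for all $\nu\in\mathbb Z$; (ii) $c_{\nu N}=c_\nu$ for all $\nu\in\mathbb Z$; (iii) the series $\sum_{n=0}^\infty|b_n|^2$ converges, where $(b_n)$ is defined by $$\sum_{n=0}^\infty b_nz^n=\exp\Big(-c_0-2\sum_{\nu=1}^\infty c_\nu z^\nu\Big).$$ Moreover, condition (iii) may be replaced by the following weaker one: (iii') for some $\varepsilon>0$ the series $\sum_{n=0}^\infty|b_n(\varepsilon)|^2$ converges, where $(b_n(\varepsilon))$ is defined by $$\sum_{n=0}^\infty b_n(\varepsilon)z^n=\exp\Big(-\varepsilon\sum_{\nu=1}^\infty c_\nu z^\nu\Big).$$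
   Context: $\mathbb T$ is the unit circle, $\lambda$ its Haar probability measure. $M(\mathbb T)$ is the space of finite real (signed) Borel measures on $\mathbb T$. The Fourier coefficients of $\mu\in M(\mathbb T)$ are $c_\nu(\mu)=\int_{\mathbb T}\zeta^{-\nu}\,d\mu(\zeta)$, $\nu\in\mathbb Z$. A measure $\mu\in M(\mathbb T)$ is called special if $\mu=\alpha\lambda+\sigma$ where $\alpha\in\mathbb R$ and $\sigma\ge0$ is a finite Borel measure on $\mathbb T$ singular with respect to $\lambda$. $\mu$ is $N$-invariant if $(\varphi_N)_*\mu=\mu$ for $\varphi_N(\zeta)=\zeta^N$. *)

(* Defs.v *)
From HB Require Import structures.
From mathcomp Require Import all_boot all_order all_algebra.
From mathcomp Require Import complex.
From mathcomp Require Import all_classical all_reals all_analysis.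

Set Implicit Arguments.
Unset Strict Implicit.
Unset Printing Implicit Defensive.

Import Order.TTheory GRing.Theory Num.Theory.
Import numFieldNormedType.Exports.

Local Open Scope classical_set_scope.
Local Open Scope complex_scope.
Local Open Scope ring_scope.

(* R[i]^o carries the topology of the modulus; R[i] itself carries none. *)
Definition unit_circle (R : realType) : set R[i]^o := [set z | `|z| = 1].
Arguments unit_circle R : clear implicits.

(* The circle as a type, with the subspace topology. *)
Definition circle (R : realType) : Type := set_type (unit_circle R).

Definition circle_val (R : realType) (x : circle R) : R[i] := \val x.

Lemma circle_valP (R : realType) (x : circle R) : `|circle_val x| = 1.
Proof. exact: set_mem (valP x). Qed.

Definition mk_circle (R : realType) (z : R[i]) (hz : `|z| = 1) : circle R :=
  exist _ (z : R[i]^o) (mem_set (hz : unit_circle R z)).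

HB.instance Definition _ (R : realType) := Topological.on (circle R).
HB.instance Definition _ (R : realType) :=
  isPointed.Build (circle R) (mk_circle (normr1 R[i])).
(* The Borel sigma-algebra. *)
HB.instance Definition _ (R : realType) :=
  Measurable.copy (circle R) (g_sigma_algebraType (@open (circle R))).

Definition cexp (R : realType) (z : R[i]) : R[i] :=
  (expR (complex.Re z))%:C * (cos (complex.Im z) +i* sin (complex.Im z)).

Lemma norm_cexp (R : realType) (z : R[i]) :
  `|cexp z| = (expR (complex.Re z))%:C.
Proof.
rewrite /cexp normrM ger0_norm ?lecR ?expR_ge0//.
by rewrite [X in _ * X]normc_def/= cos2Dsin2 sqrtr1 mulr1.
Qed.

Lemma norm_cexp_turn (R : realType) (t : R) :
  `|cexp (0 +i* (2 * pi * t))| = 1.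
Proof. by rewrite norm_cexp/= expR0. Qed.

(* t |-> exp(2 pi i t) *)
Definition circle_turn (R : realType) (t : R) : circle R :=
  mk_circle (norm_cexp_turn t).

Lemma continuous_real_complex (R : realType) :
  continuous (fun t : R => t%:C : R[i]^o).
Proof.
move=> t; apply/cvgrPdist_lt => /= e e0.
have eE : e = (complex.Re e)%:C.
  by move: e0; case: e => a b; rewrite ltcE/= => /andP[/eqP->].
have e0' : 0 < complex.Re e by rewrite -ltcR -eE.
near=> s.
rewrite -rmorphB /= normc_def/= expr0n addr0 sqrtr_sqr eE ltcR.
by near: s; apply: cvgr_dist_lt.
Unshelve. all: by end_near. Qed.

Lemma continuous_circle_turn (R : realType) : continuous (@circle_turn R).
Proof.
apply: continuous_comp_initial => t /=.
have -> : set_val \o @circle_turn R = (fun t : R =>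
   (cos (2 * pi * t))%:C + (sin (2 * pi * t))%:C * 'i : R[i]^o).
  by apply/funext => s /=; rewrite set_valE/= /cexp/= expR0 mul1r; simpc.
have cl : {for t, continuous (fun s : R => 2 * pi * s)}.
  exact: mulrl_continuous.
apply: cvgD; last apply: cvgMr_tmp.
  apply: continuous_comp; last exact: continuous_real_complex.
  by apply: (continuous_comp cl); exact: continuous_cos.
apply: continuous_comp; last exact: continuous_real_complex.
by apply: (continuous_comp cl); exact: continuous_sin.
Qed.

Lemma measurable_circle_turn (R : realType) :
  measurable_fun [set: R] (@circle_turn R).
Proof.
apply: (measurability (@open (circle R))) => //= _ [U oU <-].
rewrite setTI; apply: measurable_realfun.open_measurable.
by move/continuousP : (@continuous_circle_turn R); exact.
Qed.

(* The normalised arc length: the law of exp(2 pi i t) for t uniformly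
   distributed on [0, 1]. *)
Definition haar (R : realType) : set (circle R) -> \bar R :=
  pushforward (uniform_prob (@ltr01 R)) (@circle_turn R).
Arguments haar R : clear implicits.


Section haar_probability.
Variable R : realType.

Let haar_measure : {measure set (circle R) -> \bar R} :=
  measure_function_pushforward__canonical__measure_function_Measure
    (uniform_prob (@ltr01 R)) (@measurable_circle_turn R).

HB.instance Definition _ := isMeasure.Build _ _ _ (haar R)
  (measure0 haar_measure) (measure_ge0 haar_measure)
  (@measure_semi_sigma_additive _ _ _ haar_measure).

Let haar_setT : haar R setT = 1%E.
Proof. by rewrite /haar /pushforward preimage_setT probability_setT. Qed.

HB.instance Definition _ := Measure_isProbability.Build _ _ _ (haar R) haar_setT.

End haar_probability.
Section charge_integral.
Context d (T : measurableType d) (R : realType).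
Variable mu : {charge set T -> \bar R}.

Definition hahn_choice :
    {P : set T & {N : set T | hahn_decomposition mu P N}} :=
  let P := cid (Hahn_decomposition mu) in
  existT _ (projT1 P) (cid (projT2 P)).

(* The two measures of the Jordan decomposition; on measurable sets they do not
   depend on the Hahn decomposition which is chosen. *)
Definition charge_pos : {measure set T -> \bar R} :=
  jordan_pos (projT2 (projT2 hahn_choice)).
Definition charge_neg : {measure set T -> \bar R} :=
  jordan_neg (projT2 (projT2 hahn_choice)).

Definition charge_integral (f : T -> R) : R :=
  Rintegral charge_pos setT f - Rintegral charge_neg setT f.

Definition charge_Cintegral (f : T -> R[i]) : R[i] :=
  charge_integral (fun x => complex.Re (f x)) +i*
  charge_integral (fun x => complex.Im (f x)).

End charge_integral.

Definition fourier_coef (R : realType) (mu : {charge set (circle R) -> \bar R})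
    (nu : int) : R[i] :=
  charge_Cintegral mu (fun x => circle_val x ^ (- nu)).

Lemma norm_circle_exp (R : realType) (N : nat) (x : circle R) :
  `|circle_val x ^+ N| = 1.
Proof. by rewrite normrX circle_valP expr1n. Qed.

Definition circle_exp (R : realType) (N : nat) (x : circle R) : circle R :=
  mk_circle (norm_circle_exp N x).

Definition invariant_charge (R : realType) (N : nat)
    (mu : {charge set (circle R) -> \bar R}) : Prop :=
  forall A, measurable A -> pushforward mu (circle_exp N) A = mu A.

Definition mutually_singular d (T : measurableType d) (R : realType)
    (m1 m2 : {measure set T -> \bar R}) : Prop :=
  exists A : set T, [/\ measurable A, m1 A = 0%E & m2 (~` A) = 0%E].

Definition special (R : realType) (mu : {charge set (circle R) -> \bar R}) :
    Prop :=
  exists (alpha : R) (sigma : {finite_measure set (circle R) -> \bar R}),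
    mutually_singular sigma (haar R) /\
    forall A, measurable A -> mu A = (alpha%:E * haar R A + sigma A)%E.

Definition special_invariant_with_coefs (R : realType) (N : nat)
    (c : int -> R[i]) (mu : {charge set (circle R) -> \bar R}) : Prop :=
  [/\ special mu, invariant_charge N mu & forall nu, fourier_coef mu nu = c nu].

(* sum_{nu >= 1} c_nu z^nu *)
Definition taylor_part (R : realType) (c : int -> R[i]) (z : R[i]) : R[i] :=
  limn (series (fun k : nat => c k.+1%:Z * z ^+ k.+1 : R[i]^o)).

(* sum_{n >= 0} b_n z^n = F z on the open unit disc; F has at most one such
   sequence b. *)
Definition expands (R : realType) (b : nat -> R[i]) (F : R[i] -> R[i]) : Prop :=
  forall z : R[i], `|z| < 1 ->
    series (fun n : nat => b n * z ^+ n : R[i]^o) @ \oo --> (F z : R[i]^o).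

Definition square_summable (R : realType) (b : nat -> R[i]) : Prop :=
  cvgn (series (fun n : nat => Normc.normc (b n) ^+ 2)).

Definition exp_square_summable (R : realType) (c : int -> R[i]) : Prop :=
  exists b : nat -> R[i],
    expands b (fun z => cexp (- c 0 - 2 * taylor_part c z)) /\
    square_summable b.

Definition exp_eps_square_summable (R : realType) (c : int -> R[i]) : Prop :=
  exists eps : R, 0 < eps /\
  exists b : nat -> R[i],
    expands b (fun z => cexp (- eps%:C * taylor_part c z)) /\
    square_summable b.

(* Main.v *)
(* A special measure alpha haar + sigma has Re (c_0 + 2 sum c_v z^v) >= alpha in
   the disc, being alpha plus the Poisson integral of sigma; hence the exponential
   is bounded, and by Parseval its coefficients are square summable.

   Conversely let F = exp(-eps sum_(v >= 1) c_v z^v) have square summable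
   coefficients, with sum S. As c_(vN) = c_v, the logarithm of F(z^Q), Q = N^m, is
   the mean of the logarithms of F over the rotations of z by the Q-th roots of
   unity. By Jensen's inequality |F(z^Q)|^2 is at most the mean of |F|^2 over these
   rotations, and for m large Parseval bounds this by 2 S. So F is bounded, and
   Re (c_0 + 2 sum c_v z^v) is bounded below; by Herglotz' theorem the c_v are,
   up to a multiple of haar, the coefficients of a positive measure m, which is
   N-invariant.

   Finally m = beta haar + sigma with sigma singular. Take d > m(T) and let k be the
   negative part of m - d haar: it is N-invariant and k <= d haar. For v <> 0 the
   coefficients of k at v N^j are all equal, so Bessel's inequality makes them
   vanish, and k is a nonzero multiple of haar. The set carrying the positive part
   of m - d haar is k-negligible, hence haar-negligible. *)
From HB Require Import structures.
Require Import Defs.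
From mathcomp Require Import all_boot all_order all_algebra.
From mathcomp Require Import complex.
From mathcomp Require Import all_classical all_reals all_analysis.
From mathcomp Require Import measurable_realfun.
From mathcomp Require Import ring lra zify.
Set Implicit Arguments.
Unset Strict Implicit.
Unset Printing Implicit Defensive.
Import Order.TTheory GRing.Theory Num.Theory.
Import numFieldNormedType.Exports.

Local Open Scope classical_set_scope.
Local Open Scope complex_scope.
Local Open Scope ring_scope.

(** * Sequences of complex numbers and exponentials of power series *)

(** No integral over a circle |z| = r occurs: Parseval's identity, the Fejér means and the
    approximating measures in Herglotz' theorem are all finite means over Q-th roots of unity. Such
    means are exact below degree Q, so truncations are paired with a large Q.

    In the bound of F the points z with z^Q = z0 approach the circle as Q grows, but z0 does not
    move: within a residue class modulo Q, Cauchy-Schwarz costs only 1 / (1 - |z0|^2), and this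
    constant multiplies the tail of sum |b_n|^2 beyond Q, which tends to 0. The factor 2 comes from
    (x + y)^2 <= 2 x^2 + 2 y^2; its size is harmless, because it only changes the multiple of haar
    that is split off.

    The invariance of the negative part k is not immediate, as the Hahn decomposition is not known
    to be invariant. For phi(z) = z^N one gets k(A) <= k(phi^-1 A); applied to A and to its
    complement this forces equality, since the total masses agree. *)

Section complex_sequences.
Variable R : realType.
Implicit Types (u v : nat -> R[i]) (x y z l : R[i]).
Local Notation normc := (@Normc.normc R).

Lemma normrcE z : `|z| = (normc z)%:C.
Proof. by case: z => a b; rewrite normc_def. Qed.

Lemma normc_ge0 z : 0 <= normc z.
Proof. by rewrite -lecR -normrcE normr_ge0. Qed.

Lemma le_normcB x y : normc (x - y) <= normc x + normc y.
Proof. by rewrite -(normcN y); exact: le_normcD. Qed.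

Lemma normcB x y : normc (x - y) = normc (y - x).
Proof. by rewrite -normcN opprB. Qed.

Lemma normcX z n : normc (z ^+ n) = normc z ^+ n.
Proof. by apply: complexI; rewrite -normrcE normrX normrcE rmorphXn. Qed.

Lemma normc_real (a : R) : normc a%:C = `|a|.
Proof. by rewrite /= expr0n/= addr0 sqrtr_sqr. Qed.

Lemma normc_conj z : normc (z^*%C) = normc z.
Proof. by case: z => a b /=; rewrite sqrrN. Qed.

Lemma normc_sqr z : normc z ^+ 2 = complex.Re z ^+ 2 + complex.Im z ^+ 2.
Proof. by case: z => a b /=; rewrite sqr_sqrtr ?addr_ge0 ?sqr_ge0. Qed.

Lemma mulcJ z : z * z^*%C = (normc z ^+ 2)%:C.
Proof. by rewrite normc_sqr; case: z => a b /=; simpc; congr (_ +i* _); ring. Qed.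

Lemma ler_Re_normc z : `|complex.Re z| <= normc z.
Proof. by rewrite -lecR -normrcE normc_ge_Re. Qed.

Lemma ler_Im_normc z : `|complex.Im z| <= normc z.
Proof. by rewrite -[`|_|]normrN -ReiNIm (le_trans (ler_Re_normc _))// Normc.normcM /= expr0n expr1n add0r sqrtr1 mulr1. Qed.

Lemma normc_le_ReIm z : normc z <= `|complex.Re z| + `|complex.Im z|.
Proof.
rewrite {1}(complexE z) (le_trans (le_normcD _ _))// Normc.normcM !normc_real.
by rewrite /= expr0n expr1n add0r sqrtr1 mul1r.
Qed.

Lemma ReD x y : complex.Re (x + y) = complex.Re x + complex.Re y.
Proof. by case: x y => [? ?] [? ?]. Qed.

Lemma ImD x y : complex.Im (x + y) = complex.Im x + complex.Im y.
Proof. by case: x y => [? ?] [? ?]. Qed.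

Lemma ReN x : complex.Re (- x) = - complex.Re x.
Proof. by case: x. Qed.

Lemma ImN x : complex.Im (- x) = - complex.Im x.
Proof. by case: x. Qed.

Lemma Re_conjc x : complex.Re (x^*%C) = complex.Re x.
Proof. by case: x. Qed.

Lemma Im_conjc x : complex.Im (x^*%C) = - complex.Im x.
Proof. by case: x. Qed.

Lemma Re_sum (I : Type) (r : seq I) (P : pred I) (F : I -> R[i]) :
  complex.Re (\sum_(i <- r | P i) F i) = \sum_(i <- r | P i) complex.Re (F i).
Proof. exact: (big_morph _ ReD). Qed.

Lemma Im_sum (I : Type) (r : seq I) (P : pred I) (F : I -> R[i]) :
  complex.Im (\sum_(i <- r | P i) F i) = \sum_(i <- r | P i) complex.Im (F i).
Proof. exact: (big_morph _ ImD). Qed.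

Lemma normc_sum (I : Type) (r : seq I) (P : pred I) (F : I -> R[i]) :
  normc (\sum_(i <- r | P i) F i) <= \sum_(i <- r | P i) normc (F i).
Proof.
elim/big_ind2 : _ => //= [|x a y b ? ?]; first by rewrite expr0n/= addr0 sqrtr0.
by rewrite (le_trans (le_normcD _ _)) ?lerD.
Qed.

Lemma Re_realM (a : R) z : complex.Re (a%:C * z) = a * complex.Re z.
Proof. by case: z => x y; simpc. Qed.

Lemma Im_realM (a : R) z : complex.Im (a%:C * z) = a * complex.Im z.
Proof. by case: z => x y; simpc. Qed.

(** Coordinatewise, so that limits reduce to real ones; [cvgcP] identifies it with convergence in
    [R[i]^o], the topology of the statement. *)
Definition cvgc u l : Prop :=
  (fun n => complex.Re (u n)) @ \oo --> (complex.Re l : R) /\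
  (fun n => complex.Im (u n)) @ \oo --> (complex.Im l : R).

Lemma cvgc_normcB u l : cvgc u l -> (fun n => normc (l - u n)) @ \oo --> (0 : R).
Proof.
move=> [hr hi].
have h1 : `|complex.Re l - complex.Re (u n)| @[n --> \oo] --> `|complex.Re l - complex.Re l|.
  by apply: cvg_norm; apply: cvgB => //; exact: cvg_cst.
have h2 : `|complex.Im l - complex.Im (u n)| @[n --> \oo] --> `|complex.Im l - complex.Im l|.
  by apply: cvg_norm; apply: cvgB => //; exact: cvg_cst.
move: h1 h2; rewrite !subrr normr0 => h1 h2.
have h3 : `|complex.Re l - complex.Re (u n)| + `|complex.Im l - complex.Im (u n)| @[n --> \oo] --> (0 : R).
  by rewrite -[X in _ --> X]addr0; exact: cvgD h1 h2.
apply: (squeeze_cvgr _ (cvg_cst (0 : R)) h3); apply: nearW => n.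
by rewrite normc_ge0 /= -!ReN -!ImN -!ReD -!ImD normc_le_ReIm.
Qed.

Lemma cvgc_le u l (e : nat -> R) :
  (forall n, normc (l - u n) <= e n) -> e @ \oo --> (0 : R) -> cvgc u l.
Proof.
move=> ue e0; split; apply/cvgrPdist_lt => d d0;
  move/cvgr0_norm_lt: (e0) => /(_ _ d0); apply: filterS => n hn /=;
  apply: le_lt_trans (le_lt_trans (ue n) (le_lt_trans (ler_norm _) hn)).
  by rewrite -ReN -ReD ler_Re_normc.
by rewrite -ImN -ImD ler_Im_normc.
Qed.

Lemma posC_Re (e : R[i]) : 0 < e -> e = (complex.Re e)%:C /\ 0 < complex.Re e.
Proof.
move=> e0; have eE : e = (complex.Re e)%:C.
  by move: e0; case: e => a b; rewrite ltcE/= => /andP[/eqP->].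
by split=> //; rewrite -ltcR -eE.
Qed.

Lemma cvgcP u l : cvgc u l <-> (u : nat -> R[i]^o) @ \oo --> (l : R[i]^o).
Proof.
split=> [/cvgc_normcB h|].
  apply/cvgrPdist_lt => e e0.
  have [eE e0'] := posC_Re e0.
  move/cvgr0_norm_lt: h => /(_ _ e0'); apply: filterS => n hn /=.
  by rewrite eE (normrcE (l - u n)) ltcR (le_lt_trans (ler_norm _)).
move/cvgrPdist_lt => h; split; apply/cvgrPdist_lt => e e0;
  have e0' : 0 < e%:C by rewrite ltcR.
  apply: filterS (h _ e0') => n; rewrite normrcE ltcR; apply: le_lt_trans.
  by rewrite -ReN -ReD ler_Re_normc.
apply: filterS (h _ e0') => n; rewrite normrcE ltcR; apply: le_lt_trans.
by rewrite -ImN -ImD ler_Im_normc.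
Qed.

Lemma cvgc_unique u l l' : cvgc u l -> cvgc u l' -> l = l'.
Proof.
move=> [ur ui] [ur' ui']; apply/eqP; rewrite eq_complex.
rewrite -(cvg_lim _ ur)// -(cvg_lim _ ui)// (cvg_lim _ ur')// (cvg_lim _ ui')//.
by rewrite !eqxx.
Qed.

Lemma cvgc_cst l : cvgc (fun=> l) l.
Proof. by split; exact: cvg_cst. Qed.

Lemma eq_cvgc u v l : u =1 v -> cvgc u l -> cvgc v l.
Proof. by move=> /funext ->. Qed.

Lemma cvgcD u v l l' : cvgc u l -> cvgc v l' -> cvgc (fun n => u n + v n) (l + l').
Proof.
by move=> [ur ui] [vr vi]; split; [under eq_fun do rewrite ReD; rewrite ReD|
  under eq_fun do rewrite ImD; rewrite ImD]; exact: cvgD.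
Qed.

Lemma cvgcN u l : cvgc u l -> cvgc (fun n => - u n) (- l).
Proof.
by move=> [ur ui]; split; [under eq_fun do rewrite ReN; rewrite ReN|
  under eq_fun do rewrite ImN; rewrite ImN]; exact: cvgN.
Qed.

Lemma cvgcB u v l l' : cvgc u l -> cvgc v l' -> cvgc (fun n => u n - v n) (l - l').
Proof. by move=> h1 h2; apply: cvgcD => //; exact: cvgcN. Qed.

Lemma cvgcM u v l l' : cvgc u l -> cvgc v l' -> cvgc (fun n => u n * v n) (l * l').
Proof.
have reM x y : complex.Re (x * y) = complex.Re x * complex.Re y - complex.Im x * complex.Im y.
  by case: x y => [? ?] [? ?].
have imM x y : complex.Im (x * y) = complex.Re x * complex.Im y + complex.Im x * complex.Re y.
  by case: x y => [? ?] [? ?].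
move=> [ur ui] [vr vi]; split; [under eq_fun do rewrite reM; rewrite reM|
  under eq_fun do rewrite imM; rewrite imM].
  by apply: cvgB; exact: cvgM.
by apply: cvgD; exact: cvgM.
Qed.

Lemma cvgcMl z u l : cvgc u l -> cvgc (fun n => z * u n) (z * l).
Proof. by apply: cvgcM; exact: cvgc_cst. Qed.

Lemma cvgc_sum (I : Type) (r : seq I) (F : I -> nat -> R[i]) (L : I -> R[i]) :
  (forall i, cvgc (F i) (L i)) ->
  cvgc (fun n => \sum_(i <- r) F i n) (\sum_(i <- r) L i).
Proof.
move=> h; elim: r => [|i r IH].
  by under eq_fun do rewrite big_nil; rewrite big_nil; exact: cvgc_cst.
by under eq_fun do rewrite big_cons; rewrite big_cons; apply: cvgcD.
Qed.

Lemma cvgc_comp u l (f : nat -> nat) : f @ \oo --> \oo -> cvgc u l ->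
  cvgc (fun n => u (f n)) l.
Proof. by move=> hf [ur ui]; split; [apply: cvg_comp hf ur|apply: cvg_comp hf ui]. Qed.

Lemma cvgc_normc u l : cvgc u l -> (fun n => normc (u n)) @ \oo --> (normc l : R).
Proof.
move/cvgc_normcB => h; apply/cvgrPdist_lt => e e0.
move/cvgr0_norm_lt: h => /(_ _ e0); apply: filterS => n; apply: le_lt_trans.
rewrite [leRHS]ger0_norm ?normc_ge0// ler_norml; apply/andP; split.
  rewrite lerBrDl lerBlDr normcB -{1}(subrK l (u n)) addrC.
  by rewrite (le_trans (le_normcD _ _)) 1?addrC.
by rewrite lerBlDr -{1}(subrK (u n) l); exact: le_normcD.
Qed.

Lemma abs_cvgc u : cvgn (series (fun n => normc (u n))) ->
  exists l, cvgc (fun n => \sum_(i < n) u i) l.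
Proof.
move=> hu.
have hre : cvgn (series (fun n => complex.Re (u n))).
  apply: normed_cvg; apply: series_le_cvg hu => n /=;
    [exact: normr_ge0|exact: normc_ge0|exact: ler_Re_normc].
have him : cvgn (series (fun n => complex.Im (u n))).
  apply: normed_cvg; apply: series_le_cvg hu => n /=;
    [exact: normr_ge0|exact: normc_ge0|exact: ler_Im_normc].
exists (limn (series (fun n => complex.Re (u n))) +i* limn (series (fun n => complex.Im (u n)))).
split=> /=.
  by under eq_fun do rewrite Re_sum -(big_mkord xpredT (fun i => complex.Re (u i))).
by under eq_fun do rewrite Im_sum -(big_mkord xpredT (fun i => complex.Im (u i))).
Qed.

Lemma cvgc_series u l :
  cvgc (fun n => \sum_(i < n) u i) l <->
  series (u : nat -> R[i]^o) @ \oo --> (l : R[i]^o).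
Proof.
rewrite cvgcP; suff -> : series (u : nat -> R[i]^o) = (fun n => \sum_(i < n) u i) by [].
by apply/funext => n; rewrite /series/= -(big_mkord xpredT).
Qed.

End complex_sequences.

(** * Cauchy products of absolutely convergent series *)

Section cauchy_product.
Variable R : realType.
Local Notation normc := (@Normc.normc R).

Definition conv (K : pzRingType) (a b : nat -> K) (n : nat) : K :=
  \sum_(i < n.+1) a i * b (n - i)%N.

Lemma series_conv (K : pzRingType) (a b : nat -> K) (n : nat) :
  \sum_(k < n) conv a b k = \sum_(i < n) a i * \sum_(j < n - i) b j.
Proof.
elim: n => [|n IH]; first by rewrite !big_ord0.
rewrite big_ord_recr/= IH [RHS]big_ord_recr/= /conv [X in _ + X]big_ord_recr/=.
rewrite addrA -big_split/= subSnn big_ord1 subnn; congr (_ + _).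
apply: eq_bigr => i _; rewrite -mulrDr subSn ?(ltnW (ltn_ord i))//.
by rewrite big_ord_recr.
Qed.

(** The square i, j < n minus the triangle i + j < n. *)
Lemma series_conv_rest (K : pzRingType) (a b : nat -> K) (n : nat) :
  (\sum_(i < n) a i) * (\sum_(j < n) b j) - \sum_(k < n) conv a b k =
  \sum_(i < n) a i * \sum_(n - i <= j < n) b j.
Proof.
rewrite series_conv mulr_suml -sumrB; apply: eq_bigr => i _.
rewrite -mulrBr; congr (_ * _); rewrite -!(big_mkord xpredT).
by rewrite [X in X - _](@big_cat_nat _ _ _ (n - i))//= ?leq_subr// addrAC subrr add0r.
Qed.

Lemma conv_ge0 (a b : nat -> R) : (forall n, 0 <= a n) -> (forall n, 0 <= b n) ->
  forall n, 0 <= conv a b n.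
Proof. by move=> a0 b0 n; apply: sumr_ge0 => i _; rewrite mulr_ge0. Qed.

(** For nonnegative terms the sum over the square of side n lies between those over the triangles i
    + j < n and i + j < 2n, which have a common limit. *)
Lemma pos_cauchy_product (a b : nat -> R) (A B : R) :
  (forall n, 0 <= a n) -> (forall n, 0 <= b n) ->
  series a @ \oo --> A -> series b @ \oo --> B ->
  series (conv a b) @ \oo --> A * B.
Proof.
move=> a0 b0 hA hB.
have hAB : (fun n => series a n * series b n) @ \oo --> A * B by exact: cvgM.
have sE (u : nat -> R) n : series u n = \sum_(i < n) u i.
  by rewrite /series/= big_mkord.
have s0 (u : nat -> R) n : (forall n, 0 <= u n) -> 0 <= series u n.
  by move=> u0; rewrite sE sumr_ge0.
have snd (u : nat -> R) : (forall n, 0 <= u n) ->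
    {homo series u : n m / (n <= m)%N >-> n <= m}.
  by move=> u0; apply: nondecreasing_series => n _ _; exact: u0.
have T1 n : series (conv a b) n <= series a n * series b n.
  rewrite -subr_ge0 !sE series_conv_rest; apply: sumr_ge0 => i _.
  by rewrite mulr_ge0// sumr_ge0.
have T2 n : series a n * series b n <= series (conv a b) n.*2.
  rewrite !sE series_conv -addnn big_split_ord/= mulr_suml.
  rewrite ler_wpDr//; first by rewrite sumr_ge0// => i _; rewrite mulr_ge0// sumr_ge0.
  apply: ler_sum => i _; apply: ler_wpM2l => //.
  by rewrite -!sE snd// -addnBA ?leq_addr// ltnW.
have cT : cvgn (series (conv a b)).
  apply: nondecreasing_is_cvgn; first by apply: snd; exact: conv_ge0.
  exists (A * B) => _ [n _ <-]; apply: le_trans (T1 n) _.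
  have aA := nondecreasing_cvgn_le (snd _ a0) (cvgP _ hA) n.
  have bB := nondecreasing_cvgn_le (snd _ b0) (cvgP _ hB) n.
  rewrite (cvg_lim _ hA)// in aA; rewrite (cvg_lim _ hB)// in bB.
  by apply: ler_pM => //; exact: s0.
suff -> : A * B = limn (series (conv a b)) by [].
rewrite -(cvg_lim _ hAB)//; apply: cvg_lim => //.
apply: (@squeeze_cvgr _ _ _ _ (series (conv a b)) (fun n => series (conv a b) n.*2)) => //.
  by apply: nearW => n; rewrite T1 T2.
apply: cvg_comp cT => //.
by apply/cvgnyPge => k; exists k => // n /= kn; rewrite (leq_trans kn)// -addnn leq_addr.
Qed.

Lemma norm_conv_le (a b : nat -> R[i]) n :
  normc (conv a b n) <= conv (fun n => normc (a n)) (fun n => normc (b n)) n.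
Proof.
rewrite /conv (le_trans (normc_sum _ _ _))// ler_sum// => i _.
by rewrite Normc.normcM.
Qed.

(** The rest in [series_conv_rest] is dominated by the rest for the moduli, which tends to 0 by the
    nonnegative case. *)
Lemma cauchy_product (a b : nat -> R[i]) (A B : R[i]) :
  cvgn (series (fun n => normc (a n))) -> cvgn (series (fun n => normc (b n))) ->
  cvgc (fun n => \sum_(i < n) a i) A -> cvgc (fun n => \sum_(i < n) b i) B ->
  cvgc (fun n => \sum_(i < n) conv a b i) (A * B).
Proof.
move=> ca cb hA hB; have hAB := cvgcM hA hB.
pose a' n := normc (a n); pose b' n := normc (b n).
have sE (u : nat -> R) n : series u n = \sum_(i < n) u i.
  by rewrite /series/= big_mkord.
have h : (fun n => series a' n * series b' n - series (conv a' b') n) @ \oo -->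
    limn (series a') * limn (series b') - limn (series a') * limn (series b').
  apply: cvgB; first exact: cvgM.
  by apply: pos_cauchy_product => // n; exact: normc_ge0.
rewrite subrr in h.
have h2 : cvgc (fun n => (\sum_(i < n) a i) * (\sum_(i < n) b i) - \sum_(i < n) conv a b i) 0.
  apply: cvgc_le h => n.
  rewrite sub0r normcN !sE !series_conv_rest.
  apply: le_trans (normc_sum _ _ _) _; apply: ler_sum => i _.
  by rewrite Normc.normcM ler_wpM2l ?normc_ge0// normc_sum.
have := cvgcB hAB h2; rewrite subr0; apply: eq_cvgc => n.
by rewrite opprB addrC subrK.
Qed.

Lemma cvg_normc_conv (a b : nat -> R[i]) :
  cvgn (series (fun n => normc (a n))) -> cvgn (series (fun n => normc (b n))) ->
  cvgn (series (fun n => normc (conv a b n))).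
Proof.
move=> ca cb; apply: (@series_le_cvg _ _ (conv (fun n => normc (a n)) (fun n => normc (b n)))) => [n|n|n|].
- exact: normc_ge0.
- by apply: conv_ge0 => ?; exact: normc_ge0.
- exact: norm_conv_le.
- by apply: cvgP; apply: pos_cauchy_product ca cb => // n; exact: normc_ge0.
Qed.

End cauchy_product.

Lemma sum_cvg (R : realType) (T : Type) (FF : set_system T) {FFF : Filter FF}
    (I : Type) (r : seq I) (f : I -> T -> R) (L : I -> R) :
  (forall i, f i @ FF --> L i) ->
  (fun n => \sum_(i <- r) f i n) @ FF --> \sum_(i <- r) L i.
Proof. by move=> h; apply: cvg_big => //; exact: add_continuous. Qed.

(** * The exponential of a power series *)

Section exponential.
Variable R : realType.
Local Notation normc := (@Normc.normc R).
Implicit Types (z w : R[i]).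

Lemma series_ord (u : nat -> R) : series u = (fun n => \sum_(i < n) u i).
Proof. by apply/funext => n; rewrite /series/= big_mkord. Qed.

Lemma cvg_le_cst (u : nat -> R) (l a : R) :
  u @ \oo --> l -> (forall n, u n <= a) -> l <= a.
Proof.
move=> ul ua; rewrite -(cvg_lim _ ul)//; apply: limr_le; first exact: cvgP ul.
exact: nearW.
Qed.

Lemma cvgc_normc_le (u : nat -> R[i]) (l : R[i]) (a : R) :
  cvgc u l -> (forall n, normc (u n) <= a) -> normc l <= a.
Proof. by move=> /cvgc_normc ul; exact: cvg_le_cst. Qed.

Lemma cvgc_real (u : nat -> R) (l : R) :
  u @ \oo --> l -> cvgc (fun n => (u n)%:C) l%:C.
Proof. by move=> ul; split => //=; exact: cvg_cst. Qed.

Lemma cexpD z w : cexp (z + w) = cexp z * cexp w.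
Proof.
rewrite /cexp ReD ImD expRD cosD sinD rmorphM/=; simpc.
by congr (_ +i* _); ring.
Qed.

Lemma cexp0 : cexp (0 : R[i]) = 1.
Proof. by rewrite /cexp/= expR0 cos0 sin0; simpc. Qed.

Lemma cexpMn z n : cexp (z *+ n) = cexp z ^+ n.
Proof. by elim: n => [|n IH]; rewrite ?mulr0n ?cexp0// mulrS cexpD IH exprS. Qed.

Lemma normc_cexp z : normc (cexp z) = expR (complex.Re z).
Proof. by apply: complexI; rewrite -normrcE norm_cexp. Qed.

Lemma factC_neq0 n : n`!%:R != 0 :> R[i].
Proof. by rewrite pnatr_eq0 -lt0n fact_gt0. Qed.

Definition cexp_coeff z (n : nat) : R[i] := z ^+ n / n`!%:R.

Lemma normc_nat n : normc n%:R = n%:R.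
Proof. by rewrite -[n%:R](rmorph_nat (real_complex R)) normc_real ger0_norm. Qed.

Lemma normc_cexp_coeff z n : normc (cexp_coeff z n) = exp_coeff (normc z) n.
Proof. by rewrite /cexp_coeff Normc.normcM Normc.normcV normcX normc_nat. Qed.

Lemma conv_cexp_coeff z w n :
  conv (cexp_coeff w) (cexp_coeff z) n = cexp_coeff (z + w) n.
Proof.
rewrite /conv /cexp_coeff exprDn mulr_suml; apply: eq_bigr => i _.
have hi : (i <= n)%N by rewrite -ltnS.
rewrite -mulr_natr -(bin_fact hi) !natrM.
have := factC_neq0 i; have := factC_neq0 (n - i).
have : 'C(n, i)%:R != 0 :> R[i] by rewrite pnatr_eq0 -lt0n bin_gt0.
by move=> h1 h2 h3; field; rewrite h1 h2 h3.
Qed.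

Lemma cexp_coeff_real (x : R) n : cexp_coeff x%:C n = (exp_coeff x n)%:C.
Proof. by rewrite /cexp_coeff /exp_coeff/= rmorphM rmorphXn/= fmorphV rmorph_nat. Qed.

Lemma cexp_coeff_imag (y : R) n :
  cexp_coeff (0 +i* y) n = cos_coeff y n +i* sin_coeff y n.
Proof.
rewrite /cexp_coeff /cos_coeff /sin_coeff/=.
have e2 : (0 +i* y) ^+ 2 = (- y ^+ 2)%:C by rewrite expr2; simpc.
have -> : (0 +i* y) ^+ n = (0 +i* y) ^+ (odd n) * ((-1) ^+ n./2 * y ^+ (n./2).*2)%:C.
  rewrite -{1}(odd_double_half n) exprD -mul2n exprM e2; congr (_ * _).
  by rewrite -rmorphXn/= -[- _]mulN1r exprMn -exprM.
have -> : n`!%:R^-1 = (n`!%:R^-1)%:C :> R[i] by rewrite fmorphV rmorph_nat.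
have -> : y ^+ n = y ^+ odd n * y ^+ n./2.*2 by rewrite -exprD odd_double_half.
rewrite -exprnP.
case: (boolP (odd n)) => [on|en] /=.
  have -> : n.-1./2 = n./2 by rewrite -{1}(odd_double_half n) on/= doubleK.
  by rewrite expr1; simpc; congr (_ +i* _); ring.
by rewrite expr0; simpc; congr (_ +i* _); ring.
Qed.

(** [cexp] is defined through real functions; its series is the Cauchy product of those of exp(Re z)
    and of cos(Im z) + i sin(Im z). *)
Lemma cexp_series z : cvgc (fun n => \sum_(j < n) cexp_coeff z j) (cexp z).
Proof.
have hr : cvgc (fun n => \sum_(j < n) cexp_coeff (complex.Re z)%:C j)
               (expR (complex.Re z))%:C.
  under eq_fun do under eq_bigr do rewrite cexp_coeff_real.
  under eq_fun do rewrite -rmorph_sum.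
  by apply: cvgc_real; rewrite -series_ord; exact: is_cvg_series_exp_coeff.
have hi : cvgc (fun n => \sum_(j < n) cexp_coeff (0 +i* complex.Im z) j)
               (cos (complex.Im z) +i* sin (complex.Im z)).
  under eq_fun do under eq_bigr do rewrite cexp_coeff_imag.
  split; [under eq_fun do rewrite Re_sum|under eq_fun do rewrite Im_sum];
    rewrite -[X in X @ \oo]series_ord /=.
    by rewrite cos.unlock; exact: is_cvg_series_cos_coeff.
  by rewrite sin.unlock; exact: is_cvg_series_sin_coeff.
have nc w : cvgn (series (fun n => normc (cexp_coeff w n))).
  under eq_fun do rewrite normc_cexp_coeff.
  exact: is_cvg_series_exp_coeff.
have := cauchy_product (nc _) (nc _) hr hi.
apply: eq_cvgc => n; apply: eq_bigr => i _.
by rewrite conv_cexp_coeff; congr (cexp_coeff _ _); case: z {hr hi} => a b; simpc.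
Qed.

Fixpoint conv_pow (K : pzRingType) (a : nat -> K) (j : nat) : nat -> K :=
  if j is j'.+1 then conv a (conv_pow a j') else fun n => (n == 0)%:R.

Lemma normc_conv_pow_le (a : nat -> R[i]) j n :
  normc (conv_pow a j n) <= conv_pow (fun n => normc (a n)) j n.
Proof.
elim: j n => [|j IH] n /=; first by rewrite normc_nat.
rewrite /conv (le_trans (normc_sum _ _ _))// ler_sum// => i _.
by rewrite Normc.normcM ler_wpM2l ?normc_ge0.
Qed.

Lemma conv_pow_ge0 (a : nat -> R) j n : (forall n, 0 <= a n) -> 0 <= conv_pow a j n.
Proof.
move=> a0; elim: j n => [|j IH] n /=; first by rewrite ler0n.
exact: conv_ge0.
Qed.

Lemma conv_pow_scale (a : nat -> R[i]) z j n :
  conv_pow (fun n => a n * z ^+ n) j n = conv_pow a j n * z ^+ n.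
Proof.
elim: j n => [|j IH] n /=; first by case: n => [|n] /=; rewrite ?mulr1 ?mul0r.
rewrite /conv mulr_suml; apply: eq_bigr => i _; rewrite IH.
have hi : (i <= n)%N by rewrite -ltnS.
have -> : z ^+ n = z ^+ i * z ^+ (n - i) by rewrite -exprD subnKC.
by ring.
Qed.

Lemma sum_delta0 (K : pzRingType) n : \sum_(i < n.+1) ((i : nat) == 0)%:R = 1 :> K.
Proof. by rewrite big_ord_recl/= big1 ?addr0. Qed.

Lemma series_delta0 : series (fun n : nat => (n == 0)%:R : R) @ \oo --> (1 : R).
Proof.
rewrite series_ord; apply: (@cvg_trans _ ((fun=> 1 : R) @ \oo)); last exact: cvg_cst.
apply: near_eq_cvg; exists 1%N => // -[|n]//= _; first by rewrite sum_delta0.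
Qed.

Lemma conv_pow_pos_series (a : nat -> R) (A : R) j : (forall n, 0 <= a n) ->
  series a @ \oo --> A -> series (conv_pow a j) @ \oo --> A ^+ j.
Proof.
move=> a0 aA; elim: j => [|j IH]; first by rewrite expr0; exact: series_delta0.
by rewrite exprS; apply: pos_cauchy_product => // n; exact: conv_pow_ge0.
Qed.

Lemma conv_pow_series (a : nat -> R[i]) (A : R[i]) j :
  cvgn (series (fun n => normc (a n))) -> cvgc (fun n => \sum_(i < n) a i) A ->
  cvgn (series (fun n => normc (conv_pow a j n))) /\
  cvgc (fun n => \sum_(i < n) conv_pow a j i) (A ^+ j).
Proof.
move=> ca aA; elim: j => [|j [IH1 IH2]].
  split.
    by under eq_fun do rewrite normc_nat; apply: cvgP; exact: series_delta0.
  have h := cvgc_real series_delta0.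
  apply: eq_cvgc h => n; rewrite series_ord rmorph_sum; apply: eq_bigr => i _.
  by rewrite rmorph_nat.
split; first exact: cvg_normc_conv.
by rewrite exprS; exact: cauchy_product.
Qed.

(** The double series of (a^j)_n / j! is summed over j first to give b_n. Summed over n first it
    gives the exponential series of A; the interchange is justified by the majorant exp([At]), where
    [At] is the sum of the moduli. *)
Lemma cexp_of_series (a : nat -> R[i]) (A : R[i]) :
  cvgn (series (fun n => normc (a n))) -> cvgc (fun n => \sum_(i < n) a i) A ->
  exists b : nat -> R[i],
  [/\ forall n, cvgc (fun K => \sum_(j < K) conv_pow a j n / j`!%:R) (b n),
      cvgn (series (fun n => normc (b n))) &
      cvgc (fun n => \sum_(i < n) b i) (cexp A)].
Proof.
move=> ca aA; pose at_ n := normc (a n); set At := limn (series at_).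
have at0 n : 0 <= at_ n by exact: normc_ge0.
have qA L j : \sum_(i < L) conv_pow at_ j i <= At ^+ j.
  have h := conv_pow_pos_series (j := j) at0 ca; rewrite -/At in h.
  rewrite -(cvg_lim _ h)//.
  have := @nondecreasing_cvgn_le _ (series (conv_pow at_ j)) _ (cvgP _ h) L.
  rewrite series_ord; apply; rewrite -series_ord.
  by apply: nondecreasing_series => n _ _; exact: conv_pow_ge0.
have At0 : 0 <= At by have := qA 0%N 1%N; rewrite big_ord0 expr1.
pose d j n := conv_pow a j n / j`!%:R.
have dle j n : normc (d j n) <= conv_pow at_ j n / j`!%:R.
  rewrite /d Normc.normcM Normc.normcV normc_nat ler_wpM2r ?invr_ge0//.
  exact: normc_conv_pow_le.
have dsum L j : \sum_(n < L) normc (d j n) <= exp_coeff At j.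
  rewrite /exp_coeff/= (le_trans (ler_sum _ (fun i _ => dle j _)))//.
  by rewrite -mulr_suml ler_wpM2r ?invr_ge0 ?qA.
have hb n : exists l, cvgc (fun K => \sum_(j < K) d j n) l.
  apply: (abs_cvgc (u := fun j => d j n)).
  apply: series_le_cvg (is_cvg_series_exp_coeff At) => j;
    [exact: normc_ge0|exact: exp_coeff_ge0|].
  have := dsum n.+1 j; rewrite big_ord_recr/=; apply: le_trans.
  by rewrite lerDr sumr_ge0// => i _; exact: normc_ge0.
have [b bP] := choice hb.
pose eps K := expR At - \sum_(j < K) exp_coeff At j.
have eps0 : eps @ \oo --> (0 : R).
  rewrite -[X in _ --> X](subrr (expR At)); apply: cvgB; first exact: cvg_cst.
  by rewrite -[X in X @ \oo]series_ord; exact: is_cvg_series_exp_coeff.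
have expleq K : \sum_(j < K) exp_coeff At j <= expR At.
  have := @nondecreasing_cvgn_le _ (series (exp_coeff At)) _ (is_cvg_series_exp_coeff At) K.
  rewrite {2}series_ord; apply.
  by apply: nondecreasing_series => n _ _; exact: exp_coeff_ge0.
(* A bound uniform in L: K = 0 makes b absolutely summable, and for general K the limit in L
   compares the sum of b with the K-th partial sum of exp(A). *)
have bd K L : \sum_(n < L) normc (b n - \sum_(j < K) d j n) <= eps K.
  have h : (fun m => \sum_(n < L) normc (\sum_(j < K + m) d j n - \sum_(j < K) d j n)) @ \oo -->
      \sum_(n < L) normc (b n - \sum_(j < K) d j n).
    apply: sum_cvg => n; apply: cvgc_normc; apply: cvgcB; last exact: cvgc_cst.
    apply: cvgc_comp (bP n).
    by apply/cvgnyPge => k; exists k => // m /= km; rewrite (leq_trans km)// leq_addl.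
  apply: (cvg_le_cst h) => m.
  apply: (@le_trans _ _ (\sum_(n < L) \sum_(j < m) normc (d (K + j)%N n))).
    apply: ler_sum => n _; rewrite big_split_ord/= addrAC subrr add0r.
    exact: normc_sum.
  rewrite exchange_big/=.
  apply: (@le_trans _ _ (\sum_(j < m) exp_coeff At (K + j)%N)).
    by apply: ler_sum => j _; exact: dsum.
  by rewrite /eps lerBrDl (le_trans _ (expleq (K + m)%N))// [leRHS]big_split_ord.
have cb : cvgn (series (fun n => normc (b n))).
  apply: nondecreasing_is_cvgn.
    by apply: nondecreasing_series => n _ _; exact: normc_ge0.
  exists (expR At) => _ [L _ <-]; rewrite series_ord.
  have := bd 0%N L; rewrite /eps big_ord0 subr0; apply: le_trans.
  by apply: ler_sum => n _; rewrite big_ord0 subr0.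
have [B hB] := abs_cvgc cb.
suff AB : cexp A = B by exists b; rewrite AB.
apply: (cvgc_unique (cexp_series A)); apply: cvgc_le eps0 => K.
have h : cvgc (fun L => \sum_(n < L) b n - \sum_(n < L) \sum_(j < K) d j n)
              (B - \sum_(j < K) cexp_coeff A j).
  apply: cvgcB => //; under eq_fun do rewrite exchange_big/=.
  apply: cvgc_sum => j; rewrite /d; under eq_fun do rewrite -mulr_suml.
  rewrite /cexp_coeff mulrC; under eq_fun do rewrite mulrC.
  by apply: cvgcMl; exact: (conv_pow_series j ca aA).2.
apply: (cvgc_normc_le h) => L; rewrite -sumrB.
exact: le_trans (normc_sum _ _ _) (bd K L).
Qed.

Lemma cvg_normc_geometric (f : nat -> R[i]) (M : R) z :
  (forall n, normc (f n) <= M) -> normc z < 1 ->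
  cvgn (series (fun n => normc (f n * z ^+ n))).
Proof.
move=> fM z1.
have h : cvgn (series (geometric M (normc z))).
  by apply: is_cvg_geometric_series; rewrite ger0_norm ?normc_ge0.
apply: series_le_cvg h => n.
- exact: normc_ge0.
- by rewrite /geometric/= mulr_ge0 ?exprn_ge0 ?normc_ge0// (le_trans _ (fM 0%N)) ?normc_ge0.
- by rewrite /geometric/= Normc.normcM normcX ler_wpM2r ?exprn_ge0 ?normc_ge0.
Qed.

(* The n-th coefficient is sum_j (f^j)_n / j!, where f^j is the j-th convolution
   power; it is read off at z = 1/2 and shown not to depend on z. *)
Lemma cexp_of_power_series (f : nat -> R[i]) (M : R) :
  (forall n, normc (f n) <= M) ->
  exists b : nat -> R[i], forall z, normc z < 1 ->
    cvgn (series (fun n => normc (b n * z ^+ n))) /\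
    forall F, cvgc (fun n => \sum_(i < n) f i * z ^+ i) F ->
      cvgc (fun n => \sum_(i < n) b i * z ^+ i) (cexp F).
Proof.
move=> fM.
have key z : normc z < 1 -> exists b : nat -> R[i],
    (forall n, cvgc (fun K => \sum_(j < K) conv_pow f j n * z ^+ n / j`!%:R) (b n)) /\
    cvgn (series (fun n => normc (b n))) /\
    forall F, cvgc (fun n => \sum_(i < n) f i * z ^+ i) F ->
      cvgc (fun n => \sum_(i < n) b i) (cexp F).
  move=> z1; have h := cvg_normc_geometric fM z1.
  have [A hA] := abs_cvgc h; have [b [h1 h2 h3]] := cexp_of_series h hA.
  exists b; split; last by split=> // F hF; rewrite (cvgc_unique hF hA).
  by move=> n; apply: eq_cvgc (h1 n) => K; apply: eq_bigr => j _; rewrite conv_pow_scale.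
have h2 : normc (2^-1 : R[i]) < 1.
  by rewrite Normc.normcV (normc_nat 2) invf_lt1// ltr1n.
have [b2 [b2P _]] := key _ h2.
exists (fun n => b2 n * 2 ^+ n) => z z1.
have [b [bP1 [bP2 bP3]]] := key _ z1.
suff e n : b2 n * 2 ^+ n * z ^+ n = b n.
  split; first by under eq_fun do rewrite e.
  by move=> F /bP3; apply: eq_cvgc => n; under [RHS]eq_bigr do rewrite e.
apply: cvgc_unique (bP1 n).
have := cvgcMl (2 ^+ n * z ^+ n) (b2P n).
have -> : b2 n * 2 ^+ n * z ^+ n = 2 ^+ n * z ^+ n * b2 n by ring.
apply: eq_cvgc => K; rewrite mulr_sumr; apply: eq_bigr => j _.
have : (2 : R[i]) ^+ n != 0 by rewrite expf_neq0// pnatr_eq0.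
have := factC_neq0 j; rewrite exprVn => hj hn.
by field; rewrite hn hj.
Qed.

End exponential.

(** * Roots of unity *)

HB.lock Definition uroot (R : realType) (Q : nat) : R[i] :=
  cexp (0 +i* (2 * pi * Q%:R^-1)).

Section roots_of_unity.
Variable R : realType.
Local Notation normc := (@Normc.normc R).
Local Notation uroot := (@uroot R).

Arguments conjc : simpl never.
Arguments cexp : simpl never.
Arguments Normc.normc : simpl never.

Lemma conjcM (x y : R[i]) : (x * y)^*%C = x^*%C * y^*%C.
Proof. exact: rmorphM. Qed.

Lemma conjcX (x : R[i]) n : (x ^+ n)^*%C = x^*%C ^+ n.
Proof. exact: rmorphXn. Qed.

Lemma conjc_sum (I : Type) (r : seq I) (P : pred I) (F : I -> R[i]) :
  (\sum_(i <- r | P i) F i)^*%C = \sum_(i <- r | P i) (F i)^*%C.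
Proof. exact: rmorph_sum. Qed.

Lemma uroot_exp Q k : uroot Q ^+ k = cexp (0 +i* (2 * pi * (k%:R / Q%:R))).
Proof.
rewrite uroot.unlock -cexpMn; congr (cexp _); rewrite -[LHS]mulr_natr.
have h (x : R) : (0 +i* x) * k%:R = 0 +i* (x * k%:R).
  have -> : k%:R = (k%:R)%:C :> R[i] by rewrite rmorph_nat.
  by simpc.
by rewrite h; congr (_ +i* _); ring.
Qed.

Lemma normc_uroot Q : normc (uroot Q) = 1.
Proof. by rewrite uroot.unlock normc_cexp expR0. Qed.

Lemma uroot_neq0 Q : uroot Q != 0.
Proof.
by apply/eqP => h; have := normc_uroot Q; rewrite h Normc.normc0 => /eqP; rewrite eq_sym oner_eq0.
Qed.

Lemma uroot_conj Q : (uroot Q)^*%C = (uroot Q)^-1.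
Proof.
apply: (mulfI (uroot_neq0 Q)); rewrite mulcJ normc_uroot expr1n divff//.
exact: uroot_neq0.
Qed.

Lemma uroot_expQ Q : (0 < Q)%N -> uroot Q ^+ Q = 1.
Proof.
move=> Q0; rewrite uroot_exp divff ?pnatr_eq0 -?lt0n// mulr1 /cexp/= expR0.
rewrite mul1r mulrC mulr_natr.
rewrite mulr2n sinD cosD cospi sinpi mulr0 mulN1r opprK mul0r subr0.
by rewrite mulr0 addr0.
Qed.

Lemma uroot_exp_neq1 Q k : (0 < k < Q)%N -> uroot Q ^+ k != 1.
Proof.
move=> /andP[k0 kQ]; rewrite uroot_exp /cexp/= expR0 mul1r.
apply/eqP => -[h _]; move: h.
(* The half angle pi k / Q lies in the interval (0, pi), where sine is positive, so cos (2 pi k / Q)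
   = 1 - 2 sin^2 (pi k / Q) < 1. *)
have Q0 : 0 < Q%:R :> R by rewrite ltr0n (leq_trans _ kQ).
set x := k%:R / Q%:R; have -> : 2 * pi * x = (pi * x) *+ 2 by rewrite -mulr_natr; ring.
have : 0 < sin (pi * x).
  apply: sin_gt0_pi; apply/andP; split; first by rewrite mulr_gt0 ?pi_gt0// /x divr_gt0// ltr0n.
  by rewrite gtr_pMr ?pi_gt0// /x ltr_pdivrMr// mul1r ltr_nat.
rewrite mulr2n cosD -!expr2 => s0.
have := cos2Dsin2 (pi * x); nra.
Qed.

Lemma sum_uroot Q n : (0 < Q)%N ->
  \sum_(k < Q) (uroot Q ^+ n) ^+ k = if (Q %| n)%N then Q%:R else 0.
Proof.
move=> Q0.
have e : uroot Q ^+ n = uroot Q ^+ (n %% Q).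
  by rewrite {1}(divn_eq n Q) exprD mulnC exprM uroot_expQ// expr1n mul1r.
case: ifPn => [/dvdnP[q ->]|nQ].
  under eq_bigr do rewrite mulnC exprM uroot_expQ// !expr1n.
  by rewrite sumr_const card_ord.
have h : uroot Q ^+ n - 1 != 0.
  by rewrite subr_eq0 e uroot_exp_neq1// ltn_mod Q0 andbT lt0n; rewrite /dvdn in nQ.
apply: (mulfI h); rewrite mulr0 -subrX1 -exprM mulnC exprM uroot_expQ//.
by rewrite expr1n subrr.
Qed.

Lemma uroot_orth Q i j : (i < Q)%N -> (j < Q)%N ->
  \sum_(k < Q) (uroot Q ^+ i * (uroot Q)^*%C ^+ j) ^+ k = if i == j then Q%:R else 0.
Proof.
move=> iQ jQ; have Q0 : (0 < Q)%N by rewrite (leq_trans _ iQ).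
have u0 := uroot_neq0 Q.
wlog ij : i j iQ jQ / (j <= i)%N => [hw|].
  have [/hw|ij] := leqP j i; first exact.
  have := hw j i jQ iQ (ltnW ij); rewrite eq_sym => h.
  apply: (can_inj (@conjcK R)); rewrite conjc_sum.
  have -> : (if i == j then Q%:R else 0 : R[i])^*%C = if i == j then Q%:R else 0.
    by case: ifP; rewrite ?conjc_nat ?conjc0.
  rewrite -h; apply: eq_bigr => k _.
  by rewrite conjcX conjcM !conjcX conjcK mulrC.
have -> : uroot Q ^+ i * (uroot Q)^*%C ^+ j = uroot Q ^+ (i - j).
  by rewrite uroot_conj exprVn expfB_cond ?(negbTE u0)//.
rewrite sum_uroot//; have -> : (Q %| i - j)%N = (i == j) => //.
have h : (i - j < Q)%N by rewrite (leq_ltn_trans _ iQ)// leq_subr.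
apply/idP/eqP => [|->]; last by rewrite subnn dvdn0.
by rewrite /dvdn modn_small// subn_eq0 => ij'; apply/eqP; rewrite eqn_leq ij ij'.
Qed.

(** Parseval's identity for the finite Fourier transform on Z/Q. *)
Lemma discrete_parseval Q (A : nat -> R[i]) :
  \sum_(k < Q) normc (\sum_(j < Q) A j * uroot Q ^+ (k * j)) ^+ 2 =
  Q%:R * \sum_(j < Q) normc (A j) ^+ 2.
Proof.
apply: complexI; rewrite rmorphM rmorph_nat !rmorph_sum/=.
under eq_bigr do rewrite -mulcJ conjc_sum mulr_suml.
under eq_bigr do under eq_bigr do rewrite mulr_sumr.
rewrite exchange_big/= mulr_sumr; apply: eq_bigr => i _.
rewrite exchange_big/= (bigD1 i)//= [X in _ + X]big1 ?addr0 => [|j ji].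
  rewrite -mulcJ mulrC -[X in _ * X](_ : \sum_(k < Q) (uroot Q ^+ i * (uroot Q)^*%C ^+ i) ^+ k = _).
    rewrite mulr_sumr; apply: eq_bigr => k _.
    by rewrite conjcM conjcX exprMn -!exprM ![(k * _)%N]mulnC; ring.
  by rewrite uroot_orth// eqxx.
transitivity (A i * (A j)^*%C * \sum_(k < Q) (uroot Q ^+ i * (uroot Q)^*%C ^+ j) ^+ k).
  rewrite mulr_sumr; apply: eq_bigr => k _.
  by rewrite conjcM conjcX exprMn -!exprM ![(k * _)%N]mulnC; ring.
by rewrite uroot_orth// ifN ?mulr0// eq_sym.
Qed.

Lemma sum_blocks (V : zmodType) (F : nat -> V) L Q :
  \sum_(n < L * Q) F n = \sum_(l < L) \sum_(j < Q) F (l * Q + j)%N.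
Proof.
elim: L => [|L IH]; first by rewrite !big_ord0.
by rewrite mulSnr big_split_ord/= IH big_ord_recr.
Qed.

(** By Lagrange's identity the difference is half a sum of squares. *)
Lemma cauchy_schwarz_sum n (x y : nat -> R) :
  (\sum_(i < n) x i * y i) ^+ 2 <= (\sum_(i < n) x i ^+ 2) * (\sum_(i < n) y i ^+ 2).
Proof.
rewrite -subr_ge0.
have -> : (\sum_(i < n) x i ^+ 2) * (\sum_(i < n) y i ^+ 2) - (\sum_(i < n) x i * y i) ^+ 2 =
  2^-1 * \sum_(i < n) \sum_(j < n) (x i * y j - x j * y i) ^+ 2.
  have e1 : \sum_(i < n) \sum_(j < n) (x i ^+ 2 * y j ^+ 2) = (\sum_(i < n) x i ^+ 2) * (\sum_(i < n) y i ^+ 2).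
    by rewrite mulr_suml; apply: eq_bigr => i _; rewrite mulr_sumr.
  have e2 : \sum_(i < n) \sum_(j < n) (x j ^+ 2 * y i ^+ 2) = (\sum_(i < n) x i ^+ 2) * (\sum_(i < n) y i ^+ 2).
    by rewrite exchange_big e1.
  have e3 : \sum_(i < n) \sum_(j < n) ((x i * y i) * (x j * y j)) = (\sum_(i < n) x i * y i) ^+ 2.
    by rewrite expr2 mulr_suml; apply: eq_bigr => i _; rewrite mulr_sumr.
  have sq i j : (x i * y j - x j * y i) ^+ 2 = x i ^+ 2 * y j ^+ 2 + x j ^+ 2 * y i ^+ 2 - 2 * (x i * y i * (x j * y j)) by ring.
  under [in RHS]eq_bigr => i _ do under eq_bigr => j _ do
    rewrite sq.
  under [in RHS]eq_bigr do rewrite sumrB big_split/= -[X in _ - X]mulr_sumr.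
  by rewrite sumrB big_split/= -mulr_sumr e1 e2 e3; field.
by rewrite mulr_ge0 ?invr_ge0// sumr_ge0// => i _; rewrite sumr_ge0// => j _; rewrite sqr_ge0.
Qed.

End roots_of_unity.

(** * Boundedness of F from square summable coefficients *)

Section h2_bound.
Variable R : realType.
Local Notation normc := (@Normc.normc R).
Local Notation uroot := (@uroot R).

Lemma cvgn_mulnr Q : (0 < Q)%N -> (fun n => n * Q)%N @ \oo --> \oo.
Proof.
move=> Q0; apply/cvgnyPge => k; exists k => // n /= kn.
by rewrite (leq_trans kn)// leq_pmulr.
Qed.

Lemma normc_uroot_mul Q k (z : R[i]) : normc (uroot Q ^+ k * z) = normc z.
Proof. by rewrite Normc.normcM normcX normc_uroot expr1n mul1r. Qed.

(* Averaging over rotations by Q-th roots of unity keeps the terms of index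
   divisible by Q. *)
Lemma average_roots (g : nat -> R[i]) (G : R[i] -> R[i]) Q z : (0 < Q)%N ->
  (forall z, normc z < 1 -> cvgc (fun n => \sum_(i < n) g i * z ^+ i) (G z)) ->
  (forall n, g (n * Q)%N = g n) -> normc z < 1 ->
  \sum_(k < Q) G (uroot Q ^+ k * z) = Q%:R * G (z ^+ Q).
Proof.
move=> Q0 hG gQ z1.
have h1 : cvgc (fun n => \sum_(k < Q) \sum_(i < n * Q) g i * (uroot Q ^+ k * z) ^+ i)
              (\sum_(k < Q) G (uroot Q ^+ k * z)).
  apply: cvgc_sum => k.
  apply: (cvgc_comp (u := fun n => \sum_(i < n) g i * (uroot Q ^+ k * z) ^+ i) (cvgn_mulnr Q0)).
  by apply: hG; rewrite normc_uroot_mul.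
apply: (cvgc_unique h1); have zQ : normc (z ^+ Q) < 1.
  by rewrite normcX exprn_ilt1 ?normc_ge0// -lt0n.
apply: eq_cvgc (cvgcMl Q%:R (hG _ zQ)) => n.
have e i : \sum_(k < Q) g i * (uroot Q ^+ k * z) ^+ i =
    g i * z ^+ i * (if (Q %| i)%N then Q%:R else 0).
  rewrite -sum_uroot// mulr_sumr; apply: eq_bigr => k _.
  by rewrite exprMn -!exprM mulnC; ring.
rewrite exchange_big/=; under [RHS]eq_bigr do rewrite e.
rewrite (sum_blocks (fun i => g i * z ^+ i * (if (Q %| i)%N then Q%:R else 0))).
rewrite mulr_sumr; apply: eq_bigr => l _.
case: Q Q0 gQ {h1 zQ e} => // Q _ gQ.
rewrite big_ord_recl/= addn0 dvdn_mull// gQ big1 ?addr0 => [|i _].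
  by rewrite -exprM mulnC mulrC.
rewrite dvdn_addr ?dvdn_mull// gtnNdvd ?mulr0//.
by rewrite /bump/= add1n ltnS.
Qed.

(** The graph of exp lies above its tangent at the mean m; the linear terms cancel in the sum. *)
Lemma jensen_expR n (x : nat -> R) (m : R) :
  \sum_(k < n) x k = n%:R * m -> n%:R * expR m <= \sum_(k < n) expR (x k).
Proof.
move=> xm; apply: (@le_trans _ _ (\sum_(k < n) expR m * (1 + (x k - m)))).
  rewrite -mulr_sumr big_split/= sumrB xm !sumr_const card_ord.
  by rewrite -[m *+ n]mulr_natl subrr addr0 mulrC.
apply: ler_sum => k _; rewrite -{2}[x k](subrKC m) expRD.
by rewrite ler_wpM2l ?expR_ge0// expR_ge1Dx.
Qed.

Lemma sum_geometric_le (x : R) n : 0 <= x < 1 -> \sum_(i < n) x ^+ i <= (1 - x)^-1.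
Proof.
move=> /andP[x0 x1]; rewrite -[leRHS]mul1r ler_pdivlMr ?subr_gt0// mulrC.
by rewrite -[1 - x]opprB mulNr -subrX1 opprB lerBlDr lerDl exprn_ge0.
Qed.

(** The first term of the residue class of j is kept apart. The others are bounded by Cauchy-Schwarz
    against the powers of r = |z^Q|, so that the constant depends on z^Q only and does not grow with
    Q when z^Q is fixed. *)
Lemma block_norm_sqr (b : nat -> R[i]) z Q L j : (0 < Q)%N -> normc z < 1 ->
  normc (\sum_(l < L.+1) b (l * Q + j)%N * z ^+ (l * Q + j)) ^+ 2 <=
  2 * normc (b j) ^+ 2 +
  2 * (1 - normc (z ^+ Q) ^+ 2)^-1 * \sum_(l < L) normc (b (l.+1 * Q + j)%N) ^+ 2.
Proof.
move=> Q0 z1; set r := normc (z ^+ Q); set D := (1 - r ^+ 2)^-1.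
have z0 := normc_ge0 z.
have r0 : 0 <= r by exact: normc_ge0.
have r1 : r < 1 by rewrite /r normcX exprn_ilt1// -lt0n.
have D0 : 0 <= D by rewrite invr_ge0 subr_ge0 exprn_ile1// ltW.
pose X := \sum_(l < L) normc (b (l.+1 * Q + j)%N) * r ^+ l.
have hX : normc (\sum_(l < L.+1) b (l * Q + j)%N * z ^+ (l * Q + j)) <= normc (b j) + X.
  rewrite big_ord_recl/= mul0n add0n (le_trans (le_normcD _ _))// lerD//.
    by rewrite Normc.normcM normcX ler_piMr ?normc_ge0// exprn_ile1// ltW.
  rewrite (le_trans (normc_sum _ _ _))// ler_sum// => l _.
  rewrite Normc.normcM ler_wpM2l ?normc_ge0// /bump/= add1n normcX.
  rewrite /r normcX -exprM; apply: ler_wiXn2l; [exact: normc_ge0|exact: ltW|].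
  by rewrite mulSn mulnC -addnA addnCA leq_addr.
have X0 : 0 <= X by apply: sumr_ge0 => l _; rewrite mulr_ge0 ?normc_ge0// exprn_ge0.
have X2 : X ^+ 2 <= D * \sum_(l < L) normc (b (l.+1 * Q + j)%N) ^+ 2.
  apply: le_trans (cauchy_schwarz_sum L (fun l => normc (b (l.+1 * Q + j)%N)) (fun l => r ^+ l)) _.
  rewrite mulrC ler_wpM2r ?sumr_ge0// => [l _|]; first exact: sqr_ge0.
  under eq_bigr do rewrite -exprM mulnC exprM.
  by apply: sum_geometric_le; rewrite sqr_ge0 exprn_ilt1.
apply: (@le_trans _ _ ((normc (b j) + X) ^+ 2)).
  by rewrite ler_pXn2r// ?nnegrE ?addr_ge0 ?normc_ge0.
rewrite -mulrA; move: X2; set Y := D * _; move: (normc (b j)) => B h.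
have := sqr_ge0 (B - X); nra.
Qed.

(* Let Q = N^m and z^Q = z0. Since g_(nQ) = g_n, the value G(z0) is the mean of
   G over the Q-th roots of z0, so Jensen's inequality bounds |exp(G(z0))|^2 by
   the mean of |exp(G)|^2 over these roots, which Parseval evaluates. *)
Lemma h2_radial_bound (g b : nat -> R[i]) (G : R[i] -> R[i]) (S : R) N z0 :
  (1 < N)%N ->
  (forall z, normc z < 1 -> cvgc (fun n => \sum_(i < n) g i * z ^+ i) (G z)) ->
  (forall z, normc z < 1 -> cvgc (fun n => \sum_(i < n) b i * z ^+ i) (cexp (G z))) ->
  (forall n, g (n * N)%N = g n) ->
  series (fun n => normc (b n) ^+ 2) @ \oo --> S ->
  normc z0 < 1 -> normc (cexp (G z0)) ^+ 2 <= 2 * S.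
Proof.
move=> N1 hG hb gN hS z01.
pose s n := \sum_(i < n) normc (b i) ^+ 2.
have sS n : s n <= S.
  rewrite -(cvg_lim _ hS)//.
  have := @nondecreasing_cvgn_le _ (series (fun n => normc (b n) ^+ 2)) _ (cvgP _ hS) n.
  rewrite {2}series_ord; apply.
  by apply: nondecreasing_series => k _ _; exact: sqr_ge0.
pose D := (1 - normc z0 ^+ 2)^-1.
have D0 : 0 <= D by rewrite invr_ge0 subr_ge0 exprn_ile1 ?normc_ge0// ltW.
(* [D] depends on z0 alone, so the second term vanishes as m grows. *)
have key m : normc (cexp (G z0)) ^+ 2 <= 2 * S + 2 * D * (S - s (N ^ m)%N).
  set Q := (N ^ m)%N; have Q0 : (0 < Q)%N by rewrite expn_gt0 (ltnW N1).
  pose z := Q.-root z0; have zQ : z ^+ Q = z0 by rewrite /z rootCK.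
  have z1 : normc z < 1.
    rewrite ltNge; apply/negP => h; move: z01; rewrite -zQ normcX ltNge.
    by rewrite exprn_ege1.
  have gQ n : g (n * Q)%N = g n.
    rewrite /Q; elim: (m) n => [|k IH] n; first by rewrite expn0 muln1.
    by rewrite expnSr mulnA gN IH.
  have Qr : 0 < Q%:R :> R by rewrite ltr0n.
  rewrite -(ler_pM2l Qr).
  pose x k := complex.Re (G (uroot Q ^+ k * z)) * 2.
  have e2 w : normc (cexp w) ^+ 2 = expR (complex.Re w * 2).
    by rewrite normc_cexp -expRM_natr.
  have h1 : Q%:R * normc (cexp (G z0)) ^+ 2 <= \sum_(k < Q) normc (cexp (G (uroot Q ^+ k * z))) ^+ 2.
    rewrite e2; under eq_bigr do rewrite e2.
    apply: (jensen_expR (x := x)); rewrite /x -mulr_suml -Re_sum.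
    rewrite (average_roots Q0 hG gQ z1) zQ mulrA; congr (_ * _).
    have -> : Q%:R = (Q%:R)%:C :> R[i] by rewrite rmorph_nat.
 by rewrite Re_realM.
  apply: le_trans h1 _.
  (* Partial sums are cut at multiples of Q: collected by residue classes, they become the finite
     Fourier transform of [A] below, ready for [discrete_parseval]. *)
  have h2 : (fun L => \sum_(k < Q) normc (\sum_(i < L.+1 * Q) b i * (uroot Q ^+ k * z) ^+ i) ^+ 2) @ \oo -->
      \sum_(k < Q) normc (cexp (G (uroot Q ^+ k * z))) ^+ 2.
    apply: sum_cvg => k; under eq_fun do rewrite expr2; rewrite expr2.
    have h : (fun L => normc (\sum_(i < L.+1 * Q) b i * (uroot Q ^+ k * z) ^+ i)) @ \oo -->
       normc (cexp (G (uroot Q ^+ k * z))).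
      apply: cvgc_normc.
      apply: (cvgc_comp (u := fun n => \sum_(i < n) b i * (uroot Q ^+ k * z) ^+ i)).
        apply/cvgnyPge => p; exists p => // n /= pn.
        by rewrite (leq_trans pn)// (leq_trans (leqnSn n))// leq_pmulr.
      by apply: hb; rewrite normc_uroot_mul.
    by apply: cvgM; exact: h.
  apply: (cvg_le_cst h2) => L.
  pose A j := \sum_(l < L.+1) b (l * Q + j)%N * z ^+ (l * Q + j).
  have e k : \sum_(i < L.+1 * Q) b i * (uroot Q ^+ k * z) ^+ i =
             \sum_(j < Q) A j * uroot Q ^+ (k * j).
    rewrite (sum_blocks (fun i => b i * (uroot Q ^+ k * z) ^+ i)) exchange_big/=.
    apply: eq_bigr => j _; rewrite /A mulr_suml; apply: eq_bigr => l _.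
    rewrite exprMn -exprM -mulrA; congr (_ * _); rewrite mulrC; congr (_ * _).
    have h : uroot Q ^+ (k * (l * Q)) = 1.
      by rewrite mulnA mulnC exprM uroot_expQ// expr1n.
    by rewrite mulnDr exprD h mul1r.
  under eq_bigr do rewrite e.
  rewrite discrete_parseval ler_pM2l//.
  apply: (@le_trans _ _ (\sum_(j < Q) (2 * normc (b j) ^+ 2 +
      2 * (1 - normc (z ^+ Q) ^+ 2)^-1 * \sum_(l < L) normc (b (l.+1 * Q + j)%N) ^+ 2))).
    by apply: ler_sum => j _; exact: block_norm_sqr.
  rewrite big_split/= -!mulr_sumr zQ -/D lerD//.
    by rewrite ler_wpM2l// sS.
  rewrite ler_wpM2l//; first by rewrite mulr_ge0.
  rewrite exchange_big/= lerBrDl.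
  rewrite (le_trans _ (sS (L.+1 * Q)%N))// /s (sum_blocks (fun i => normc (b i) ^+ 2)).
  by rewrite big_ord_recl/=.
have hs : (fun m => s (N ^ m)%N) @ \oo --> S.
  have h : s @ \oo --> S by move: hS; rewrite series_ord.
  apply: cvg_comp h.
  apply/cvgnyPge => p; exists p => // n /= pn.
  by rewrite (leq_trans pn)// ltnW// ltn_expl.
have hl : (fun m => 2 * S + 2 * D * (S - s (N ^ m)%N)) @ \oo --> 2 * S + 2 * D * (S - S).
  apply: cvgD; first exact: cvg_cst.
  apply: cvgM; first exact: cvg_cst.
  by apply: cvgB => //; exact: cvg_cst.
rewrite subrr mulr0 addr0 in hl.
rewrite -(cvg_lim _ hl)//; apply: limr_ge; first exact: cvgP hl.
exact: nearW.
Qed.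

End h2_bound.

(** * Finite measures on the circle *)

Section bounded_measurable.
Context d (T : measurableType d) (R : realType).
Implicit Types (f g : T -> R) (m n p : {measure set T -> \bar R}).

(** A class stable under sums and products and integrable for every finite measure, which settles
    all integrability conditions below. *)
Definition bounded_mfun f : Prop :=
  measurable_fun setT f /\ exists M, forall x, `|f x| <= M.

Lemma bounded_mfun_cst (a : R) : bounded_mfun (fun=> a).
Proof. by split=> //; exists `|a|. Qed.

Lemma bounded_mfunD f g : bounded_mfun f -> bounded_mfun g ->
  bounded_mfun (fun x => f x + g x).
Proof.
move=> [mf [M hM]] [mg [K hK]]; split; first exact: measurable_funD.
by exists (M + K) => x; rewrite (le_trans (ler_normD _ _))// lerD.
Qed.

Lemma bounded_mfunM f g : bounded_mfun f -> bounded_mfun g ->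
  bounded_mfun (fun x => f x * g x).
Proof.
move=> [mf [M hM]] [mg [K hK]]; split; first exact: measurable_funM.
by exists (M * K) => x; rewrite normrM ler_pM.
Qed.

Lemma bounded_mfunZ (a : R) f : bounded_mfun f -> bounded_mfun (fun x => a * f x).
Proof. by move=> hf; apply: bounded_mfunM => //; exact: bounded_mfun_cst. Qed.

Lemma bounded_mfunB f g : bounded_mfun f -> bounded_mfun g ->
  bounded_mfun (fun x => f x - g x).
Proof.
move=> hf hg; have := bounded_mfunD hf (bounded_mfunZ (-1) hg).
by under eq_fun do rewrite mulN1r.
Qed.

Lemma bounded_mfun_sum (I : Type) (r : seq I) (F : I -> T -> R) :
  (forall i, bounded_mfun (F i)) -> bounded_mfun (fun x => \sum_(i <- r) F i x).
Proof.
move=> hF; elim: r => [|i r IH].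
  by under eq_fun do rewrite big_nil; exact: bounded_mfun_cst.
by under eq_fun do rewrite big_cons; exact: bounded_mfunD.
Qed.

Lemma bounded_mfun_integrable m f : (m setT < +oo)%E -> bounded_mfun f ->
  m.-integrable setT (EFin \o f).
Proof.
move=> mT [mf [M hM]]; apply: measurable_bounded_integrable => //.
by exists M; split; [exact: num_real|move=> x Mx y _; exact: le_trans (hM y) (ltW Mx)].
Qed.

Section finite_measure.
Variable m : {measure set T -> \bar R}.
Hypothesis mT : (m setT < +oo)%E.

Lemma bintegralD f g : bounded_mfun f -> bounded_mfun g ->
  Rintegral m setT (fun x => f x + g x) = Rintegral m setT f + Rintegral m setT g.
Proof. by move=> hf hg; rewrite RintegralD//; exact: bounded_mfun_integrable. Qed.

Lemma bintegralB f g : bounded_mfun f -> bounded_mfun g ->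
  Rintegral m setT (fun x => f x - g x) = Rintegral m setT f - Rintegral m setT g.
Proof. by move=> hf hg; rewrite RintegralB//; exact: bounded_mfun_integrable. Qed.

Lemma bintegralZ (a : R) f : bounded_mfun f ->
  Rintegral m setT (fun x => a * f x) = a * Rintegral m setT f.
Proof. by move=> hf; rewrite RintegralZl//; exact: bounded_mfun_integrable. Qed.

Lemma bintegral_cst (a : R) : Rintegral m setT (fun=> a) = a * fine (m setT).
Proof. exact: Rintegral_cst. Qed.

Lemma bintegral_sum (I : Type) (r : seq I) (F : I -> T -> R) :
  (forall i, bounded_mfun (F i)) ->
  Rintegral m setT (fun x => \sum_(i <- r) F i x) =
  \sum_(i <- r) Rintegral m setT (F i).
Proof.
move=> hF; elim: r => [|i r IH].
  under eq_Rintegral do rewrite big_nil.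
  by rewrite big_nil bintegral_cst mul0r.
under eq_Rintegral do rewrite big_cons.
by rewrite big_cons bintegralD// ?IH//; exact: bounded_mfun_sum.
Qed.

Lemma le_bintegral f g : bounded_mfun f -> bounded_mfun g -> (forall x, f x <= g x) ->
  Rintegral m setT f <= Rintegral m setT g.
Proof. by move=> hf hg fg; apply: le_Rintegral => //; exact: bounded_mfun_integrable. Qed.

Lemma bintegral_dist f g (e : R) : bounded_mfun f -> bounded_mfun g ->
  (forall x, `|f x - g x| <= e) ->
  `|Rintegral m setT f - Rintegral m setT g| <= e * fine (m setT).
Proof.
move=> hf hg fg; rewrite -bintegralB// ler_norml -mulNr -!bintegral_cst.
by apply/andP; split; apply: le_bintegral; do ?[exact: bounded_mfun_cst|exact: bounded_mfunB];
  move=> x; move: (fg x); rewrite ler_norml => /andP[].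
Qed.

End finite_measure.

Lemma bintegral_measure_eq m n f : (forall A, measurable A -> m A = n A) ->
  Rintegral m setT f = Rintegral n setT f.
Proof. by move=> mn; congr fine; apply: eq_measure_integral => A mA _; exact: mn. Qed.

Lemma bintegral_measure_add m n f : (m setT < +oo)%E -> (n setT < +oo)%E ->
  bounded_mfun f -> Rintegral (measure_add m n) setT f =
  Rintegral m setT f + Rintegral n setT f.
Proof.
move=> mT nT hf; have mf := bounded_mfun_integrable mT hf.
have nf := bounded_mfun_integrable nT hf.
have h := integral_measure_add measurableT mf nf.
by rewrite /Rintegral [X in fine X = _]h fineD//; exact: integrable_fin_num.
Qed.

Lemma measure_addT_lty m n : (m setT < +oo)%E -> (n setT < +oo)%E ->
  (measure_add m n setT < +oo)%E.
Proof. by move=> mT nT; rewrite measure_addE lte_add_pinfty. Qed.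

(** m - n = m' - n' is written as m + n' = m' + n, an identity between measures. *)
Lemma bintegral_difference m n m' n' f :
  (m setT < +oo)%E -> (n setT < +oo)%E -> (m' setT < +oo)%E -> (n' setT < +oo)%E ->
  (forall A, measurable A -> m A + n' A = m' A + n A)%E ->
  bounded_mfun f ->
  Rintegral m setT f - Rintegral n setT f = Rintegral m' setT f - Rintegral n' setT f.
Proof.
move=> mT nT mT' nT' h hf.
have : Rintegral (measure_add m n') setT f = Rintegral (measure_add m' n) setT f.
  apply: bintegral_measure_eq => A mA.
  transitivity (m A + n' A)%E; first exact: measure_addE.
  by rewrite h//; apply/esym; exact: measure_addE.
by rewrite !bintegral_measure_add// => /eqP; rewrite eq_sym -subr_eq addrAC => /eqP <-; rewrite addrK.
Qed.

Lemma charge_posB (mu : {charge set T -> \bar R}) A : measurable A ->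
  mu A = (charge_pos mu A - charge_neg mu A)%E.
Proof.
move=> mA; rewrite (jordan_decomp (projT2 (projT2 (hahn_choice mu))) mA) /cadd.
congr (_ + _)%E; rewrite /cscale EFinN.
exact: mulN1e.
Qed.

(** This frees the integral from the chosen Jordan decomposition: any pair of finite measures with
    difference mu computes it. *)
Lemma charge_integralE (mu : {charge set T -> \bar R}) m n f :
  (m setT < +oo)%E -> (n setT < +oo)%E ->
  (forall A, measurable A -> mu A = m A - n A)%E -> bounded_mfun f ->
  charge_integral mu f = Rintegral m setT f - Rintegral n setT f.
Proof.
move=> mT nT h hf; rewrite /charge_integral.
have fin A : measurable A -> (charge_pos mu A \is a fin_num) /\ (charge_neg mu A \is a fin_num).
  by move=> mA; split; rewrite /charge_pos /charge_neg fin_num_measure.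
have [pT nT'] := fin _ measurableT.
apply: bintegral_difference => //; rewrite ?ltey_eq ?pT ?nT'//.
move=> A mA; have [pA nA] := fin _ mA.
have mA' : m A \is a fin_num.
  by rewrite ge0_fin_numE// (le_lt_trans _ mT)// le_measure// ?inE.
have nA' : n A \is a fin_num.
  by rewrite ge0_fin_numE// (le_lt_trans _ nT)// le_measure// ?inE.
have := charge_posB mu mA; rewrite h// => {}h; move: h.
rewrite -(fineK mA') -(fineK nA') -(fineK pA) -(fineK nA) => -[] h.
by rewrite -!EFinD; congr (_%:E); lra.
Qed.

End bounded_measurable.

Section pushforward_integral.
Context d d' (T : measurableType d) (T' : measurableType d') (R : realType).

Lemma bounded_mfun_comp (phi : T -> T') (f : T' -> R) :
  measurable_fun setT phi -> bounded_mfun f -> bounded_mfun (f \o phi).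
Proof.
move=> mphi [mf [M hM]]; split; first exact: measurableT_comp.
by exists M => x; exact: hM.
Qed.

Lemma bintegral_pushforward (m : {measure set T -> \bar R}) (phi : T -> T')
    (mphi : measurable_fun setT phi) (f : T' -> R) :
  (m setT < +oo)%E -> bounded_mfun f ->
  Rintegral (measure_function_pushforward__canonical__measure_function_Measure m mphi) setT f =
  Rintegral m setT (f \o phi).
Proof.
move=> mT hf; congr fine; rewrite (@integral_pushforward _ _ _ _ _ _ mphi)//.
  exact/measurable_EFinP/hf.1.
rewrite preimage_setT; apply: (bounded_mfun_integrable mT).
exact: bounded_mfun_comp.
Qed.

End pushforward_integral.

(** * Lipschitz functions on the circle determine finite measures *)

Section circle_functions.
Variable R : realType.
Local Notation normc := (@Normc.normc R).
Implicit Types (x y : circle R) (f : circle R -> R).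

Definition cdist x y : R := normc (circle_val x - circle_val y).

Lemma normc_circle x : normc (circle_val x) = 1.
Proof. by apply: complexI; rewrite -normrcE circle_valP. Qed.

Lemma cdist_ge0 x y : 0 <= cdist x y.
Proof. exact: normc_ge0. Qed.

Lemma cdistC x y : cdist x y = cdist y x.
Proof. exact: normcB. Qed.

Lemma cdistxx x : cdist x x = 0.
Proof. by rewrite /cdist subrr Normc.normc0. Qed.

Lemma cdist_triangle y x z : cdist x z <= cdist x y + cdist y z.
Proof. by rewrite /cdist -{1}(subrK (circle_val y) (circle_val x)) -addrA le_normcD. Qed.

Lemma cdist_le2 x y : cdist x y <= 2.
Proof. by rewrite (le_trans (le_normcB _ _))// !normc_circle. Qed.

(** The subspace topology is that of the chordal distance, so openness can be tested with real
    radii. *)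
Lemma circle_openP (U : set (circle R)) :
  open U <-> forall x, U x -> exists2 e, 0 < e & forall y, cdist x y < e -> U y.
Proof.
split.
  move=> [V oV <-] x /= Vx.
  have /nbhs_ballP[e /= e0 eV] : nbhs (set_val x : R[i]^o) V by exact: open_nbhs_nbhs.
  have [eE re0] := posC_Re e0.
  exists (complex.Re e) => // y xy; apply: eV.
  by rewrite /ball/= eE (normrcE (set_val x - set_val y)) ltcR.
move=> h; rewrite openE => x /h[e e0 hU].
have : nbhs x (set_val @^-1` [set z : R[i]^o | `|(set_val x : R[i]^o) - z| < e%:C]).
  apply: (@initial_continuous _ (R[i]^o) set_val x).
  by apply: nbhsx_ballx; rewrite ltcR.
apply: filterS => y /=; rewrite (normrcE (set_val x - set_val y)) ltcR.
exact: hU.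
Qed.

Lemma lipschitz_bounded_mfun f (L : R) :
  (forall x y, `|f x - f y| <= L * cdist x y) -> bounded_mfun f.
Proof.
move=> fL; split.
  apply: (measurability _ (RGenOInfty.measurableE R)) => _ [_ [a ->] <-].
  rewrite setTI; apply: sub_sigma_algebra.
  apply/circle_openP => x; rewrite /= in_itv/= andbT => ax.
  have L1 : 0 < `|L| + 1 by rewrite ltr_pwDr.
  exists ((f x - a) / (`|L| + 1)); first by rewrite divr_gt0// subr_gt0.
  move=> y; rewrite ltr_pdivlMr// => xy; rewrite in_itv/= andbT.
  have : `|f x - f y| < f x - a.
    apply: le_lt_trans (fL x y) (le_lt_trans _ xy).
    rewrite mulrC ler_wpM2l ?cdist_ge0// (le_trans (ler_norm _))// lerDl.
    by [].
  by rewrite ltr_norml => /andP[_]; lra.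
exists (`|f point| + `|L| * 2) => x.
rewrite -{1}(subrK (f point) (f x)) (le_trans (ler_normD _ _))// addrC lerD//.
rewrite (le_trans (fL _ _))// (@le_trans _ _ (`|L| * cdist x point))//.
  by rewrite ler_wpM2r ?cdist_ge0// ler_norm.
by rewrite ler_wpM2l// cdist_le2.
Qed.

(** When U is the whole circle the infimum of the empty set is 0 by default; hence the recurring
    hypothesis that the complement is nonempty. *)
Definition dist_compl (U : set (circle R)) x : R := inf [set cdist x y | y in ~` U].

Lemma dist_compl_lb (U : set (circle R)) x y : (~` U) y -> dist_compl U x <= cdist x y.
Proof.
move=> Uy; apply: inf_lbound; last by exists y.
by exists 0 => _ [z _ <-]; exact: cdist_ge0.
Qed.

Lemma dist_compl_glb (U : set (circle R)) x e : (~` U) !=set0 ->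
  (forall y, (~` U) y -> e <= cdist x y) -> e <= dist_compl U x.
Proof.
move=> [y Uy] h; apply: lb_le_inf; first by exists (cdist x y), y.
by move=> _ [z Uz <-]; exact: h.
Qed.

Lemma dist_compl_lipschitz (U : set (circle R)) x y : (~` U) !=set0 ->
  dist_compl U x - dist_compl U y <= cdist x y.
Proof.
move=> U0; rewrite lerBlDr addrC -lerBlDr; apply: dist_compl_glb => // z Uz.
by rewrite lerBlDr (le_trans (dist_compl_lb _ Uz))// addrC cdist_triangle.
Qed.

(** Lipschitz functions with values in [0, 1] that converge pointwise to the indicator of an open
    U. *)
Definition bump_fun (U : set (circle R)) (k : nat) x : R :=
  Num.min 1 (k%:R * dist_compl U x).

Lemma bump_fun_lipschitz U k x y : (~` U) !=set0 ->
  `|bump_fun U k x - bump_fun U k y| <= k%:R * cdist x y.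
Proof.
move=> U0; have h u v : k%:R * dist_compl U u - k%:R * dist_compl U v <= k%:R * cdist u v.
  by rewrite -mulrBr ler_wpM2l// dist_compl_lipschitz.
have := h x y; have := h y x; rewrite (cdistC y x) /bump_fun.
have := mulr_ge0 (ler0n R k) (cdist_ge0 x y).
move: (k%:R * dist_compl U x) (k%:R * dist_compl U y) (k%:R * cdist x y) => a b c h0 h1 h2.
case: (leP 1 a) => ?; case: (leP 1 b) => ?; rewrite ler_norml; apply/andP; split; lra.
Qed.

Lemma bump_fun_cvg U x : open U -> (~` U) !=set0 ->
  bump_fun U ^~ x @ \oo --> (\1_U x : R).
Proof.
move=> oU U0; have [Ux|Ux] := pselect (U x).
  have [e e0 he] := (circle_openP U).1 oU x Ux.
  have de : e <= dist_compl U x.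
    by apply: dist_compl_glb => // y Uy; rewrite leNgt; apply/negP => /he.
  rewrite indicE mem_set//=.
  apply: cvg_near_cst; exists (Num.truncn e^-1).+1 => // k /= hk.
  rewrite /bump_fun min_l//.
  apply: (@le_trans _ _ (k%:R * e)); last by rewrite ler_wpM2l.
  rewrite -ler_pdivrMr// mul1r ltW// (lt_le_trans (truncnS_gt _))//.
  by rewrite ler_nat.
have -> : \1_U x = 0 :> R by rewrite indicE memNset.
apply: cvg_near_cst; apply: nearW => k.
have d0 : dist_compl U x = 0.
  apply/eqP; rewrite eq_le -{1}(cdistxx x) dist_compl_lb//= dist_compl_glb//.
  by move=> y _; exact: cdist_ge0.
by rewrite /bump_fun d0 mulr0 minElt ltr10.
Qed.

Lemma bump_fun_ge0 U k x : (~` U) !=set0 -> 0 <= bump_fun U k x <= 1.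
Proof.
move=> U0; have h : 0 <= dist_compl U x.
  by apply: dist_compl_glb => // y _; exact: cdist_ge0.
rewrite /bump_fun minElt; case: ltP => h1; first by rewrite ler01 lexx.
by rewrite mulr_ge0.
Qed.

Lemma measure_open_lim (m : {measure set (circle R) -> \bar R}) U :
  (m setT < +oo)%E -> open U -> (~` U) !=set0 ->
  (fun k => Rintegral m setT (bump_fun U k)) @ \oo --> fine (m U).
Proof.
move=> mT oU U0; have mU : measurable U by exact: sub_sigma_algebra.
have bU k : bounded_mfun (bump_fun U k).
  by apply: (@lipschitz_bounded_mfun _ k%:R) => x y; exact: bump_fun_lipschitz.
have Ufin : m U \is a fin_num.
  by rewrite ge0_fin_numE// (le_lt_trans _ mT)// le_measure// ?inE.
have h : (fun k => \int[m]_x (bump_fun U k x)%:E)%E @ \oo --> (\int[m]_x (\1_U x)%:E)%E.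
  apply: (@dominated_cvg _ _ _ m setT measurableT (fun k x => (bump_fun U k x)%:E)
    (fun x => (\1_U x)%:E) (cst 1%E)) => //.
  - by move=> k; apply/measurable_EFinP; exact: (bU k).1.
  - by move=> x _; apply: cvg_EFin; [exact: nearW|exact: bump_fun_cvg].
  - exact: (bounded_mfun_integrable mT (bounded_mfun_cst _ 1)).
  - move=> k x _; rewrite lee_fin; have /andP[b0 b1] := bump_fun_ge0 k x U0.
    by rewrite ger0_norm.
rewrite integral_indic// setIT in h.
by apply: fine_cvg; rewrite fineK.
Qed.

(** Open sets are stable under intersection and generate the Borel sets, so agreement on them
    suffices; there the measure is a limit of integrals of [bump_fun]. *)
Lemma measure_eq_lipschitz (m n : {measure set (circle R) -> \bar R}) :
  (m setT < +oo)%E -> (n setT < +oo)%E ->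
  (forall f L, (forall x y, `|f x - f y| <= L * cdist x y) ->
     Rintegral m setT f = Rintegral n setT f) ->
  forall A, measurable A -> m A = n A.
Proof.
move=> mT nT h.
have fin (p : {measure set (circle R) -> \bar R}) A : (p setT < +oo)%E -> measurable A -> p A \is a fin_num.
  by move=> pT mA; rewrite ge0_fin_numE// (le_lt_trans _ pT)// le_measure// ?inE.
have hT : m setT = n setT.
  have := h (fun=> 1) 0 (fun x y => _); rewrite !bintegral_cst !mul1r.
  move=> e; rewrite -(fineK (fin m _ mT measurableT)) -(fineK (fin n _ nT measurableT)) e//.
  by move=> x y; rewrite subrr normr0 mul0r.
move=> A mA; apply: (@measure_unique _ _ _ (@open (circle R)) (fun=> setT)) => //.
- exact: openI.
- by move=> i; exact: openT.
- by rewrite bigcup_const.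
(* The whole circle has no bump functions; it is covered by the constant test function in [hT]. *)
- move=> U oU; have [U0|/set0P/negP] := pselect ((~` U) !=set0); last first.
    by rewrite negbK => /eqP; rewrite -setCT => /setC_inj ->.
  have mU : measurable U by exact: sub_sigma_algebra.
  rewrite -(fineK (fin m _ mT mU)) -(fineK (fin n _ nT mU)); congr (_%:E).
  have h1 := measure_open_lim mT oU U0; have h2 := measure_open_lim nT oU U0.
  rewrite -(cvg_lim _ h1)// -(cvg_lim _ h2)//; congr (limn _); apply/funext => k.
  by apply: (h _ k%:R) => x y; exact: bump_fun_lipschitz.
Qed.

End circle_functions.

(** * The Fejér kernel and its sums over roots of unity *)

Section fejer_kernel.
Variable R : realType.
Local Notation normc := (@Normc.normc R).
Local Notation Re := (@complex.Re R).
Implicit Types (z : R[i]) (n : nat).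

(** On the circle, n times the usual Fejér kernel. The last summand has coefficient 0, so the degree
    is n - 1. *)
Definition fejer n z : R :=
  n%:R + 2 * \sum_(v < n) (n%:R - v.+1%:R) * Re (z ^+ v.+1).

Lemma ReM2 (a b : R[i]) : Re a * Re b = 2^-1 * (Re (a * b) + Re (a * b^*%C)).
Proof. by case: a b => [a1 a2] [b1 b2] /=; field. Qed.

Lemma fejerE n z : normc z = 1 -> fejer n z = normc (\sum_(j < n) z ^+ j) ^+ 2.
Proof.
move=> z1; elim: n => [|n IH].
  by rewrite /fejer !big_ord0 Normc.normc0 mulr0 addr0 expr0n.
rewrite [in RHS]big_ord_recr/= normc_sqr ReD ImD.
have -> (a b c d : R) : (a + c) ^+ 2 + (b + d) ^+ 2 = (a ^+ 2 + b ^+ 2) + (c ^+ 2 + d ^+ 2) + 2 * (c * a + d * b) by ring.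
rewrite -!normc_sqr -IH normcX z1 !expr1n.
have -> (a b : R[i]) : Re a * Re b + complex.Im a * complex.Im b = Re (a * b^*%C).
  by case: a b => [a1 a2] [b1 b2] /=; ring.
rewrite conjc_sum mulr_sumr Re_sum.
have zJ k : (k <= n)%N -> z ^+ n * (z ^+ k)^*%C = z ^+ (n - k).
  move=> kn; rewrite -{1}(subnK kn) exprD -mulrA mulcJ normcX z1 !expr1n.
  by rewrite mulr1.
have -> : \sum_(i < n) Re (z ^+ n * (z ^+ i)^*%C) = \sum_(v < n) Re (z ^+ v.+1).
  rewrite (reindex_inj rev_ord_inj)/=; apply: eq_bigr => i _.
  by rewrite zJ ?leq_subr// subKn.
rewrite /fejer big_ord_recr/= subrr mul0r addr0.
have -> : \sum_(i < n) (n.+1%:R - i.+1%:R) * Re (z ^+ i.+1) =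
  \sum_(i < n) (n%:R - i.+1%:R) * Re (z ^+ i.+1) + \sum_(i < n) Re (z ^+ i.+1).
  rewrite -big_split/=; apply: eq_bigr => i _; rewrite -(natr1 n); ring.
by rewrite -(natr1 n); ring.
Qed.

Lemma fejer_ge0 n z : normc z = 1 -> 0 <= fejer n z.
Proof. by move=> z1; rewrite fejerE// sqr_ge0. Qed.

Section roots.
Variables (Q : nat) (z : R[i]).
Let c k := z * (uroot R Q ^+ k)^*%C.

Lemma sum_Re_roots v : (0 < v < Q)%N -> \sum_(k < Q) Re (c k ^+ v) = 0.
Proof.
move=> /andP[v0 vQ]; rewrite -Re_sum.
have -> : \sum_(k < Q) c k ^+ v = z ^+ v * (\sum_(k < Q) (uroot R Q ^+ v) ^+ k)^*%C.
  rewrite conjc_sum mulr_sumr; apply: eq_bigr => k _.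
  by rewrite /c exprMn -conjcX -!exprM mulnC.
rewrite sum_uroot ?(leq_trans _ vQ)// gtnNdvd// conjc0 mulr0.
by [].
Qed.

(** Over Q equidistributed points every frequency strictly between 0 and Q averages to 0; only the
    constant term is left. *)
Lemma sum_fejer n : (n < Q)%N -> \sum_(k < Q) fejer n (c k) = n%:R * Q%:R.
Proof.
move=> nQ; rewrite big_split/= sumr_const card_ord -mulr_sumr exchange_big/=.
rewrite big1 ?mulr0 ?addr0 ?mulr_natr// => v _.
by rewrite -mulr_sumr sum_Re_roots ?mulr0//= (leq_ltn_trans _ nQ).
Qed.

(** Multiplication by Re z shifts frequencies by one, so the surviving constant term comes from
    frequency 1 of the kernel, of weight n - 1. *)
Lemma sum_fejer_Re n : (1 < n < Q)%N -> normc z = 1 ->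
  \sum_(k < Q) fejer n (c k) * Re (c k) = (n%:R - 1) * Q%:R.
Proof.
move=> /andP[n1 nQ] z1.
have c1 k : normc (c k) = 1 by rewrite /c Normc.normcM z1 normc_conj normcX normc_uroot expr1n mulr1.
have e k : fejer n (c k) * Re (c k) = n%:R * Re (c k ^+ 1) +
   (\sum_(v < n) (n%:R - v.+1%:R) * Re (c k ^+ v.+2) + \sum_(v < n) (n%:R - v.+1%:R) * Re (c k ^+ v)).
  rewrite /fejer mulrDl expr1; congr (_ + _).
  rewrite -mulrA mulr_suml -big_split/= mulr_sumr; apply: eq_bigr => v _.
  rewrite -mulrA ReM2 -exprSr [c k ^+ v.+1 * _](_ : _ = c k ^+ v); first by field.
  by rewrite exprSr -mulrA mulcJ c1 expr1n mulr1.
under eq_bigr do rewrite e.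
rewrite big_split/= -mulr_sumr sum_Re_roots ?mulr0 ?add0r; last first.
  by rewrite (ltn_trans n1).
rewrite big_split/= exchange_big/= big1 ?add0r => [|v _]; last first.
  rewrite -mulr_sumr; case: (ltnP v.+2 Q) => vQ.
    by rewrite sum_Re_roots ?mulr0.
  (* Frequency v + 2 can reach Q only for the last summand, whose weight n - (v + 1) is 0. *)
  have -> : v.+1 = n by apply/eqP; rewrite eqn_leq ltn_ord/=; rewrite -ltnS (leq_trans nQ).
  by rewrite subrr mul0r.
case: n n1 nQ {e} => // n n1 nQ.
rewrite exchange_big/= big_ord_recl/= [X in _ + X]big1 ?addr0 => [|v _].
  by under eq_bigr do rewrite /=; rewrite -mulr_sumr/= sumr_const card_ord.
by rewrite -mulr_sumr sum_Re_roots ?mulr0//= /bump/= add1n (leq_ltn_trans _ nQ)// ltnS ltnW.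
Qed.

End roots.
End fejer_kernel.

(** * Finite measures are determined by their Fourier coefficients *)

Section fourier_coefficients.
Variable R : realType.
Local Notation normc := (@Normc.normc R).
Local Notation Re := (@complex.Re R).
Local Notation Im := (@complex.Im R).
Implicit Types (x y : circle R) (m p : {measure set (circle R) -> \bar R}) (n : nat).

Lemma circle_val_neq0 x : circle_val x != 0.
Proof.
by apply/eqP => h; have := normc_circle x; rewrite h Normc.normc0 => /eqP; rewrite eq_sym oner_eq0.
Qed.

Lemma circle_valV x : (circle_val x)^-1 = (circle_val x)^*%C.
Proof.
apply: (mulfI (circle_val_neq0 x)); rewrite mulcJ normc_circle expr1n divff//.
exact: circle_val_neq0.
Qed.

Lemma circle_exprzN x (v : int) : circle_val x ^ (- v) = (circle_val x ^ v)^*%C.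
Proof.
case: v => v; last by rewrite NegzE opprK /exprz/= -exprVn circle_valV conjcX conjcK.
case: v => [|v]; first by rewrite oppr0 expr0z conjc1.
by rewrite -NegzE /exprz/= -exprVn circle_valV conjcX.
Qed.

Lemma circle_expn_dist x y n : normc (circle_val x ^+ n - circle_val y ^+ n) <= n%:R * cdist x y.
Proof.
elim: n => [|n IH]; first by rewrite !expr0 subrr Normc.normc0 mul0r.
have -> : circle_val x ^+ n.+1 - circle_val y ^+ n.+1 =
  circle_val x * (circle_val x ^+ n - circle_val y ^+ n) + (circle_val x - circle_val y) * circle_val y ^+ n.
  by rewrite !exprS; ring.
rewrite (le_trans (le_normcD _ _))// !Normc.normcM normcX !normc_circle expr1n mul1r mulr1.
by rewrite -natr1 mulrDl mul1r lerD.
Qed.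

Lemma circle_exprz_dist x y (v : int) :
  normc (circle_val x ^ v - circle_val y ^ v) <= `|v|%:R * cdist x y.
Proof.
case: v => v; first exact: circle_expn_dist.
rewrite NegzE !circle_exprzN -rmorphB normc_conj abszN; exact: circle_expn_dist.
Qed.

Lemma trig_bounded_mfun (a : R[i]) (v : int) :
  bounded_mfun (fun x : circle R => Re (a * circle_val x ^ v)).
Proof.
apply: (@lipschitz_bounded_mfun _ _ (normc a * `|v|%:R)) => x y.
rewrite -ReN -ReD -mulrBr (le_trans (ler_Re_normc _))// Normc.normcM -mulrA.
by rewrite ler_wpM2l ?normc_ge0// circle_exprz_dist.
Qed.

Lemma Re_bounded_mfun (v : int) : bounded_mfun (fun x : circle R => Re (circle_val x ^ v)).
Proof. by have := trig_bounded_mfun 1 v; under eq_fun do rewrite mul1r. Qed.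

Lemma Im_bounded_mfun (v : int) : bounded_mfun (fun x : circle R => Im (circle_val x ^ v)).
Proof.
have := trig_bounded_mfun (- 'i)%C v.
suff e x : Re ((- 'i)%C * circle_val x ^ v) = Im (circle_val x ^ v).
  by under eq_fun do rewrite e.
by case: (_ ^ _) => a b /=; ring.
Qed.

Definition measure_coef m (v : int) : R[i] :=
  Rintegral m setT (fun x => Re (circle_val x ^ (- v))) +i*
  Rintegral m setT (fun x => Im (circle_val x ^ (- v))).

Lemma trig_integral m (a : R[i]) (v : int) : (m setT < +oo)%E ->
  Rintegral m setT (fun x => Re (a * circle_val x ^ v)) = Re (a * measure_coef m (- v)).
Proof.
move=> mT; have e x : Re (a * circle_val x ^ v) =
    Re a * Re (circle_val x ^ v) - Im a * Im (circle_val x ^ v).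
  by case: a (_ ^ _) => [? ?] [? ?].
under eq_Rintegral do rewrite e.
have h1 := Re_bounded_mfun v; have h2 := Im_bounded_mfun v.
rewrite bintegralB ?bintegralZ//; [|exact: bounded_mfunZ..].
by rewrite /measure_coef opprK; case: a {e} => a1 a2 /=.
Qed.

Lemma measure_coef0 m : measure_coef m 0 = (fine (m setT))%:C.
Proof.
rewrite /measure_coef oppr0; congr (_ +i* _).
  under eq_Rintegral do rewrite expr0z /=; rewrite bintegral_cst mul1r//.
by under eq_Rintegral do rewrite expr0z /=; rewrite bintegral_cst mul0r.
Qed.

Lemma measure_coefN m (v : int) : (m setT < +oo)%E ->
  measure_coef m (- v) = (measure_coef m v)^*%C.
Proof.
move=> mT; rewrite /measure_coef opprK /=; congr (_ +i* _).
  by under [RHS]eq_Rintegral do rewrite circle_exprzN Re_conjc.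
under [in RHS]eq_Rintegral do rewrite circle_exprzN Im_conjc -mulN1r.
by rewrite bintegralZ ?mulN1r ?opprK//; exact: Im_bounded_mfun.
Qed.

Lemma circle_val_turn (t : R) : circle_val (circle_turn t) = cexp (0 +i* (2 * pi * t)).
Proof. by []. Qed.

(** A discrete convolution: f enters only through its values at the Q-th roots of unity, so the
    integral of the mean is a finite combination of Fourier coefficients and no double integral
    arises. *)
Definition fejer_mean (f : circle R -> R) (n Q : nat) (x : circle R) : R :=
  (n * Q)%:R^-1 * \sum_(k < Q) f (circle_turn (k%:R / Q%:R)) *
     fejer n (circle_val x * (uroot R Q ^+ k)^*%C).

(* The distance d from x to a root w satisfies d <= 1/(2s) + s d^2/2, and d^2 is
   a trigonometric polynomial of degree 1. *)
Lemma fejer_mean_dist (f : circle R -> R) (L : R) (s : nat) x : (1 < s)%N ->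
  (forall x y, `|f x - f y| <= L * cdist x y) ->
  `|fejer_mean f (s ^ 2) (s ^ 2).+1 x - f x| <= L * (2 * s%:R^-1).
Proof.
(* The Fejér weights give 1 - Re c the mean 1/n. With n = s^2 the bound d <= 1/(2s) + s (1 - Re c)
   therefore has mean 3/(2s), below the claimed 2/s. Q = n + 1 is the least value allowed by the
   sums above. *)
move=> s1 fL; set n := (s ^ 2)%N; set Q := n.+1.
have L0 : 0 <= L.
  have [y xy] : exists y : circle R, 0 < cdist x y.
    have h : `|- circle_val x| = 1 by rewrite normrN circle_valP.
    exists (mk_circle h); rewrite /cdist/= opprK -mulr2n normcMn normc_circle.
    by rewrite ltr0n.
  by have := le_trans (normr_ge0 _) (fL x y); rewrite pmulr_lge0.
have s0 : 0 < s%:R :> R by rewrite ltr0n (ltn_trans _ s1).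
have n1 : (1 < n)%N by rewrite /n (ltn_trans s1)// -{1}(expn1 s) ltn_exp2l.
have nQ : (n < Q)%N by [].
have nr : n%:R = s%:R ^+ 2 :> R by rewrite /n natrX.
have Q0 : 0 < Q%:R :> R by rewrite ltr0n.
have n0 : 0 < n%:R :> R by rewrite ltr0n (ltn_trans _ n1).
have nQ0 : 0 < (n * Q)%:R :> R by rewrite natrM mulr_gt0.
pose c k := circle_val x * (uroot R Q ^+ k)^*%C.
have c1 k : normc (c k) = 1.
  by rewrite /c Normc.normcM normc_circle normc_conj normcX normc_uroot expr1n mulr1.
have wE k : circle_val (circle_turn (k%:R / Q%:R)) = uroot R Q ^+ k.
  by rewrite circle_val_turn uroot_exp.
have hd k : cdist (circle_turn (k%:R / Q%:R)) x <= s%:R^-1 / 2 + s%:R * (1 - Re (c k)).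
  have e : cdist (circle_turn (k%:R / Q%:R)) x ^+ 2 = 2 * (1 - Re (c k)).
    have : normc (c k - 1) = cdist (circle_turn (k%:R / Q%:R)) x.
      rewrite cdistC /cdist wE.
      have -> : c k - 1 = (circle_val x - uroot R Q ^+ k) * (uroot R Q ^+ k)^*%C.
        by rewrite mulrBl mulcJ normcX normc_uroot !expr1n.
      by rewrite Normc.normcM normc_conj normcX normc_uroot expr1n mulr1.
    move=> <-; have := normc_sqr (c k); rewrite c1 normc_sqr ReD ImD.
    by case: (c k) => a b /= h; rewrite oppr0 addr0; lra.
  have -> : 1 - Re (c k) = cdist (circle_turn (k%:R / Q%:R)) x ^+ 2 / 2 by rewrite e; field.
  have := sqr_ge0 (1 - s%:R * cdist (circle_turn (k%:R / Q%:R)) x).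
  move: (cdist _ _) => d h.
  rewrite -(ler_pM2l s0) (_ : s%:R * (_ + _) = 2^-1 + s%:R ^+ 2 * d ^+ 2 / 2); first by nra.
  by field; rewrite gt_eqF.
have -> : fejer_mean f n Q x - f x = (n * Q)%:R^-1 *
    \sum_(k < Q) (f (circle_turn (k%:R / Q%:R)) - f x) * fejer n (c k).
  rewrite /fejer_mean; under [in RHS]eq_bigr do rewrite mulrBl.
  rewrite sumrB mulrBr; congr (_ - _); rewrite -mulr_sumr (sum_fejer _ nQ).
  by rewrite natrM mulrCA mulVf ?mulr1// gt_eqF// mulr_gt0.
rewrite normrM gtr0_norm ?invr_gt0// mulrC ler_pdivrMr//.
apply: le_trans (ler_norm_sum _ _ _) _.
apply: (@le_trans _ _ (\sum_(k < Q) L * (s%:R^-1 / 2 + s%:R * (1 - Re (c k))) * fejer n (c k))).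
  apply: ler_sum => k _; rewrite normrM (ger0_norm (fejer_ge0 n (c1 k))).
  rewrite ler_wpM2r ?fejer_ge0// (le_trans (fL _ _))// ler_wpM2l//.
have -> : \sum_(k < Q) L * (s%:R^-1 / 2 + s%:R * (1 - Re (c k))) * fejer n (c k) =
   L * ((s%:R^-1 / 2 + s%:R) * \sum_(k < Q) fejer n (c k) - s%:R * \sum_(k < Q) fejer n (c k) * Re (c k)).
  by rewrite !mulr_sumr -sumrB mulr_sumr; apply: eq_bigr => k _; ring.
rewrite sum_fejer// sum_fejer_Re ?n1 ?normc_circle// -[leRHS]mulrA ler_wpM2l//.
rewrite natrM nr le_eqVlt; apply/orP; right.
have -> : (s%:R^-1 / 2 + s%:R) * (s%:R ^+ 2 * Q%:R) - s%:R * ((s%:R ^+ 2 - 1) * Q%:R) = 3 / 2 * s%:R * Q%:R :> R.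
  by field; rewrite gt_eqF.
have -> : 2 / s%:R * (s%:R ^+ 2 * Q%:R) = 2 * s%:R * Q%:R :> R by field; rewrite gt_eqF.
by rewrite ltr_pM2r// ltr_pM2r//; lra.
Qed.

Lemma fejer_bounded_mfun n (a : R[i]) : bounded_mfun (fun x => fejer n (circle_val x * a)).
Proof.
rewrite /fejer; apply: bounded_mfunD; first exact: bounded_mfun_cst.
apply: bounded_mfunZ; apply: bounded_mfun_sum => v.
apply: bounded_mfunZ; have := trig_bounded_mfun (a ^+ v.+1) v.+1%:Z.
by under eq_fun do rewrite mulrC -exprnP -exprMn.
Qed.

Lemma fejer_mean_bounded_mfun f n Q : bounded_mfun (fejer_mean f n Q).
Proof.
apply: bounded_mfunZ; apply: bounded_mfun_sum => k; apply: bounded_mfunZ.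
exact: fejer_bounded_mfun.
Qed.

Lemma fejer_integral m n (a : R[i]) : (m setT < +oo)%E ->
  Rintegral m setT (fun x => fejer n (circle_val x * a)) =
  n%:R * Re (measure_coef m 0) +
  2 * \sum_(v < n) (n%:R - v.+1%:R) * Re (a ^+ v.+1 * measure_coef m (- v.+1%:Z)).
Proof.
move=> mT; have hb (v : nat) : bounded_mfun (fun x : circle R => Re ((circle_val x * a) ^+ v.+1)).
  by have := trig_bounded_mfun (a ^+ v.+1) v.+1%:Z;
    under eq_fun do rewrite mulrC -exprnP -exprMn.
rewrite /fejer bintegralD//; [|exact: bounded_mfun_cst|]; last first.
  by apply: bounded_mfunZ; apply: bounded_mfun_sum => v; exact: bounded_mfunZ.
rewrite bintegral_cst measure_coef0/=; congr (_ + _).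
rewrite bintegralZ//; last by apply: bounded_mfun_sum => v; exact: bounded_mfunZ.
rewrite bintegral_sum//; last by move=> v; exact: bounded_mfunZ.
congr (_ * _); apply: eq_bigr => v _; rewrite bintegralZ//; congr (_ * _).
by rewrite -trig_integral//; apply: eq_Rintegral => x _; rewrite mulrC -exprnP -exprMn.
Qed.

Lemma fejer_mean_integral_eq m p f k Q : (m setT < +oo)%E -> (p setT < +oo)%E ->
  (forall v, measure_coef m v = measure_coef p v) ->
  Rintegral m setT (fejer_mean f k Q) = Rintegral p setT (fejer_mean f k Q).
Proof.
move=> mT pT h; rewrite /fejer_mean !bintegralZ//;
  do ?[by apply: bounded_mfun_sum => j; apply: bounded_mfunZ; exact: fejer_bounded_mfun].
rewrite !bintegral_sum//; do ?[by move=> j; apply: bounded_mfunZ; exact: fejer_bounded_mfun].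
congr (_ * _); apply: eq_bigr => j _; rewrite !bintegralZ//; do ?[exact: fejer_bounded_mfun].
rewrite !fejer_integral//; congr (_ * (_ * _ + _ * _)); first by rewrite h.
by apply: eq_bigr => v _; rewrite h.
Qed.

(** Both measures give the same integral to each Fejér mean of a Lipschitz f, and the means converge
    uniformly to f. *)
Theorem measure_coef_unique m p : (m setT < +oo)%E -> (p setT < +oo)%E ->
  (forall v, measure_coef m v = measure_coef p v) ->
  forall A, measurable A -> m A = p A.
Proof.
move=> mT pT h; apply: measure_eq_lipschitz => // f L fL.
have bf := lipschitz_bounded_mfun fL.
set K := fine (m setT) + fine (p setT).
have key s : (1 < s)%N ->
    `|Rintegral m setT f - Rintegral p setT f| <= L * (2 * s%:R^-1) * K.
  move=> s1; set F := fejer_mean f (s ^ 2) (s ^ 2).+1.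
  have bF : bounded_mfun F by exact: fejer_mean_bounded_mfun.
  have d x : `|F x - f x| <= L * (2 * s%:R^-1) by exact: fejer_mean_dist.
  have h1 := bintegral_dist mT bF bf d; have h2 := bintegral_dist pT bF bf d.
  have h3 : Rintegral m setT F = Rintegral p setT F by exact: fejer_mean_integral_eq.
  rewrite h3 in h1; rewrite /K mulrDr.
  have -> : Rintegral m setT f - Rintegral p setT f =
     (Rintegral p setT F - Rintegral p setT f) - (Rintegral p setT F - Rintegral m setT f) by ring.
  by rewrite (le_trans (ler_normB _ _))// addrC lerD.
have h0 : (fun s => L * (2 * s.+2%:R^-1) * K) @ \oo --> (0 : R).
  have := @cvg_harmonic R; rewrite -(cvg_shiftS (@harmonic R) _) => hh.
  rewrite -[X in _ --> X](_ : L * (2 * 0) * K = 0); last by rewrite !(mulr0, mul0r).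
  apply: cvgM; last exact: cvg_cst.
  by apply: cvgM; [exact: cvg_cst|apply: cvgM; [exact: cvg_cst|exact: hh]].
apply/eqP; rewrite -subr_eq0 -normr_le0 -(cvg_lim _ h0)//.
apply: limr_ge; first exact: cvgP h0.
by apply: nearW => s; exact: key.
Qed.

End fourier_coefficients.

(** * Fourier coefficients of haar *)

Section haar_coefficients.
Variable R : realType.
Local Notation normc := (@Normc.normc R).
Local Notation Re := (@complex.Re R).
Local Notation Im := (@complex.Im R).

Lemma cos_sin_turn n : cos (2 * pi * n%:R : R) = 1 /\ sin (2 * pi * n%:R : R) = 0.
Proof.
have := uroot_exp R 1 n; have := uroot_expQ R (ltn0Sn 0); rewrite expr1 => ->.
by rewrite expr1n divr1 /cexp/= expR0 mul1r => -[<- <-].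
Qed.

Lemma circle_turn_expn (t : R) n :
  circle_val (circle_turn t) ^+ n = cos (2 * pi * n%:R * t) +i* sin (2 * pi * n%:R * t).
Proof.
rewrite circle_val_turn -cexpMn; set z := Complex _ _ *+ n.
have -> : z = 0 +i* (2 * pi * n%:R * t).
  have -> : z = (0 +i* (2 * pi * t)) * (n%:R)%:C by rewrite /z rmorph_nat mulr_natr.
  by simpc; congr (_ +i* _); ring.
by rewrite /cexp/= expR0 mul1r.
Qed.

(** The phase serves both coordinates of a coefficient: 0 for the cosine, -pi/2 for the sine. *)
Lemma integral_uniform_cos n (phi : R) : (0 < n)%N ->
  Rintegral (uniform_prob (@ltr01 R)) setT (fun t => cos (2 * pi * n%:R * t + phi)) = 0.
Proof.
move=> n0; set w := 2 * pi * n%:R.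
have w0 : w != 0 by rewrite /w !mulf_neq0 ?pnatr_eq0 ?gt_eqF ?pi_gt0// lt0n_neq0.
pose h t := cos (w * t + phi).
pose F t := t + w^-1 * sin (w * t + phi).
have dF t : is_derive t (1 : R) F (1 + h t).
  rewrite /F /h; apply: is_derive_eq.
  by rewrite addr0 -[w%:A]/(w * 1) -[_ *: _]/(_ * _); field.
have ch : continuous h.
  move=> t; apply: continuous_comp; last exact: continuous_cos.
  by apply: cvgD; [exact: mulrl_continuous|exact: cvg_cst].
have cF : continuous F.
  by move=> t; apply/differentiable_continuous/derivable1_diffP; exact: (dF t).(ex_derive).
have mh : bounded_mfun h.
  by split; [exact: continuous_measurable_fun|exists 1 => t; exact: cos_max].
pose U : {measure set _ -> \bar R} := uniform_prob (@ltr01 R).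
have UT : U setT = 1%E by exact: probability_setT.
have Uoo : (U setT < +oo)%E by rewrite UT ltry.
(* Adding 1 makes the integrand nonnegative, as [integral_uniform] requires; F is a primitive of 1 +
   h. *)
suff : Rintegral U setT (fun t => 1 + h t) = 1.
  rewrite bintegralD// ?bintegral_cst ?UT/= ?mulr1; [|exact: bounded_mfun_cst].
  by move/eqP; rewrite -subr_eq0 addrAC subrr add0r => /eqP.
have ch1 : continuous (fun t => 1 + h t).
  by move=> t; apply: cvgD; [exact: cvg_cst|exact: ch].
have mh1 : bounded_mfun (fun t => 1 + h t).
  by apply: bounded_mfunD => //; exact: bounded_mfun_cst.
rewrite /Rintegral integral_uniform; last 2 first.
- by apply/measurable_EFinP; exact: mh1.1.
- by move=> t; rewrite lee_fin /h -lerBlDl sub0r; have := cos_geN1 (w * t + phi).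
rewrite subr0 invr1 mul1e (@continuous_FTC2 _ (fun t => 1 + h t) F)//.
- have [c1 s1] := cos_sin_turn n; rewrite -/w in c1 s1.
  have e1 : F 1 = 1 + F 0.
    by rewrite /F !mulr1 !mulr0 !add0r sinD c1 s1 mul0r add0r mul1r.
  by rewrite e1 /= addrK.
- exact: continuous_subspaceT.
- split=> [t _||].
  + exact: (dF t).(ex_derive).
  + by apply: cvg_at_right_filter; exact: cF.
  + by apply: cvg_at_left_filter; exact: cF.
- by move=> t _; rewrite derive1E; exact: (dF t).(derive_val).
Qed.

Lemma haarE (f : circle R -> R) : bounded_mfun f ->
  Rintegral (haar R) setT f = Rintegral (uniform_prob (@ltr01 R)) setT (f \o @circle_turn R).
Proof.
move=> hf.
transitivity (Rintegral
  (measure_function_pushforward__canonical__measure_function_Measure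
    (uniform_prob (@ltr01 R)) (@measurable_circle_turn R)) setT f).
  exact: bintegral_measure_eq.
apply: bintegral_pushforward => //.
by rewrite -ge0_fin_numE// fin_num_measure.
Qed.

Lemma haarT_lty : (haar R setT < +oo)%E.
Proof. by rewrite probability_setT ltry. Qed.

Lemma haar_coef (v : int) : measure_coef (haar R) v = (v == 0)%:R.
Proof.
have key n : measure_coef (haar R) (- n.+1%:Z) = 0.
  rewrite /measure_coef opprK; congr (_ +i* _).
    rewrite haarE; last exact: Re_bounded_mfun.
    rewrite -[RHS](integral_uniform_cos 0 (ltn0Sn n)); apply: eq_Rintegral => t _ /=.
    by rewrite -exprnP circle_turn_expn addr0.
  rewrite haarE; last exact: Im_bounded_mfun.
  rewrite -[RHS](integral_uniform_cos (- (pi / 2)) (ltn0Sn n)); apply: eq_Rintegral => t _ /=.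
  by rewrite -exprnP circle_turn_expn -cosBpihalf.
case: v => [[|n]|n] /=.
- rewrite measure_coef0; congr (_%:C).
  by rewrite [X in fine X](@probability_setT _ _ _ (haar R)).
- rewrite -[n.+1%:Z]opprK measure_coefN; last exact: haarT_lty.
  by rewrite key conjc0.
- by rewrite NegzE key.
Qed.

End haar_coefficients.

(** * The theorems of Helly and Herglotz *)

Section right_limit.
Variable R : realType.
Variable F : R -> R.
Hypothesis ndF : {homo F : x y / x <= y}.
Hypothesis F0 : forall x, 0 <= F x.

(** The right-continuous version of F: a pointwise limit of distribution functions is monotone but
    may fail to be right continuous. *)
Definition right_inf (x : R) : R := inf [set F y | y in [set y | x < y]].

Lemma right_inf_le x y : x < y -> right_inf x <= F y.
Proof.
move=> xy; apply: inf_lbound; last by exists y.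
by exists 0 => _ [z _ <-].
Qed.

Lemma right_inf_ge x a : (forall y, x < y -> a <= F y) -> a <= right_inf x.
Proof.
move=> h; apply: lb_le_inf; first by exists (F (x + 1)), (x + 1) => //=; rewrite ltrDl.
by move=> _ [y /= xy <-]; exact: h.
Qed.

Lemma le_right_inf x : F x <= right_inf x.
Proof. by apply: right_inf_ge => y xy; rewrite ndF// ltW. Qed.

Lemma right_inf_nondecreasing : {homo right_inf : x y / x <= y}.
Proof. by move=> x y xy; apply: right_inf_ge => z yz; rewrite right_inf_le// (le_lt_trans xy). Qed.

Lemma right_inf_right_continuous : right_continuous right_inf.
Proof.
move=> x; apply/cvgrPdist_lt => e e0.
have [y xy hy] : exists2 y, x < y & F y < right_inf x + e.
  apply/not_exists2P => h; have : right_inf x + e <= right_inf x.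
    by apply: right_inf_ge => y xy; rewrite leNgt; apply/negP => hy; have [] := h y.
  by rewrite gerDl leNgt e0.
near=> z.
have xz : x < z by near: z; exact: nbhs_right_gt.
have zy : z < y by near: z; exact: nbhs_right_lt.
rewrite distrC ger0_norm ?subr_ge0 ?right_inf_nondecreasing ?ltW//.
by rewrite ltrBlDl (le_lt_trans _ hy)// right_inf_le.
Unshelve. all: by end_near. Qed.

HB.instance Definition _ := isCumulative.Build R _ R right_inf
  right_inf_nondecreasing right_inf_right_continuous.

Definition right_inf_cumulative : cumulative R R := right_inf.

End right_limit.

(* Half-open cells: the partition starts at -1, so that an atom at 0 is counted. *)
Section stieltjes_approximation.
Variable R : realType.
Variables (g : R -> R) (L : R) (K : nat).
Hypothesis gL : forall x y, `|g x - g y| <= L * `|x - y|.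
Hypothesis K0 : (0 < K)%N.

Let p (i : nat) : R := -1 + i%:R / K%:R.
Let n := K.*2.

Lemma partition_nondecreasing : {homo p : i j / (i <= j)%N >-> i <= j}.
Proof. by move=> i j ij; rewrite /p lerD2l ler_wpM2r ?invr_ge0// ler_nat. Qed.

Lemma partition_last : p n = 1.
Proof.
rewrite /p /n -muln2 natrM mulrAC divff ?mul1r; last by rewrite pnatr_eq0 -lt0n.
by ring.
Qed.

Lemma partition_first : p 0 = -1.
Proof. by rewrite /p mul0r addr0. Qed.

Lemma partition_step i : p i.+1 = p i + K%:R^-1.
Proof. by rewrite /p -natr1 mulrDl mul1r addrA. Qed.

Let L0 : 0 <= L.
Proof. by have := le_trans (normr_ge0 _) (gL 1 0); rewrite subr0 normr1 mulr1. Qed.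

Definition riemann_stieltjes (F : R -> R) : R :=
  \sum_(i < n) g (p i.+1) * (F (p i.+1) - F (p i)).

(** F and G may differ at partition points, which are not chosen as continuity points. Summation by
    parts moves the increments to g, where each is at most L/K, and G - F at p_i is at most
    F(p_(i+1)) - F(p_i), which telescopes. *)
Lemma riemann_stieltjes_dist (F G : R -> R) : {homo F : x y / x <= y} ->
  (forall x, F x <= G x) -> (forall x y, x < y -> G x <= F y) ->
  F (-1) = 0 -> G (-1) = 0 -> F 1 = G 1 ->
  `|riemann_stieltjes G - riemann_stieltjes F| <= L / K%:R * F 1.
Proof.
move=> ndF FG GF Fm Gm F1.
pose d i := G (p i) - F (p i).
have d0 i : 0 <= d i by rewrite subr_ge0.
have e m : \sum_(i < m) g (p i.+1) * (d i.+1 - d i) =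
    g (p m) * d m - g (p 0) * d 0%N - \sum_(i < m) (g (p i.+1) - g (p i)) * d i.
  elim: m => [|m IH]; first by rewrite !big_ord0 subrr subr0.
  by rewrite !big_ord_recr/= IH; ring.
have -> : riemann_stieltjes G - riemann_stieltjes F = \sum_(i < n) g (p i.+1) * (d i.+1 - d i).
  by rewrite -sumrB; apply: eq_bigr => i _; rewrite /d; ring.
rewrite e /d partition_last partition_first Fm Gm F1 !subrr !mulr0 !add0r -/(d _) oppr0 add0r normrN.
have -> : G 1 = \sum_(i < n) (F (p i.+1) - F (p i)).
  rewrite -(big_mkord xpredT (fun i => F (p i.+1) - F (p i))) telescope_sumr//.
  by rewrite partition_last partition_first Fm subr0 F1.
rewrite (le_trans (ler_norm_sum _ _ _))// mulr_sumr ler_sum// => i _.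
rewrite normrM (ger0_norm (d0 i)) ler_pM//.
  rewrite (le_trans (gL _ _))// partition_step addrAC subrr add0r.
  by rewrite ger0_norm ?invr_ge0.
rewrite /d lerB// GF// partition_step ltrDl invr_gt0 ltr0n.
by [].
Qed.

Definition step_approx (x : R) : R := \sum_(i < n) g (p i.+1) * (p i < x <= p i.+1)%R%:R.

Lemma step_indicator x i :
  (p i < x <= p i.+1)%R%:R = (x <= p i.+1)%R%:R - (x <= p i)%R%:R :> R.
Proof.
have := partition_nondecreasing (leqnSn i); move: (p i) (p i.+1) => a b ab.
case: (ltP a x) => ax; case: (leP x b) => xb //=; rewrite ?subr0 ?subrr//.
by have := lt_le_trans xb (le_trans ax ab); rewrite ltxx.
Qed.

Lemma sum_step_indicator x : \sum_(i < n) (p i < x <= p i.+1)%R%:R = (-1 < x <= 1)%R%:R :> R.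
Proof.
under eq_bigr do rewrite step_indicator.
rewrite -(big_mkord xpredT (fun i => (x <= p i.+1)%R%:R - (x <= p i)%R%:R)).
rewrite telescope_sumr// partition_last partition_first.
case: (ltP (-1) x) => ax; case: (leP x 1) => xb //=; rewrite ?subr0 ?subrr//.
by exfalso; move: ax xb; lra.
Qed.

Lemma step_approx_dist x : -1 < x <= 1 -> `|step_approx x - g x| <= L / K%:R.
Proof.
move=> x1; have e : \sum_(i < n) (p i < x <= p i.+1)%R%:R = 1 :> R by rewrite sum_step_indicator x1.
rewrite -[g x]mulr1 -{1}e mulr_sumr -sumrB -[leRHS]mulr1 -[X in _ <= _ * X]e mulr_sumr.
rewrite (le_trans (ler_norm_sum _ _ _))// ler_sum// => i _.
rewrite -mulrBl normrM [X in _ * X]ger0_norm//.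
case: (boolP (p i < x <= p i.+1)) => [/andP[h1 h2]|_]; last by rewrite !mulr0.
rewrite !mulr1 (le_trans (gL _ _))// ler_wpM2l//.
by rewrite ger0_norm ?subr_ge0// lerBlDl (le_trans _ (lerD (ltW h1) (lexx _)))// -partition_step.
Qed.

Lemma step_approx0 x : ~~ (-1 < x <= 1) -> step_approx x = 0.
Proof.
move=> x1; have e : \sum_(i < n) (p i < x <= p i.+1)%R%:R = 0 :> R.
  by rewrite sum_step_indicator (negbTE x1).
apply: big1 => i _; have := psumr_eq0P _ e; move=> /(_ (fun i _ => ler0n _ _)) h.
by rewrite h ?mulr0.
Qed.

End stieltjes_approximation.

Lemma ultra_fmap (T T' : Type) (f : T -> T') (F : set_system T) :
  UltraFilter F -> UltraFilter (f @ F).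
Proof.
move=> FU; split; first exact: fmap_proper_filter.
move=> G GP FG; apply/seteqP; split=> // A GA.
have [//|FA] := in_ultra_setVsetC (f @^-1` A) FU.
have GA' : G (~` A) by exact: FG.
by have [x []] := filter_ex (filterI GA GA').
Qed.

Section helly.
Variable R : realType.

Lemma stieltjes_itv (G : cumulative R R) (a b : R) : a <= b ->
  lebesgue_stieltjes_measure G `]a, b]%classic = (G b - G a)%:E.
Proof.
move=> ab; rewrite /lebesgue_stieltjes_measure /measure_extension.
rewrite measurable_mu_extE/=; last exact: is_ocitv.
by rewrite wlength_itv_bnd.
Qed.

Variables (Q : nat -> nat) (w t : nat -> nat -> R) (M : R).
Hypothesis w0 : forall n k, 0 <= w n k.
Hypothesis t01 : forall n k, (k < Q n)%N -> 0 <= t n k <= 1.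
Hypothesis wM : forall n, \sum_(k < Q n) w n k <= M.

Let Lam n (g : R -> R) := \sum_(k < Q n) w n k * g (t n k).

(* The distribution functions are made to converge along an ultrafilter. *)
Lemma helly : exists m : {measure set (measurableTypeR R) -> \bar R},
  (m setT < +oo)%E /\
  forall (g : R -> R) (L l : R), bounded_mfun (g : measurableTypeR R -> R) ->
    (forall x y, `|g x - g y| <= L * `|x - y|) ->
    Lam^~ g @ \oo --> l -> Rintegral m setT g = l.
Proof.
(* An ultrafilter finer than [\oo] gives every bounded sequence a limit, at all x at once, and keeps
   the limits that exist along [\oo]; it plays the part of a diagonal subsequence. *)
have [U [UU sU]] := ultraFilterLemma (eventually_filter : ProperFilter (\oo : set_system nat)).
have UF : ProperFilter U by exact: ultra_proper.
have M0 : 0 <= M by rewrite (le_trans _ (wM 0))// sumr_ge0.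
pose F_ n x := Lam n (fun y => (y <= x)%R%:R).
have F01 n x : 0 <= F_ n x <= M.
  rewrite sumr_ge0/=; last by move=> k _; rewrite mulr_ge0.
  rewrite (le_trans _ (wM n))// ler_sum// => k _; rewrite ler_piMr//.
  by rewrite lern1; case: (_ <= _).
have ex x : exists l : R, F_ ^~ x @ U --> l.
  have cK : compact `[0 : R, M]%classic by exact: segment_compact.
  have hU : UltraFilter (F_^~ x @ U) by exact: ultra_fmap.
  have hK : (F_^~ x @ U) `[0 : R, M]%classic.
    have hU' : U [set n | F_ n x \in `[0, M]] by apply: filterE => n; rewrite /= in_itv/=; exact: F01.
    exact: hU'.
  by move: cK; rewrite compact_ultra => /(_ _ hU hK)[l [_ ?]]; exists l.
have [F FP] := choice ex.
have ndF : {homo F : x y / x <= y}.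
  move=> x y xy; apply: (ler_cvg_to (FP x) (FP y)); apply: filterE => n.
  apply: ler_sum => k _; rewrite ler_wpM2l// ler_nat.
  by case: (leP (t n k) x) => // h; rewrite (le_trans h xy).
have F0 x : 0 <= F x.
  by apply: (cvgr_to_ge (FP x)); apply: filterE => n; have /andP[] := F01 n x.
have FM x : F x <= M.
  by apply: (cvgr_to_le (FP x)); apply: filterE => n; have /andP[] := F01 n x.
have F_neg x : x < 0 -> F x = 0.
  move=> x0; apply/eqP; rewrite eq_le F0 andbT.
  apply: (cvgr_to_le (FP x)); apply: filterE => n; rewrite /F_ /Lam big1// => k _.
  have /andP[t0 _] := t01 (ltn_ord k).
  by rewrite leNgt (lt_le_trans x0 t0) mulr0.
have F_one x : 1 <= x -> F x = F 1.
  move=> x1; apply/le_anti/andP; split; last exact: ndF.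
  apply: (ler_cvg_to (FP x) (FP 1)); apply: filterE => n.
  apply: ler_sum => k _; rewrite ler_wpM2l// ler_nat.
  have /andP[_ t1] := t01 (ltn_ord k).
  by rewrite t1; case: (_ <= _).
pose G := right_inf_cumulative F0.
have GE x : G x = right_inf F x by [].
have FG x : F x <= G x by rewrite GE; exact: le_right_inf.
have GF x y : x < y -> G x <= F y by move=> xy; rewrite GE; exact: right_inf_le.
have G_neg x : x < 0 -> G x = 0.
  move=> x0; apply/eqP; rewrite eq_le (le_trans (F0 x) (FG x)) andbT.
  have h : x < x / 2 by lra.
  by rewrite (le_trans (GF _ _ h))// F_neg//; lra.
have G_one : G 1 = F 1.
  apply/eqP; rewrite eq_le FG andbT; have h : (1 : R) < 2 by lra.
  by rewrite (le_trans (GF _ _ h))// F_one// ltW.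
(* Cutting down to ]-1, 1] makes the measure finite. All approximating masses lie in [0, 1], so the
   cut costs nothing. *)
pose D : set (measurableTypeR R) := `]-1, 1]%classic.
have mD : measurable D by exact: (measurable_itv `](-1 : R), 1]).
have LD : (lebesgue_stieltjes_measure G D < +oo)%E by rewrite stieltjes_itv ?ltry//; lra.
pose m : {measure set (measurableTypeR R) -> \bar R} := mfrestr mD LD.
have mE A : m A = lebesgue_stieltjes_measure G (A `&` D) by [].
have mT : m setT = (F 1)%:E.
  by rewrite mE setTI stieltjes_itv ?G_one ?G_neg ?subr0//; lra.
have mToo : (m setT < +oo)%E by rewrite mT ltry.
exists m; split => // g L l bg gL hl.
have L0 : 0 <= L by have := le_trans (normr_ge0 _) (gL 1 0); rewrite subr0 normr1 mulr1.
have mcell a b : -1 <= a -> a <= b -> b <= 1 -> m `]a, b]%classic = (G b - G a)%:E.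
  move=> a1 ab b1; rewrite mE setIidl ?stieltjes_itv// => x /=; rewrite in_itv/= => /andP[ax xb].
  by rewrite /D/= in_itv/= (le_lt_trans a1 ax) (le_trans xb b1).
(* Three errors of size (L/K) M: from the integral to the Riemann-Stieltjes sum of G ([h1], [h2]),
   from G to F ([h3]), and from the sum of F to l ([h4]). *)
have key K : (0 < K)%N -> `|Rintegral m setT g - l| <= 3 * (L / K%:R * M).
  move=> K0; pose p i : R := -1 + i%:R / K%:R.
  have hLK : 0 <= L / K%:R by rewrite divr_ge0.
  have pn : p K.*2 = 1 by exact: partition_last.
  have p0 : p 0%N = -1 by exact: partition_first.
  have ndp := @partition_nondecreasing R K.
  have bcell i : bounded_mfun (fun x : measurableTypeR R => ((p i < x <= p i.+1)%R%:R : R)).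
    have -> : (fun x : measurableTypeR R => (p i < x <= p i.+1)%R%:R : R) = \1_(`]p i, p i.+1]%classic : set (measurableTypeR R)).
      by apply/funext => x; rewrite indicE mem_setE in_itv.
    split; first by apply: measurable_indic; exact: (measurable_itv `](p i), (p i.+1)]).
    by exists 1 => x; rewrite indicE ger0_norm// lern1 leq_b1.
  have Icell i : (i < K.*2)%N ->
      Rintegral m setT (fun x : measurableTypeR R => (p i < x <= p i.+1)%R%:R) = G (p i.+1) - G (p i).
    move=> iK.
    have -> : (fun x : measurableTypeR R => (p i < x <= p i.+1)%R%:R : R) = \1_(`]p i, p i.+1]%classic : set (measurableTypeR R)).
      by apply/funext => x; rewrite indicE mem_setE in_itv.
    have mI : measurable (`]p i, p i.+1]%classic : set (measurableTypeR R)).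
      exact: (measurable_itv `](p i), (p i.+1)]).
    rewrite /Rintegral integral_indic// setIT.
    by rewrite mcell ?ndp// -?p0 -?pn ndp.
  have bstep : bounded_mfun (step_approx g K : measurableTypeR R -> R).
    by apply: bounded_mfun_sum => i; apply: bounded_mfunZ; exact: bcell.
  have Istep : Rintegral m setT (step_approx g K) = riemann_stieltjes g K G.
    rewrite /step_approx bintegral_sum//; last by move=> i; apply: bounded_mfunZ; exact: bcell.
    by apply: eq_bigr => i _; rewrite bintegralZ ?Icell//; exact: bcell.
  pose ID : measurableTypeR R -> R := fun x => (-1 < x <= 1)%R%:R.
  have IDE : ID = \1_D.
    by apply/funext => x; rewrite /ID indicE mem_setE in_itv.
  have bID : bounded_mfun ID.
    rewrite IDE; split; first exact: measurable_indic.
    by exists 1 => x; rewrite indicE ger0_norm// lern1 leq_b1.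
  have h1 : `|Rintegral m setT (step_approx g K) - Rintegral m setT (fun x => g x * ID x)| <= L / K%:R * M.
    apply: (@le_trans _ _ (L / K%:R * fine (m setT))).
      apply: bintegral_dist => //; first exact: bounded_mfunM.
      move=> x; rewrite /ID; case: (boolP (-1 < x <= 1)) => x1.
        by rewrite mulr1 step_approx_dist.
      by rewrite (step_approx0 _ K0)// mulr0 subrr normr0.
    by rewrite mT/= ler_wpM2l.
  (* The step function vanishes off D while g need not; but m does not charge the complement of
     D. *)
  have h2 : Rintegral m setT (fun x => g x * ID x) = Rintegral m setT g.
    have [_ [B hB]] := bg.
    have bC : bounded_mfun (fun x => B * (1 - ID x)).
      by apply/bounded_mfunZ/bounded_mfunB => //; exact: bounded_mfun_cst.
    have IC : Rintegral m setT (fun x => B * (1 - ID x)) = 0.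
      rewrite bintegralZ//; last by apply: bounded_mfunB => //; exact: bounded_mfun_cst.
      rewrite bintegralB//; last exact: bounded_mfun_cst.
      have mDT : m D = m setT by rewrite !mE setIid setTI.
      by rewrite bintegral_cst IDE /Rintegral integral_indic// setIT mDT mul1r subrr mulr0.
    have B0 : 0 <= B by rewrite (le_trans _ (hB 0)).
    have d x : `|g x * ID x - g x| <= B * (1 - ID x).
      rewrite -{2}[g x]mulr1 -mulrBr normrM ler_pM// /ID.
      by case: (_ < _ <= _); rewrite ?subrr ?normr0// sub0r normrN normr1 subr0.
    have bgD := bounded_mfunM bg bID.
    apply/eqP; rewrite -subr_eq0 -bintegralB// -normr_le0 -IC.
    rewrite (le_trans (le_normr_Rintegral _ _))//.
      by apply: bounded_mfun_integrable => //; exact: bounded_mfunB.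
    apply: le_bintegral => //.
    have [m1 [C hC]] := bounded_mfunB bgD bg; split; first exact: measurableT_comp.
    by exists C => x; rewrite normr_id.
  have h3 : `|riemann_stieltjes g K G - riemann_stieltjes g K F| <= L / K%:R * M.
    apply: (@le_trans _ _ (L / K%:R * F 1)); last by rewrite ler_wpM2l.
    by apply: riemann_stieltjes_dist => //; rewrite ?F_neg ?G_neg//; lra.
  have h4 : `|riemann_stieltjes g K F - l| <= L / K%:R * M.
    have c1 : (fun n => `|riemann_stieltjes g K (F_ n) - Lam n g|) @ U --> `|riemann_stieltjes g K F - l|.
      apply: cvg_norm; apply: cvgB; last by apply: cvg_trans hl; exact: cvg_app.
      apply: sum_cvg => i; apply: cvgM; first exact: cvg_cst.
      by apply: cvgB; exact: FP.
    apply: (cvgr_to_le c1); apply: filterE => n.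
    (* For the n-th discrete measure the sum is exactly the integral of the step function, so
       [step_approx_dist] bounds the error uniformly in n. *)
    have -> : riemann_stieltjes g K (F_ n) = \sum_(k < Q n) w n k * step_approx g K (t n k).
      rewrite /riemann_stieltjes /step_approx /F_ /Lam.
      under eq_bigr do rewrite -sumrB mulr_sumr.
      rewrite exchange_big/=; apply: eq_bigr => k _; rewrite mulr_sumr; apply: eq_bigr => i _.
      by rewrite step_indicator; ring.
    rewrite /Lam -sumrB (le_trans (ler_norm_sum _ _ _))//.
    apply: (@le_trans _ _ (\sum_(k < Q n) w n k * (L / K%:R))).
      apply: ler_sum => k _; rewrite -mulrBr normrM ger0_norm// ler_wpM2l//.
      have /andP[t0 t1] := t01 (ltn_ord k).
      by rewrite step_approx_dist// t1 andbT (lt_le_trans _ t0)//; lra.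
    by rewrite -mulr_suml mulrC ler_wpM2l.
  rewrite Istep h2 in h1.
  have -> : Rintegral m setT g - l = - (riemann_stieltjes g K G - Rintegral m setT g) +
     ((riemann_stieltjes g K G - riemann_stieltjes g K F) + (riemann_stieltjes g K F - l)) by ring.
  rewrite (le_trans (ler_normD _ _))// normrN.
  have -> (x : R) : 3 * x = x + (x + x) by ring.
  by rewrite lerD// (le_trans (ler_normD _ _))// lerD.
have h0 : (fun s => 3 * (L / s.+1%:R * M)) @ \oo --> (0 : R).
  have hh := @cvg_harmonic R.
  rewrite -[X in _ --> X](_ : 3 * (L * 0 * M) = 0); last by rewrite !(mulr0, mul0r).
  apply: cvgM; first exact: cvg_cst.
  by apply: cvgM; [apply: cvgM; [exact: cvg_cst|exact: hh]|exact: cvg_cst].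
apply/eqP; rewrite -subr_eq0 -normr_le0; apply: (cvgr_to_ge h0).
by apply: nearW => s; exact: key.
Qed.

End helly.

(** * Herglotz' theorem *)

Section herglotz.
Variable R : realType.
Local Notation normc := (@Normc.normc R).
Local Notation Re := (@complex.Re R).
Local Notation Im := (@complex.Im R).

Lemma cvgc_near_le (u : nat -> R[i]) (l : R[i]) (e : nat -> R) (N : nat) :
  (forall n, (N <= n)%N -> normc (l - u n) <= e n) -> e @ \oo --> (0 : R) -> cvgc u l.
Proof.
move=> ue e0; apply: (@cvgc_le _ _ _ (fun n => if (n < N)%N then normc (l - u n) else e n)).
  by move=> n; case: ltnP => // /ue.
apply: cvg_trans e0; apply: near_eq_cvg; exists N => // n /= Nn.
by rewrite ltnNge Nn.
Qed.

Lemma lipschitz_of_derivative (f df : R -> R) :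
  (forall x, is_derive x (1 : R) f (df x)) -> (forall x, `|df x| <= 1) ->
  forall x y, `|f x - f y| <= `|x - y|.
Proof.
move=> hf hd; have key x y : x <= y -> `|f x - f y| <= `|x - y|.
  move=> xy; have [|c _] := MVT_segment xy (fun z _ => hf z).
    apply: continuous_subspaceT => z.
    by apply/differentiable_continuous/derivable1_diffP; exact: (hf z).(ex_derive).
  rewrite distrC => ->; rewrite normrM -[leRHS]mul1r ler_pM//.
  by rewrite distrC.
move=> x y; have [/key//|/ltW/key] := leP x y.
by rewrite distrC [leRHS]distrC.
Qed.

Lemma cos_lipschitz (x y : R) : `|cos x - cos y| <= `|x - y|.
Proof.
apply: (@lipschitz_of_derivative cos (fun x => - sin x)) => z.
by rewrite normrN; exact: sin_max.
Qed.

Lemma sin_lipschitz (x y : R) : `|sin x - sin y| <= `|x - y|.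
Proof. by apply: (@lipschitz_of_derivative sin cos) => z; exact: cos_max. Qed.

Variables (c : int -> R[i]) (M : R).
Hypothesis cJ : forall v, c (- v) = (c v)^*%C.
Hypothesis cM : forall v, normc (c v) <= M.
Hypothesis cpos : forall z G, normc z < 1 ->
  cvgc (fun n => \sum_(i < n) c i.+1%:Z * z ^+ i.+1) G -> 0 <= Re (c 0 + 2 * G).

Let M0 : 0 <= M.
Proof. by rewrite (le_trans _ (cM 0)) ?normc_ge0. Qed.

Lemma taylor_cvg z : normc z < 1 ->
  exists G, cvgc (fun n => \sum_(i < n) c i.+1%:Z * z ^+ i.+1) G.
Proof.
move=> z1; apply: (@abs_cvgc _ (fun i => c i.+1%:Z * z ^+ i.+1)).
have := cvg_normc_geometric (fun n => _ : normc (c n.+1%:Z * z) <= M) z1.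
under eq_fun do rewrite -mulrA -exprS; apply=> n.
by rewrite Normc.normcM -[leRHS]mulr1 ler_pM ?normc_ge0// ltW.
Qed.

Lemma taylor_tail z G L : normc z < 1 ->
  cvgc (fun n => \sum_(i < n) c i.+1%:Z * z ^+ i.+1) G ->
  normc (G - \sum_(i < L) c i.+1%:Z * z ^+ i.+1) <= M * normc z ^+ L / (1 - normc z).
Proof.
move=> z1 hG; have z0 := normc_ge0 z.
have h : cvgc (fun m => \sum_(i < L + m) c i.+1%:Z * z ^+ i.+1 - \sum_(i < L) c i.+1%:Z * z ^+ i.+1)
   (G - \sum_(i < L) c i.+1%:Z * z ^+ i.+1).
  apply: cvgcB; last exact: cvgc_cst.
  apply: (cvgc_comp (u := fun n => \sum_(i < n) c i.+1%:Z * z ^+ i.+1)) => //.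
  by apply/cvgnyPge => k; exists k => // m /= km; rewrite (leq_trans km)// leq_addl.
apply: (cvgc_normc_le h) => m.
rewrite big_split_ord/= addrAC subrr add0r (le_trans (normc_sum _ _ _))//.
rewrite -mulrA -[X in _ <= _ * X]mulrC.
apply: (@le_trans _ _ (M * \sum_(i < m) normc z ^+ i * normc z ^+ L)).
  rewrite mulr_sumr ler_sum// => i _; rewrite Normc.normcM ler_pM ?normc_ge0// normcX -exprD.
  by rewrite ler_wiXn2l// ?ltW// addnC leqnSn.
rewrite -mulr_suml ler_wpM2l// ler_wpM2r ?exprn_ge0// sum_geometric_le// z0 z1//.
Qed.

Lemma bernoulli_sub (r : R) n : 0 <= r <= 1 -> 1 - r ^+ n <= n%:R * (1 - r).
Proof.
move=> /andP[r0 r1]; elim: n => [|n IH]; first by rewrite expr0 subrr mul0r.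
have := exprn_ile1 n r0 r1; have := exprn_ge0 n r0.
rewrite exprS -natr1; move: IH; move: (r ^+ n) => x; nra.
Qed.

Lemma conj_uroot_sum Q m : (0 < m < Q)%N -> \sum_(k < Q) (uroot R Q ^+ k)^*%C ^+ m = 0.
Proof.
move=> /andP[m0 mQ]; under eq_bigr do rewrite -conjcX -exprM mulnC exprM.
rewrite -conjc_sum sum_uroot ?(leq_trans _ mQ)// gtnNdvd// conjc0.
by [].
Qed.

(* The weights are the values of Re (c_0 + 2 sum_(1 <= i <= L) c_i z^i) at the
   points z = r w^k, increased by eps to absorb the truncation error. *)
Lemma herglotz_approximation (N : nat) (eps : R) : 0 < eps ->
  exists Q (w : nat -> R), [/\ forall k, 0 <= w k, (0 < Q)%N &
    forall v, (v <= N)%N ->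
      normc (\sum_(k < Q) (w k)%:C * (uroot R Q ^+ k)^*%C ^+ v - c v%:Z) <= eps].
Proof.
move=> e0.
(* On the radius r = 1 - d the recovered coefficient is r^v c_v, off by at most M N d, which has to
   stay below eps; d <= 1/2 keeps r positive. *)
pose d := Num.min (2^-1) (eps / ((M + 1) * N.+1%:R)).
have d0 : 0 < d by rewrite /d lt_min invr_gt0 ltr0n divr_gt0// mulr_gt0 ?ltr_wpDl.
have d1 : d <= 2^-1 by rewrite /d ge_min lexx.
have de : M * (N%:R * d) <= eps.
  have h : d <= eps / ((M + 1) * N.+1%:R) by rewrite /d ge_min lexx orbT.
  have hp : 0 < (M + 1) * N.+1%:R by rewrite mulr_gt0 ?ltr_wpDl.
  move: h; rewrite ler_pdivlMr//; apply: le_trans.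
  rewrite mulrA mulrC ler_wpM2l ?(ltW d0)// ler_pM// ?lerDl// ler_nat.
  by [].
pose r := 1 - d.
have [r0 r1] : 0 < r /\ r < 1 by rewrite /r; split; lra.
(* L makes the truncation error on |z| = r at most eps, so the weights eps + Re P are
   nonnegative. *)
have [L NL hL] : exists2 L, (N < L)%N & 2 * (M * r ^+ L / (1 - r)) <= eps.
  have h : (fun L => 2 * (M * r ^+ L / (1 - r))) @ \oo --> 2 * (M * 0 / (1 - r)).
    apply: cvgM; first exact: cvg_cst.
    apply: cvgM; last exact: cvg_cst.
    apply: cvgM; first exact: cvg_cst.
    by apply: cvg_expr; rewrite gtr0_norm.
  rewrite mulr0 mul0r mulr0 in h.
  move/cvgr0_norm_lt: h => /(_ _ e0)[L0 _ hL0].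
  exists (maxn N.+1 L0); first by rewrite leq_max leqnn.
  have := hL0 (maxn N.+1 L0) (leq_maxr _ _) => /= /ltW; apply: le_trans.
  exact: ler_norm.
(* Re P has frequencies of modulus at most L and is tested against v < L. Sums of the two stay below
   2L + 1, so no aliasing occurs modulo Q. *)
pose Q := L.*2.+1; have Q0 : (0 < Q)%N by [].
pose P (k : nat) := c 0 + 2 * \sum_(i < L) c i.+1%:Z * (r%:C * uroot R Q ^+ k) ^+ i.+1.
pose w k := Q%:R^-1 * (eps + Re (P k)).
have nz k : normc (r%:C * uroot R Q ^+ k) = r.
  by rewrite Normc.normcM normc_real normcX normc_uroot expr1n mulr1 gtr0_norm.
have Qr : 0 < Q%:R :> R by rewrite ltr0n.
exists Q, w; split => // [k|v vN].
  have z1 : normc (r%:C * uroot R Q ^+ k) < 1 by rewrite nz.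
  have [G hG] := taylor_cvg z1; have := cpos z1 hG; have := taylor_tail L z1 hG.
  rewrite nz => h1 h2; rewrite /w mulr_ge0 ?invr_ge0//.
  have h3 : Re (P k) = Re (c 0 + 2 * G) - 2 * Re (G - \sum_(i < L) c i.+1%:Z * (r%:C * uroot R Q ^+ k) ^+ i.+1).
    have e2 : (2 : R[i]) = (2 : R)%:C by rewrite rmorph_nat.
    by rewrite /P e2 !ReD !Re_realM ReN; ring.
  have := le_trans (ler_norm _) (ler_Re_normc (G - \sum_(i < L) c i.+1%:Z * (r%:C * uroot R Q ^+ k) ^+ i.+1)).
  rewrite h3; move: h1 h2 hL; lra.
have c0J : (c 0)^*%C = c 0 by rewrite -cJ oppr0.
have PE k : (Re (P k))%:C = c 0 + (\sum_(i < L) c i.+1%:Z * (r%:C * uroot R Q ^+ k) ^+ i.+1 +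
   \sum_(i < L) (c i.+1%:Z * (r%:C * uroot R Q ^+ k) ^+ i.+1)^*%C).
  have := ReJ_add (P k); rewrite /P => ->.
  have cD (a b : R[i]) : (a + b)^*%C = a^*%C + b^*%C by exact: rmorphD.
  rewrite cD c0J -conjc_sum.
  have e2 : (2 : R[i])^*%C = 2 by exact: conjc_nat.
  by rewrite conjcM e2; field.
have orth i j : (i < Q)%N -> (j < Q)%N ->
    \sum_(k < Q) (uroot R Q ^+ k) ^+ i * (uroot R Q ^+ k)^*%C ^+ j = if i == j then Q%:R else 0.
  move=> iQ jQ; rewrite -uroot_orth//; apply: eq_bigr => k _.
  by rewrite exprMn conjcX -!exprM mulnC [(k * j)%N]mulnC.
have vL : (v < L)%N by exact: leq_ltn_trans vN NL.
have LQ : (L < Q)%N by rewrite /Q -addnn ltnS leq_addr.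
have vQ : (v < Q)%N by exact: ltn_trans LQ.
pose V (k : nat) := (uroot R Q ^+ k)^*%C ^+ v.
have QC : Q%:R != 0 :> R[i] by rewrite pnatr_eq0.
have S0 : \sum_(k < Q) V k = (v == 0%N)%:R * Q%:R.
  have := orth 0%N v Q0 vQ; rewrite /V; under eq_bigr do rewrite expr0 mul1r.
  by rewrite eq_sym => ->; case: eqP; rewrite ?mul1r ?mul0r.
have S1 : \sum_(k < Q) (\sum_(i < L) c i.+1%:Z * (r%:C * uroot R Q ^+ k) ^+ i.+1) * V k =
   (if v is v'.+1 then c v'.+1%:Z * r%:C ^+ v'.+1 else 0) * Q%:R.
  under eq_bigr do rewrite mulr_suml.
  rewrite exchange_big/=.
  have e (i : nat) : (i < L)%N -> \sum_(k < Q) c i.+1%:Z * (r%:C * uroot R Q ^+ k) ^+ i.+1 * V k =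
       c i.+1%:Z * r%:C ^+ i.+1 * (if i.+1 == v then Q%:R else 0).
    move=> iL; rewrite -orth ?(leq_ltn_trans iL)// mulr_sumr; apply: eq_bigr => k _.
    by rewrite exprMn /V; ring.
  under eq_bigr do rewrite e//.
  case: v vN vL vQ @V S0 e => [|v] vN vL vQ V S0 e.
    by rewrite mul0r big1// => i _; rewrite mulr0.
  have vL' : (v < L)%N by exact: ltnW.
  rewrite (bigD1 (Ordinal vL'))//= eqxx big1 ?addr0// => i /eqP iv.
  by rewrite ifN ?mulr0// eqSS; apply/eqP => iv'; apply: iv; exact: val_inj.
have S2 : \sum_(k < Q) (\sum_(i < L) (c i.+1%:Z * (r%:C * uroot R Q ^+ k) ^+ i.+1)^*%C) * V k = 0.
  under eq_bigr do rewrite mulr_suml.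
  rewrite exchange_big/= big1// => i _.
  transitivity ((c i.+1%:Z)^*%C * r%:C ^+ i.+1 * \sum_(k < Q) (uroot R Q ^+ k)^*%C ^+ (i.+1 + v)).
    rewrite mulr_sumr; apply: eq_bigr => k _.
    have -> : (c i.+1%:Z * (r%:C * uroot R Q ^+ k) ^+ i.+1)^*%C =
        (c i.+1%:Z)^*%C * (r%:C * (uroot R Q ^+ k)^*%C) ^+ i.+1.
      by rewrite conjcM (conjcX (r%:C * uroot R Q ^+ k)) (conjcM r%:C) conjc_real.
    by rewrite exprMn exprD /V; ring.
  have hb : (0 < i.+1 + v < Q)%N by have := ltn_ord i; rewrite /Q; lia.
  by rewrite conj_uroot_sum ?mulr0.
have -> : \sum_(k < Q) (w k)%:C * V k =
   (v == 0%N)%:R * (eps%:C + c 0) + (if v is v'.+1 then c v'.+1%:Z * r%:C ^+ v'.+1 else 0).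
  have e k : (w k)%:C * V k = Q%:R^-1 * ((eps%:C + c 0) * V k +
     ((\sum_(i < L) c i.+1%:Z * (r%:C * uroot R Q ^+ k) ^+ i.+1) * V k +
      (\sum_(i < L) (c i.+1%:Z * (r%:C * uroot R Q ^+ k) ^+ i.+1)^*%C) * V k)).
    by rewrite /w rmorphM rmorphD/= PE fmorphV rmorph_nat; ring.
  under eq_bigr do rewrite e.
  rewrite -mulr_sumr big_split/= -mulr_sumr big_split/= S0 S1 S2 addr0.
  by rewrite (mulrA (eps%:C + c 0)) -mulrDl mulrC mulfK// (mulrC (eps%:C + c 0)).
case: v vN {vL vQ V S0 S1 S2} => [|v] vN /=.
  by rewrite mul1r addr0 addrK normc_real gtr0_norm.
rewrite mul0r add0r -{2}[c v.+1%:Z]mulr1 -mulrBr Normc.normcM.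
have -> : r%:C ^+ v.+1 - 1 = (r ^+ v.+1 - 1)%:C by rewrite [RHS]rmorphB [in RHS]rmorphXn.
have rv : 0 <= 1 - r ^+ v.+1 by rewrite subr_ge0 exprn_ile1 ?ltW.
rewrite normc_real distrC ger0_norm//.
apply: (@le_trans _ _ (M * (N%:R * d))) => //.
rewrite ler_pM ?normc_ge0//.
apply: (@le_trans _ _ (v.+1%:R * (1 - r))); first by apply: bernoulli_sub; rewrite !ltW.
by rewrite /r opprB addrC subrK ler_wpM2r ?ler_nat// ltW.
Qed.

(** The discrete measures are placed at the points k/Q of [0, 1], a limit is taken on the line by
    [helly], and it is wrapped around the circle. On the line the characters are Lipschitz functions
    cos and sin, whose discrete integrals converge to the prescribed values. *)
Theorem herglotz : exists m : {measure set (circle R) -> \bar R},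
  (m setT < +oo)%E /\ forall v, measure_coef m v = c v.
Proof.
have /choice[f fP] : forall n : nat, exists f : nat * (nat -> R), [/\ forall k, 0 <= f.2 k, (0 < f.1)%N &
    forall v, (v <= n)%N ->
      normc (\sum_(k < f.1) (f.2 k)%:C * (uroot R f.1 ^+ k)^*%C ^+ v - c v%:Z) <= harmonic n].
  move=> n; have [Q [w h]] := @herglotz_approximation n (harmonic n) (harmonic_gt0 n).
  by exists (Q, w).
pose Q n := (f n).1; pose w n := (f n).2; pose t n (k : nat) : R := k%:R / (Q n)%:R.
have w0 n k : 0 <= w n k by have [h _ _] := fP n; exact: h.
have Q0 n : (0 < Q n)%N by have [_ h _] := fP n; exact: h.
have h v : cvgc (fun n => \sum_(k < Q n) (w n k)%:C * (uroot R (Q n) ^+ k)^*%C ^+ v) (c v%:Z).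
  apply: (@cvgc_near_le _ _ (@harmonic R) v); last exact: cvg_harmonic.
  by move=> n vn; rewrite normcB; have [_ _ h] := fP n; exact: h.
have t01 n k : (k < Q n)%N -> 0 <= t n k <= 1.
  move=> kQ; rewrite /t divr_ge0//= ler_pdivrMr ?ltr0n// mul1r ler_nat.
  exact: ltnW.
have wM n : \sum_(k < Q n) w n k <= M + 1.
  have [_ _ /(_ 0%N (leq0n _)) h0] := fP n.
  have -> : \sum_(k < Q n) w n k = Re (\sum_(k < Q n) (w n k)%:C * (uroot R (Q n) ^+ k)^*%C ^+ 0 - c 0) + Re (c 0).
    by rewrite -ReD subrK Re_sum; apply: eq_bigr => k _; rewrite expr0 mulr1.
  rewrite addrC lerD//.
    by rewrite (le_trans _ (cM 0))// (le_trans (ler_norm _))// ler_Re_normc.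
  rewrite (le_trans (ler_norm _))// (le_trans (ler_Re_normc _))// (le_trans h0)//.
  by rewrite /harmonic/= invf_le1 ?ltr0n// ler1n.
have [m [mT mP]] := helly w0 t01 wM.
have wt n k v : (uroot R (Q n) ^+ k)^*%C ^+ v =
   cos (2 * pi * v%:R * t n k) +i* - sin (2 * pi * v%:R * t n k).
  rewrite -conjcX -exprM uroot_exp /cexp/= expR0 mul1r natrM.
  have -> : 2 * pi * (k%:R * v%:R / (Q n)%:R) = 2 * pi * v%:R * t n k :> R by rewrite /t; ring.
  by rewrite mul1r !mul0r subr0 addr0.
have bcos (a : R) : bounded_mfun ((fun x => cos (a * x)) : measurableTypeR R -> R).
  split; last by exists 1 => x; exact: cos_max.
  apply: continuous_measurable_fun => x; apply: continuous_comp; last exact: continuous_cos.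
  exact: mulrl_continuous.
have bsin (a : R) : bounded_mfun ((fun x => - sin (a * x)) : measurableTypeR R -> R).
  split; last by exists 1 => x; rewrite normrN; exact: sin_max.
  apply: continuous_measurable_fun => x; apply: cvgN; apply: continuous_comp; last exact: continuous_sin.
  exact: mulrl_continuous.
have lcos (a x y : R) : `|cos (a * x) - cos (a * y)| <= `|a| * `|x - y|.
  by rewrite -normrM mulrBr cos_lipschitz.
have lsin (a x y : R) : `|- sin (a * x) - - sin (a * y)| <= `|a| * `|x - y|.
  by rewrite -normrM mulrBr opprK addrC distrC -opprB normrN -[X in X <= _]normrN opprB sin_lipschitz.
have Icos v : Rintegral m setT (fun x => cos (2 * pi * v%:R * x)) = Re (c v%:Z).
  apply: (mP _ _ _ (bcos _) (lcos _)); have [hr _] := h v.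
  apply: cvg_trans hr; apply: near_eq_cvg; apply: nearW => n.
  by rewrite Re_sum; apply: eq_bigr => k _; rewrite Re_realM wt.
have Isin v : Rintegral m setT (fun x => - sin (2 * pi * v%:R * x)) = Im (c v%:Z).
  apply: (mP _ _ _ (bsin _) (lsin _)); have [_ hi] := h v.
  apply: cvg_trans hi; apply: near_eq_cvg; apply: nearW => n.
  by rewrite Im_sum; apply: eq_bigr => k _; rewrite Im_realM wt.
pose mu : {measure set (circle R) -> \bar R} :=
  measure_function_pushforward__canonical__measure_function_Measure m (@measurable_circle_turn R).
have muT : (mu setT < +oo)%E by rewrite /mu /= /pushforward preimage_setT.
have key (v : nat) : measure_coef mu v%:Z = c v%:Z.
  rewrite /measure_coef bintegral_pushforward//; last exact: Re_bounded_mfun.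
  rewrite bintegral_pushforward//; last exact: Im_bounded_mfun.
  rewrite [RHS](_ : _ = Re (c v%:Z) +i* Im (c v%:Z)); last by case: (c v%:Z).
  rewrite -Icos -Isin; congr (_ +i* _); apply: eq_Rintegral => x _ /=;
    by rewrite circle_exprzN -exprnP circle_turn_expn.
exists mu; split => // -[v|v]; first exact: key.
by rewrite NegzE measure_coefN// key -cJ.
Qed.

End herglotz.

(** * Invariant measures *)

Section invariant_measures.
Variable R : realType.
Local Notation normc := (@Normc.normc R).
Local Notation Re := (@complex.Re R).
Local Notation Im := (@complex.Im R).
Implicit Types (m p : {measure set (circle R) -> \bar R}).

(** A bounded integrand becomes nonnegative after its bound is added; the integral of the constant
    is then cancelled. *)
Lemma bintegral_mscale d (T : measurableType d) (k : {nonneg R})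
    (m : {measure set T -> \bar R}) (f : T -> R) : (m setT < +oo)%E ->
  bounded_mfun f -> Rintegral (mscale k m) setT f = k%:num * Rintegral m setT f.
Proof.
move=> mT hf; have [mf [M hM]] := hf.
have ge0 (g : T -> R) : (forall x, 0 <= g x) -> bounded_mfun g ->
    Rintegral (mscale k m) setT g = k%:num * Rintegral m setT g.
  move=> g0 hg; rewrite /Rintegral ge0_integral_mscale//.
  - by rewrite fineM//; apply: integrable_fin_num => //; exact: bounded_mfun_integrable.
  - by apply/measurable_EFinP; have [] := hg.
  - by move=> x _; rewrite lee_fin.
have hc := @bounded_mfun_cst _ T R M.
have skT : (mscale k m setT < +oo)%E.
  by rewrite /mscale lte_mul_pinfty// lee_fin.
have h1 : Rintegral (mscale k m) setT (fun x => f x + M) = k%:num * Rintegral m setT (fun x => f x + M).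
  apply: ge0; last exact: bounded_mfunD.
  by move=> x; have := hM x; rewrite ler_norml; lra.
have M0 : 0 <= M by apply: le_trans (hM point); exact: normr_ge0.
have h2 : Rintegral (mscale k m) setT (fun=> M) = k%:num * Rintegral m setT (fun=> M) by exact: ge0.
by move: h1; rewrite !bintegralD// h2 mulrDr => /addIr.
Qed.

Lemma measurable_circle_exp N : measurable_fun setT (@circle_exp R N).
Proof.
apply: (measurability (@open (circle R))) => //= _ [U oU <-].
rewrite setTI; apply: sub_sigma_algebra; apply/circle_openP => x Ux.
have [e e0 he] := (circle_openP U).1 oU _ Ux.
exists (e / N.+1%:R); first by rewrite divr_gt0.
move=> y; rewrite ltr_pdivlMr// mulrC => xy; apply: he.
apply: le_lt_trans xy; apply: le_trans (circle_expn_dist x y N) _.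
by rewrite ler_wpM2r ?cdist_ge0// ler_nat.
Qed.

Definition circle_push N m : {measure set (circle R) -> \bar R} :=
  measure_function_pushforward__canonical__measure_function_Measure m
    (@measurable_circle_exp N).

Lemma circle_pushE N m A : circle_push N m A = m (circle_exp N @^-1` A).
Proof. by []. Qed.

Lemma circle_push_lty N m : (m setT < +oo)%E -> (circle_push N m setT < +oo)%E.
Proof. by rewrite circle_pushE preimage_setT. Qed.

Lemma circle_exp_exprz N (x : circle R) (v : int) :
  circle_val (circle_exp N x) ^ (- v) = circle_val x ^ (- (v * N%:Z)).
Proof. by rewrite -mulNr mulrC -exprz_exp. Qed.

Lemma circle_push_coef N m (v : int) : (m setT < +oo)%E ->
  measure_coef (circle_push N m) v = measure_coef m (v * N%:Z).
Proof.
move=> mT; rewrite /measure_coef bintegral_pushforward//; last exact: Re_bounded_mfun.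
rewrite bintegral_pushforward//; last exact: Im_bounded_mfun.
by congr (_ +i* _); apply: eq_Rintegral => x _ /=; rewrite circle_exp_exprz.
Qed.

(** The image under z -> z^N has coefficient of index v N at v, so the relation on coefficients is
    invariance by uniqueness. *)
Lemma invariant_of_coef N m : (m setT < +oo)%E ->
  (forall v, measure_coef m (v * N%:Z) = measure_coef m v) ->
  forall A, measurable A -> m (circle_exp N @^-1` A) = m A.
Proof.
move=> mT h A mA; rewrite -circle_pushE.
apply: (@measure_coef_unique _ _ _ (circle_push_lty _ mT) mT) => // v.
by rewrite circle_push_coef.
Qed.

Lemma coef_of_invariant N m : (m setT < +oo)%E ->
  (forall A, measurable A -> m (circle_exp N @^-1` A) = m A) ->
  forall v, measure_coef m (v * N%:Z) = measure_coef m v.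
Proof.
move=> mT h v; rewrite -circle_push_coef//.
by congr (_ +i* _); apply: bintegral_measure_eq.
Qed.

Lemma haar_invariant N A : (0 < N)%N -> measurable A ->
  haar R (circle_exp N @^-1` A) = haar R A.
Proof.
move=> N0; apply: (@invariant_of_coef N (haar R)); first exact: haarT_lty.
move=> v; rewrite [in LHS]haar_coef [in RHS]haar_coef mulf_eq0.
by rewrite (_ : (N%:Z == 0) = false) ?orbF//; apply/negbTE; rewrite eqz_nat -lt0n.
Qed.

(* Bessel's inequality for the characters x^(v N^j), whose coefficients all
   agree: these would not be square summable. *)
Lemma invariant_bounded_coef0 N m (d : R) : (1 < N)%N -> 0 < d -> (m setT < +oo)%E ->
  (forall A, measurable A -> m (circle_exp N @^-1` A) = m A) ->
  (forall A, measurable A -> (m A <= d%:E * haar R A)%E) ->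
  forall v, v != 0 -> measure_coef m v = 0.
Proof.
move=> N1 d0 mT inv mh v v0.
set a := measure_coef m v.
have aE j : measure_coef m (v * (N ^ j)%N%:Z) = a.
  elim: j => [|j IH]; first by rewrite expn0 mulr1.
  by rewrite expnS mulnC PoszM mulrA coef_of_invariant.
pose u j : int := v * (N ^ j)%N%:Z.
pose b n (x : circle R) := \sum_(j < n) Re (a^*%C * circle_val x ^ (- u j)).
have hb n : bounded_mfun (b n) by apply: bounded_mfun_sum => j; exact: trig_bounded_mfun.
have hb2 n : bounded_mfun (fun x => b n x * b n x) by exact: bounded_mfunM.
have h1 n : Rintegral m setT (b n) = n%:R * normc a ^+ 2.
  rewrite /b bintegral_sum//; last by move=> j; exact: trig_bounded_mfun.
  under eq_bigr do rewrite trig_integral// opprK aE mulrC mulcJ.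
  by rewrite sumr_const card_ord mulr_natl.
(* In the product of two real parts the frequency u_j + u_k is never 0, and u_j - u_k is 0 only for
   j = k. *)
have h2 n : Rintegral (haar R) setT (fun x => b n x * b n x) = n%:R * (2^-1 * normc a ^+ 2).
  have e x : b n x * b n x = \sum_(j < n) \sum_(k < n)
     2^-1 * (Re (a^*%C * a^*%C * circle_val x ^ (- (u j + u k))) +
             Re (a^*%C * a * circle_val x ^ (- (u j - u k)))).
    rewrite /b mulr_suml; apply: eq_bigr => j _; rewrite mulr_sumr; apply: eq_bigr => k _.
    rewrite ReM2; congr (_ * (_ + _)); congr (Re _).
      by rewrite opprD expfzDr ?circle_val_neq0//; ring.
    rewrite opprD expfzDr ?circle_val_neq0// conjcM conjcK -circle_exprzN; ring.
  under eq_Rintegral do rewrite e.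
  have hT := haarT_lty R.
  have hh (j k : 'I_n) : bounded_mfun (fun x : circle R => 2^-1 * (Re (a^*%C * a^*%C * circle_val x ^ (- (u j + u k))) +
             Re (a^*%C * a * circle_val x ^ (- (u j - u k))))).
    by apply/bounded_mfunZ/bounded_mfunD; exact: trig_bounded_mfun.
  rewrite bintegral_sum//; last by move=> j; exact: bounded_mfun_sum.
  rewrite (eq_bigr (fun=> 2^-1 * normc a ^+ 2)).
    by rewrite sumr_const card_ord mulr_natl.
  move=> j _; rewrite bintegral_sum//.
  have e2 (k : 'I_n) : Rintegral (haar R) setT (fun x => 2^-1 * (Re (a^*%C * a^*%C * circle_val x ^ (- (u j + u k))) +
             Re (a^*%C * a * circle_val x ^ (- (u j - u k))))) = 2^-1 * ((j == k)%:R * normc a ^+ 2).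
    rewrite bintegralZ//; last by apply/bounded_mfunD; exact: trig_bounded_mfun.
    rewrite bintegralD//; [|exact: trig_bounded_mfun..].
    rewrite !trig_integral// !opprK !haar_coef.
    have -> : (u j + u k == 0) = false.
      rewrite /u -mulrDr mulf_eq0 (negbTE v0)/= -PoszD eqz_nat addn_eq0.
      by rewrite !expn_eq0 eqn0Ngt (ltnW N1).
    rewrite mulr0 add0r subr_eq0 /u (inj_eq (mulfI v0)) eqz_nat eqn_exp2l//.
    rewrite (mulrC a^*%C) mulcJ Re_realM -[(j == k)%:R]/((j == k :> nat)%:R).
    by case: (j == k :> nat); rewrite /= ?mul1r ?mul0r ?mulr0 ?mulr1 ?add0r.
  under eq_bigr do rewrite e2.
  rewrite (bigD1 j)//= eqxx mul1r big1 ?addr0// => k /negbTE kj.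
  by rewrite eq_sym kj mul0r mulr0.
have h3 n : Rintegral m setT (fun x => b n x * b n x) <=
    d * Rintegral (haar R) setT (fun x => b n x * b n x).
  rewrite -[d]/((NngNum (ltW d0))%:num) -bintegral_mscale//; last exact: haarT_lty.
  apply: fine_le.
  - by apply: integrable_fin_num => //; exact: bounded_mfun_integrable.
  - apply: integrable_fin_num => //; apply: bounded_mfun_integrable => //.
    by rewrite /mscale lte_mul_pinfty ?lee_fin ?ltW//; exact: haarT_lty.
  - apply: ge0_le_measure_integral => //.
      by move=> x; rewrite lee_fin -expr2 sqr_ge0.
    by apply/measurable_EFinP; have [] := hb2 n.
(* This is (b - d)^2 >= 0 integrated against m. The linear term has weight 2d and the square at most
   d/2, so n |a|^2 stays bounded. *)
have h4 n : 2 * d * (n%:R * normc a ^+ 2) - d ^+ 2 * fine (m setT) <=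
    d * (n%:R * (2^-1 * normc a ^+ 2)).
  rewrite -h1 -h2; apply: le_trans (h3 n).
  rewrite -bintegral_cst// -bintegralZ// -bintegralB//; last 2 first.
  - exact: bounded_mfunZ.
  - exact: bounded_mfun_cst.
  apply: le_bintegral => //.
  - by apply: bounded_mfunB; [exact: bounded_mfunZ|exact: bounded_mfun_cst].
  - by move=> x; have := sqr_ge0 (b n x - d); lra.
have h5 n : n%:R * normc a ^+ 2 <= d * fine (m setT).
  have m0 : 0 <= fine (m setT) by exact: fine_ge0.
  have a0 : 0 <= n%:R * normc a ^+ 2 by rewrite mulr_ge0// sqr_ge0.
  by rewrite -(ler_pM2l d0); have := h4 n; nra.
have [a2|] := ltP 0 (normc a ^+ 2); last first.
  rewrite le_eqVlt ltNge sqr_ge0 orbF sqrf_eq0 => /eqP.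
  exact: Normc.eq0_normc.
have := archi_boundP (_ : 0 <= d * fine (m setT) / normc a ^+ 2).
have -> : 0 <= d * fine (m setT) / normc a ^+ 2 by rewrite divr_ge0 ?sqr_ge0// mulr_ge0 ?(ltW d0)// fine_ge0.
by move/(_ erefl); rewrite ltr_pdivrMr// ltNge h5.
Qed.

(* The negative part of m - d haar is invariant and dominated by d haar, so it
   is a multiple of haar, positive as soon as m has mass below d; hence the
   set carrying the positive part is haar-negligible. *)
Lemma invariant_decomposition N m : (1 < N)%N -> (m setT < +oo)%E ->
  (forall A, measurable A -> m (circle_exp N @^-1` A) = m A) ->
  exists (beta : R) (sigma : {finite_measure set (circle R) -> \bar R}),
    mutually_singular sigma (haar R) /\
    forall A, measurable A -> m A = (beta%:E * haar R A + sigma A)%E.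
Proof.
move=> N1 mT inv; have N0 : (0 < N)%N by exact: ltnW.
pose m' : {finite_measure set (circle R) -> \bar R} := mfrestr measurableT mT.
have m'E A : m' A = m A by rewrite /m' /= /mfrestr /mrestr setIT.
have hT := haarT_lty R.
pose phi := @circle_exp R N.
have mphi A : measurable A -> measurable (phi @^-1` A).
  by move=> mA; rewrite -[X in measurable X]setTI; exact: measurable_circle_exp.
(* Any d above the mass of m makes kappa negative on the whole circle, hence its negative part
   nonzero ([k0]). *)
pose d := fine (m setT) + 1.
have d0 : 0 < d by rewrite /d ltr_wpDl ?fine_ge0.
pose kappa : {charge set (circle R) -> \bar R} :=
  cadd (charge_of_finite_measure m')
       (cscale (- d) (charge_of_finite_measure (haar R))).
have kappaE A : measurable A -> (kappa A = m A - d%:E * haar R A)%E.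
  move=> mA; transitivity (m' A + (- d)%:E * haar R A)%E; first by [].
  by rewrite m'E EFinN mulNe.
have mfin A : measurable A -> m A \is a fin_num.
  by move=> mA; rewrite -m'E fin_num_measure.
have hfin A : measurable A -> haar R A \is a fin_num.
  by move=> mA; rewrite fin_num_measure.
have [P [S hPS]] := Hahn_decomposition kappa.
have [[mP _] [mS hS] PS PS0] := hPS.
pose kn : {finite_measure set (circle R) -> \bar R} := jordan_neg hPS.
pose kp : {finite_measure set (circle R) -> \bar R} := jordan_pos hPS.
have knT : (kn setT < +oo)%E by rewrite -ge0_fin_numE// fin_num_measure.
have knE A : measurable A -> (kn A = - kappa (A `&` S))%E.
  by move=> mA; rewrite -[LHS]/(jordan_neg hPS A) jordan_negE cjordan_negE /crestr0 mem_set.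
have kpE A : measurable A -> (kp A = kappa (A `&` P))%E.
  by move=> mA; rewrite -[LHS]/(jordan_pos hPS A) jordan_posE cjordan_posE /crestr0 mem_set.
have kdec A : measurable A -> (kappa A = kp A - kn A)%E.
  move=> mA; rewrite (jordan_decomp hPS mA) /cadd; congr (_ + _)%E.
  by rewrite /cscale EFinN; exact: mulN1e.
have knfin A : measurable A -> kn A \is a fin_num by move=> mA; exact: fin_num_measure.
have kpfin A : measurable A -> kp A \is a fin_num by move=> mA; exact: fin_num_measure.
have knd A : measurable A -> (kn A <= d%:E * haar R A)%E.
  move=> mA; have mAS : measurable (A `&` S) by exact: measurableI.
  rewrite knE// kappaE//.
  have : fine (haar R (A `&` S)) <= fine (haar R A).
    by rewrite fine_le ?hfin// le_measure ?inE.
  have : 0 <= fine (m (A `&` S)) by exact: fine_ge0.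
  rewrite -(fineK (mfin _ mAS)) -(fineK (hfin _ mAS)) -(fineK (hfin _ mA)).
  rewrite -!EFinM -EFinB -EFinN lee_fin.
  by move=> /= h1 h2; have := ler_wpM2l (ltW d0) h2; move: h1; lra.
(* kn(A) is -kappa(A [&] S), which equals -kappa of the preimage because m and haar are invariant;
   and -kappa <= kn everywhere. *)
have knle A : measurable A -> (kn A <= kn (phi @^-1` A))%E.
  move=> mA; have mAS : measurable (A `&` S) by exact: measurableI.
  have mphiAS := mphi _ mAS; have mphiA := mphi _ mA.
  rewrite knE// kappaE// -inv// -(haar_invariant N0)// -kappaE//.
  apply: (@le_trans _ _ (kn (phi @^-1` (A `&` S)))); last first.
    by rewrite le_measure ?inE//; apply: preimage_subset; exact: subIsetl.
  rewrite kdec//; have : (0 <= kp (phi @^-1` (A `&` S)))%E by [].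
  rewrite -(fineK (kpfin _ mphiAS)) -(fineK (knfin _ mphiAS)) -EFinB -EFinN !lee_fin.
  by move: (fine _) (fine _) => x y; lra.
have kninv A : measurable A -> kn (phi @^-1` A) = kn A.
  move=> mA; have mCA := measurableC mA.
  have mpA := mphi _ mA; have mpCA := mphi _ mCA.
  have kU B : measurable B -> (kn B + kn (~` B) = kn setT)%E.
    by move=> mB; rewrite -measureU ?setUv ?setICr//; exact: measurableC.
  have := kU _ mA; have := kU _ mpA; have := knle _ mA; have := knle _ mCA.
  rewrite -preimage_setC -[kn (phi @^-1` A)](fineK (knfin _ mpA)) -[kn A](fineK (knfin _ mA)).
  rewrite -[kn (~` A)](fineK (knfin _ mCA)) -[kn (phi @^-1` (~` A))](fineK (knfin _ mpCA)).
  rewrite -[kn setT](fineK (knfin _ measurableT)) -!EFinD !lee_fin => h1 h2 [h3] [h4].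
  by congr (_%:E); lra.
have kn0 v : v != 0 -> measure_coef kn v = 0 by exact: (invariant_bounded_coef0 N1 d0).
have k0 : 0 < fine (kn setT).
  have := kdec _ measurableT; rewrite kappaE// probability_setT mule1.
  have : 0 <= fine (kp setT) by exact: fine_ge0.
  rewrite -[m setT]fineK ?mfin// -[kp setT]fineK ?kpfin// -[kn setT]fineK ?knfin//.
  by rewrite -!EFinB => h [] /=; rewrite /d; lra.
have knh A : measurable A -> (kn A = (fine (kn setT))%:E * haar R A)%E.
  move=> mA; rewrite -[LHS](_ : mscale (NngNum (ltW k0)) (haar R) A = _)//.
  apply: (measure_coef_unique _ knT) => //.
    by rewrite /mscale lte_mul_pinfty ?lee_fin ?ltW.
  move=> v; rewrite {1}/measure_coef !bintegral_mscale//; [|exact: Im_bounded_mfun|exact: Re_bounded_mfun].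
  have := haar_coef R v; rewrite {1}/measure_coef; have [->|v0] := eqVneq v 0.
    by case=> -> ->; rewrite mulr1 mulr0 measure_coef0.
  by case=> -> ->; rewrite mulr0 [RHS]kn0.
(* kn is carried by S, so it gives P mass 0; being a positive multiple of haar, it transfers this to
   haar. *)
have hP : haar R P = 0%E.
  have := knh _ mP; rewrite knE// PS0 charge0 oppe0 => /esym/eqP.
  by rewrite mule_eq0 eqe gt_eqF//= => /eqP.
exists (d - fine (kn setT)), kp; split.
  exists S; split=> //; first by have := kpE _ mS; rewrite setIC PS0 charge0.
  apply: (subset_measure0 _ mP) => //; first exact: measurableC.
  by move=> x Sx; have : [set: circle R] x by []; rewrite -PS => -[].
move=> A mA.
have := kappaE A mA; rewrite kdec// knh//.
rewrite -[m A]fineK ?mfin// -[kp A]fineK ?kpfin// -[haar R A]fineK ?hfin//.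
by rewrite -!EFinM -!EFinB -EFinD => -[h]; congr (_%:E); lra.
Qed.

End invariant_measures.

(** * Special measures and square summability *)

Section bounded_power_series.
Variable R : realType.
Local Notation normc := (@Normc.normc R).
Local Notation Re := (@complex.Re R).
Local Notation Im := (@complex.Im R).

(** For a power series the bound depends on |z| only, hence is uniform on a circle. *)
Lemma abs_cvgc_tail (u : nat -> R[i]) (l : R[i]) (Q : nat) :
  cvgn (series (fun n => normc (u n))) -> cvgc (fun n => \sum_(i < n) u i) l ->
  normc (l - \sum_(i < Q) u i) <=
  limn (series (fun n => normc (u n))) - series (fun n => normc (u n)) Q.
Proof.
move=> hu hl.
have h : cvgc (fun m => \sum_(i < Q + m) u i - \sum_(i < Q) u i) (l - \sum_(i < Q) u i).
  apply: cvgcB; last exact: cvgc_cst.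
  apply: (cvgc_comp (u := fun n => \sum_(i < n) u i)) => //.
  by apply/cvgnyPge => k; exists k => // m /= km; rewrite (leq_trans km)// leq_addl.
apply: (cvgc_normc_le h) => m.
rewrite big_split_ord/= addrAC subrr add0r (le_trans (normc_sum _ _ _))//.
rewrite lerBrDl.
have h2 : series (fun n => normc (u n)) (Q + m)%N <= limn (series (fun n => normc (u n))).
  apply: nondecreasing_cvgn_le hu _; apply: nondecreasing_series => k _ _.
  exact: normc_ge0.
by apply: le_trans h2; rewrite [series _]series_ord big_split_ord.
Qed.

(** On |z| = r the Q-th partial sum is at most K plus the absolute tail. Parseval over the Q-th
    roots of unity bounds sum |b_j|^2 r^(2j); then Q tends to infinity, and afterwards r to 1. *)
Lemma square_summable_bounded (b : nat -> R[i]) (F : R[i] -> R[i]) (K : R) :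
  (forall z, normc z < 1 -> cvgn (series (fun n => normc (b n * z ^+ n)))) ->
  (forall z, normc z < 1 -> cvgc (fun n => \sum_(i < n) b i * z ^+ i) (F z)) ->
  (forall z, normc z < 1 -> normc (F z) <= K) ->
  cvgn (series (fun n => normc (b n) ^+ 2)).
Proof.
move=> hb hF FK.
have K0 : 0 <= K by rewrite (le_trans _ (FK 0 _)) ?normc_ge0// Normc.normc0.
have h1 (r : R) L : 0 <= r < 1 -> \sum_(j < L) normc (b j) ^+ 2 * (r ^+ 2) ^+ j <= K ^+ 2.
  move=> /andP[r0 r1].
  have nr : normc r%:C = r by rewrite normc_real ger0_norm.
  have hr : cvgn (series (fun n => normc (b n * r%:C ^+ n))) by apply: hb; rewrite nr.
  set s := series (fun n => normc (b n * r%:C ^+ n)) in hr *.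
  have hs : (fun Q => (K + (limn s - s Q)) ^+ 2) @ \oo --> (K + (limn s - limn s)) ^+ 2.
    under eq_fun do rewrite expr2; rewrite expr2.
    have h : (fun Q => K + (limn s - s Q)) @ \oo --> K + (limn s - limn s).
      by apply: cvgD; [exact: cvg_cst|apply: cvgB; [exact: cvg_cst|exact: hr]].
    by apply: cvgM; exact: h.
  rewrite subrr addr0 in hs; rewrite -(cvg_lim _ hs)//; apply: limr_ge; first exact: cvgP hs.
  exists L.+1 => // Q /= LQ.
  have Q0 : (0 < Q)%N by exact: leq_ltn_trans LQ.
  apply: (@le_trans _ _ (\sum_(j < Q) normc (b j) ^+ 2 * (r ^+ 2) ^+ j)).
    rewrite -(subnKC (ltnW LQ)) big_split_ord/= lerDl sumr_ge0// => j _.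
    by rewrite mulr_ge0 ?sqr_ge0// exprn_ge0 ?sqr_ge0.
  have Qr : 0 < Q%:R :> R by rewrite ltr0n.
  rewrite -(ler_pM2l Qr).
  have e (j : 'I_Q) : normc (b j) ^+ 2 * (r ^+ 2) ^+ j = normc (b j * r%:C ^+ j) ^+ 2.
    by rewrite Normc.normcM normcX nr [RHS]exprMn; congr (_ * _); exact: exprAC.
  under eq_bigr do rewrite e.
  rewrite -(discrete_parseval Q (fun j => b j * r%:C ^+ j)).
  apply: (@le_trans _ _ (\sum_(k < Q) (K + (limn s - s Q)) ^+ 2)); last first.
    by rewrite sumr_const card_ord mulr_natl.
  apply: ler_sum => k _.
  pose z := r%:C * uroot R Q ^+ k.
  have nz : normc z = r by rewrite Normc.normcM normcX normc_uroot expr1n mulr1 nr.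
  have z1 : normc z < 1 by rewrite nz.
  have -> : \sum_(j < Q) b j * r%:C ^+ j * uroot R Q ^+ (k * j) = \sum_(j < Q) b j * z ^+ j.
    by apply: eq_bigr => j _; rewrite exprMn -exprM mulrA.
  have ht := abs_cvgc_tail Q (hb _ z1) (hF _ z1).
  have es : series (fun n => normc (b n * z ^+ n)) = s.
    by rewrite /s; congr (series _); apply/funext => n; rewrite !Normc.normcM !normcX nz nr.
  rewrite es in ht.
  have ht0 := le_trans (normc_ge0 _) ht.
  rewrite ler_pXn2r ?nnegrE ?normc_ge0 ?(addr_ge0 K0 ht0)//.
  rewrite -(subKr (F z) (\sum_(j < Q) _)) (le_trans (le_normcB _ _))// lerD//; exact: FK.
have h2 L : \sum_(j < L) normc (b j) ^+ 2 <= K ^+ 2.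
  have hr : (fun n => (1 - @harmonic R n) ^+ 2) @ \oo --> (1 : R).
    under eq_fun do rewrite expr2.
    have h : (fun n => 1 - @harmonic R n) @ \oo --> (1 - 0 : R).
      by apply: cvgB; [exact: cvg_cst|exact: cvg_harmonic].
    have := cvgM h h; rewrite subr0 mulr1; exact.
  have hp j : (fun n => ((1 - @harmonic R n) ^+ 2) ^+ j) @ \oo --> (1 : R).
    elim: j => [|j IH]; first by under eq_fun do rewrite expr0; exact: cvg_cst.
    under eq_fun do rewrite exprS; have := cvgM hr IH; rewrite mulr1; exact.
  have h : (fun n => \sum_(j < L) normc (b j) ^+ 2 * ((1 - @harmonic R n) ^+ 2) ^+ j) @ \oo -->
       \sum_(j < L) normc (b j) ^+ 2.
    apply: sum_cvg => j; have h : (fun=> normc (b j) ^+ 2) @ \oo --> normc (b j) ^+ 2 by exact: cvg_cst.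
    have := cvgM h (hp j); rewrite mulr1; exact.
  apply: (cvg_le_cst h) => n; apply: h1.
  rewrite subr_ge0 ltrBlDr ltrDl harmonic_gt0 andbT.
  by rewrite /harmonic/= invf_le1 ?ltr0n// ler1n.
apply: nondecreasing_is_cvgn; first by apply: nondecreasing_series => k _ _; exact: sqr_ge0.
by exists (K ^+ 2) => _ [n _ <-]; rewrite series_ord h2.
Qed.

Lemma normc_cexp_le (w : R[i]) (a : R) : - a <= Re w -> normc (cexp (- w)) <= expR a.
Proof. by rewrite normc_cexp ReN ler_expR lerNl. Qed.

(* (1 - w) (1 + 2 sum_(1 <= v <= n) w^v) = 1 + w - 2 w^(n+1), and
   (1 + w) / (1 - w) has nonnegative real part. *)
Lemma dirichlet_disc_ge (w : R[i]) n : normc w < 1 ->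
  - (2 * normc w ^+ n.+1 / (1 - normc w)) <= Re (1 + 2 * \sum_(i < n) w ^+ i.+1).
Proof.
move=> w1; set P : R[i] := 1 + 2 * _; have w0 := normc_ge0 w.
have e : (1 - w) * P = 1 + w - 2 * w ^+ n.+1.
  rewrite /P; elim: (n) => [|k IH]; first by rewrite big_ord0 expr1; ring.
  rewrite big_ord_recr/= (mulrDr (2 : R[i])) addrA (mulrDr (1 - w)) IH [w ^+ k.+2]exprS; ring.
have h1 : normc (1 - w) ^+ 2 * Re P = 1 - normc w ^+ 2 - 2 * Re ((1 - w)^*%C * w ^+ n.+1).
  have -> : normc (1 - w) ^+ 2 * Re P = Re ((1 - w)^*%C * ((1 - w) * P)).
    by rewrite mulrA (mulrC (_^*%C)) mulcJ Re_realM.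
  rewrite e mulrBr ReD ReN; congr (_ - _).
    by rewrite normc_sqr; case: (w) => x y /=; ring.
  have -> : (1 - w)^*%C * (2 * w ^+ n.+1) = 2%:C * ((1 - w)^*%C * w ^+ n.+1).
    by rewrite rmorph_nat; ring.
  by rewrite Re_realM.
have n1 : normc 1 = 1 by rewrite -[RHS]normr1; exact: (normc_real 1).
have h2 : 1 - normc w <= normc (1 - w).
  by rewrite lerBlDr (le_trans _ (le_normcD _ _))// subrK n1.
set d := normc (1 - w) in h1 h2 *; have d0 : 0 < d by apply: lt_le_trans h2; rewrite subr_gt0.
have h3 : Re ((1 - w)^*%C * w ^+ n.+1) <= d * normc w ^+ n.+1.
  apply: le_trans (ler_norm _) _; apply: le_trans (ler_Re_normc _) _.
  by rewrite Normc.normcM normc_conj normcX.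
have h4 : - (2 * normc w ^+ n.+1) <= d * Re P.
  rewrite -(ler_pM2l d0) mulrA -expr2 h1.
  have : normc w ^+ 2 <= 1 by exact: exprn_ile1 w0 (ltW w1).
  by move: h3; lra.
have r0 : 0 <= normc w ^+ n.+1 by exact: exprn_ge0.
have r1 : 0 < 1 - normc w by rewrite subr_gt0.
rewrite lerNl -(ler_pM2l r1) [leRHS]mulrC divfK ?gt_eqF//.
move: h4 h2 r1; move: (Re P) => p; nra.
Qed.

End bounded_power_series.

(** * Fourier coefficients of charges, and positivity in the disc *)

Section charge_fourier_coefficients.
Variable R : realType.
Local Notation normc := (@Normc.normc R).
Local Notation Re := (@complex.Re R).
Local Notation Im := (@complex.Im R).
Implicit Types (m : {measure set (circle R) -> \bar R}) (mu : {charge set (circle R) -> \bar R}).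

(** The real a may be negative, so mu is written as the difference of m + max(a, 0) haar and max(-a,
    0) haar. *)
Lemma charge_integral_affine mu m (a : R) (f : circle R -> R) :
  (m setT < +oo)%E -> bounded_mfun f ->
  (forall A, measurable A -> mu A = a%:E * haar R A + m A)%E ->
  charge_integral mu f = a * Rintegral (haar R) setT f + Rintegral m setT f.
Proof.
move=> mT hf h; have hT := haarT_lty R.
have ap : 0 <= Num.max a 0 by rewrite le_max lexx orbT.
have an : 0 <= Num.max (- a) 0 by rewrite le_max lexx orbT.
have aE : Num.max a 0 - Num.max (- a) 0 = a.
  by case: (leP a 0) => a0; case: (leP (- a) 0) => b0; lra.
have sT (k : {nonneg R}) : (mscale k (haar R) setT < +oo)%E.
  by rewrite /mscale lte_mul_pinfty// lee_fin.
have hE A : measurable A -> (mu A = measure_add m (mscale (NngNum ap) (haar R)) A -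
    mscale (NngNum an) (haar R) A)%E.
  move=> mA; rewrite h//.
  rewrite [X in (X - _)%E](measure_addE m (mscale (NngNum ap) (haar R))).
  change (a%:E * haar R A + m A = m A + (Num.max a 0)%:E * haar R A - (Num.max (- a) 0)%:E * haar R A)%E.
  have hA : haar R A \is a fin_num by exact: fin_num_measure.
  have mA' : m A \is a fin_num.
    by rewrite ge0_fin_numE// (le_lt_trans _ mT)// le_measure// ?inE.
  rewrite -(fineK hA) -(fineK mA') -!EFinM -!EFinD; congr (_%:E).
  by rewrite -[in LHS]aE; ring.
rewrite (charge_integralE (measure_addT_lty mT (sT (NngNum ap))) (sT (NngNum an)) hE hf).
have e1 := bintegral_measure_add mT (sT (NngNum ap)) hf.
have e2 := bintegral_mscale (NngNum ap) hT hf.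
have e3 := bintegral_mscale (NngNum an) hT hf.
transitivity (Rintegral m setT f + Num.max a 0 * Rintegral (haar R) setT f -
    Num.max (- a) 0 * Rintegral (haar R) setT f).
  by congr (_ - _); [rewrite [LHS]e1; congr (_ + _); exact: e2|exact: e3].
by rewrite -[in RHS]aE; ring.
Qed.

Lemma fourier_coef_affine mu m (a : R) v :
  (m setT < +oo)%E ->
  (forall A, measurable A -> mu A = a%:E * haar R A + m A)%E ->
  fourier_coef mu v = measure_coef m v + a%:C * (v == 0)%:R.
Proof.
move=> mT h; rewrite /fourier_coef /charge_Cintegral.
rewrite !(charge_integral_affine mT _ h); [|exact: Im_bounded_mfun|exact: Re_bounded_mfun].
rewrite -haar_coef /measure_coef.
by apply/eqP; rewrite eq_complex/= !mul0r subr0 addr0 ![_ + a * _]addrC !eqxx.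
Qed.

Lemma fourier_coefB mu v :
  fourier_coef mu v = measure_coef (charge_pos mu) v - measure_coef (charge_neg mu) v.
Proof. by []. Qed.

Lemma measure_coef_add m m' v : (m setT < +oo)%E -> (m' setT < +oo)%E ->
  measure_coef (measure_add m m') v = measure_coef m v + measure_coef m' v.
Proof.
move=> mT mT'; rewrite /measure_coef !bintegral_measure_add//.
- exact: Im_bounded_mfun.
- exact: Re_bounded_mfun.
Qed.

(** Uniqueness for positive measures is applied to the positive part of each charge plus the
    negative part of the other. *)
Lemma fourier_coef_unique mu mu' :
  (forall v, fourier_coef mu v = fourier_coef mu' v) ->
  forall A, measurable A -> mu A = mu' A.
Proof.
move=> h A mA.
have fin (nu : {charge set (circle R) -> \bar R}) B : measurable B ->
    (charge_pos nu B \is a fin_num) /\ (charge_neg nu B \is a fin_num).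
  by move=> mB; split; rewrite /charge_pos /charge_neg fin_num_measure.
have lty (nu : {charge set (circle R) -> \bar R}) :
    (charge_pos nu setT < +oo)%E /\ (charge_neg nu setT < +oo)%E.
  by have [h1 h2] := fin nu _ measurableT; rewrite !ltey_eq h1 h2.
have [pT nT] := lty mu; have [pT' nT'] := lty mu'.
have : measure_add (charge_pos mu) (charge_neg mu') A =
       measure_add (charge_pos mu') (charge_neg mu) A.
  apply: measure_coef_unique mA; [exact: measure_addT_lty..|] => v.
  rewrite !measure_coef_add//; apply/eqP; rewrite eq_sym -subr_eq addrAC.
  by rewrite -fourier_coefB -h fourier_coefB subrK.
have [pA nA] := fin mu _ mA; have [pA' nA'] := fin mu' _ mA.
rewrite (charge_posB mu mA) (charge_posB mu' mA).
rewrite [LHS in LHS = _ -> _](measure_addE (charge_pos mu) (charge_neg mu')).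
rewrite [RHS in _ = RHS -> _](measure_addE (charge_pos mu') (charge_neg mu)).
rewrite -(fineK pA) -(fineK nA) -(fineK pA') -(fineK nA') -!EFinD => -[e].
by congr (_%:E); lra.
Qed.

(** The lower bound of [dirichlet_disc_ge] at w = z / x does not depend on x in the circle. It is
    integrated for each n, so the limit is taken outside the integral. *)
Lemma herglotz_ge0 m z G : (m setT < +oo)%E -> normc z < 1 ->
  cvgc (fun n => \sum_(i < n) measure_coef m i.+1%:Z * z ^+ i.+1) G ->
  0 <= Re (measure_coef m 0 + 2 * G).
Proof.
move=> mT z1 hG.
pose e n := 2 * normc z ^+ n.+1 / (1 - normc z).
have he : e @ \oo --> (0 : R).
  have h : (fun n => normc z ^+ n.+1) @ \oo --> (0 : R).
    have := @cvg_expr R (normc z); rewrite ger0_norm ?normc_ge0// => /(_ z1).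
    by rewrite -(cvg_shiftS (fun n => normc z ^+ n)); exact.
  have h2 := cvgM (cvgM (cvg_cst (2 : R)) h) (cvg_cst (1 - normc z)^-1 : _ @ \oo --> _).
  by move: h2; rewrite mulr0 mul0r; exact.
have h1 n : - (e n * fine (m setT)) <=
    Re (measure_coef m 0 + 2 * \sum_(i < n) measure_coef m i.+1%:Z * z ^+ i.+1).
  pose P (x : circle R) := 1 + \sum_(i < n) Re (2 * z ^+ i.+1 * circle_val x ^ (- i.+1%:Z)).
  have hb1 : bounded_mfun (fun x : circle R => \sum_(i < n) Re (2 * z ^+ i.+1 * circle_val x ^ (- i.+1%:Z))).
    by apply: bounded_mfun_sum => i; exact: trig_bounded_mfun.
  have hb2 : bounded_mfun P by apply: bounded_mfunD => //; exact: bounded_mfun_cst.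
  have -> : Re (measure_coef m 0 + 2 * \sum_(i < n) measure_coef m i.+1%:Z * z ^+ i.+1) =
      Rintegral m setT P.
    rewrite bintegralD//; last exact: bounded_mfun_cst.
    rewrite bintegral_cst mul1r bintegral_sum//; last by move=> i; exact: trig_bounded_mfun.
    rewrite ReD measure_coef0 mulr_sumr Re_sum; congr (_ + _); apply: eq_bigr => i _.
    by rewrite trig_integral// opprK; congr (Re _); ring.
  rewrite -mulNr -bintegral_cst; apply: le_bintegral => //; first exact: bounded_mfun_cst.
  move=> x; pose w := z * (circle_val x)^*%C.
  have nw : normc w = normc z by rewrite Normc.normcM normc_conj normc_circle mulr1.
  have := @dirichlet_disc_ge R w n; rewrite nw => /(_ z1); rewrite -/(e n).
  suff -> : Re (1 + 2 * \sum_(i < n) w ^+ i.+1) = P x by [].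
  rewrite ReD mulr_sumr Re_sum; congr (_ + _); apply: eq_bigr => i _.
  by rewrite circle_exprzN -exprnP conjcX -mulrA -exprMn.
have h2 : (fun n => Re (measure_coef m 0 + 2 * \sum_(i < n) measure_coef m i.+1%:Z * z ^+ i.+1)
     + e n * fine (m setT)) @ \oo --> Re (measure_coef m 0 + 2 * G) + 0 * fine (m setT).
  apply: cvgD; last by apply: cvgM => //; exact: cvg_cst.
  have [hr _] := cvgcD (cvgc_cst (measure_coef m 0)) (cvgcMl 2 hG).
  exact: hr.
rewrite mul0r addr0 in h2; rewrite -(cvg_lim _ h2)//.
apply: limr_ge; first exact: cvgP h2.
by apply: nearW => n; have := h1 n; rewrite -subr_ge0 opprK.
Qed.

End charge_fourier_coefficients.

(** * The two summability conditions and special measures *)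

Section exponential_criterion.
Variable R : realType.
Local Notation normc := (@Normc.normc R).
Local Notation Re := (@complex.Re R).
Local Notation Im := (@complex.Im R).

Lemma cvgc_shiftS (u : nat -> R[i]) l : cvgc (fun n => u n.+1) l -> cvgc u l.
Proof.
move=> [hr hi]; split.
  by move: hr; rewrite (cvg_shiftS (fun n => Re (u n))).
by move: hi; rewrite (cvg_shiftS (fun n => Im (u n))).
Qed.

Lemma normc_lt1 (z : R[i]) : `|z| < 1 -> normc z < 1.
Proof. by rewrite normrcE -(ltcR _ 1). Qed.

Lemma special_coef_conj (mu : {charge set (circle R) -> \bar R}) v :
  special mu -> fourier_coef mu (- v) = (fourier_coef mu v)^*%C.
Proof.
move=> [a [s [_ muE]]].
have sT : (s setT < +oo)%E by rewrite -ge0_fin_numE// fin_num_measure.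
rewrite !(fourier_coef_affine _ sT muE) measure_coefN// oppr_eq0.
have -> (x y : R[i]) : (x + y)^*%C = x^*%C + y^*%C by exact: rmorphD.
by rewrite [in RHS]conjcM conjc_real conjc_nat.
Qed.

(** As haar is invariant, so is the singular part; the term of haar is present only at v = 0, and v
    N = 0 only then. *)
Lemma special_invariant_coef_periodic N (mu : {charge set (circle R) -> \bar R}) v :
  (0 < N)%N -> special mu -> invariant_charge N mu ->
  fourier_coef mu (v * N%:Z) = fourier_coef mu v.
Proof.
move=> N0 [a [s [_ muE]]] inv.
have sT : (s setT < +oo)%E by rewrite -ge0_fin_numE// fin_num_measure.
rewrite !(fourier_coef_affine _ sT muE); congr (_ + _ * _).
  apply: coef_of_invariant => // A mA.
  have mpA : measurable (circle_exp N @^-1` A).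
    by rewrite -[X in measurable X]setTI; exact: measurable_circle_exp.
  have := inv A mA; rewrite /pushforward !muE// haar_invariant//.
  have hA : haar R A \is a fin_num by exact: fin_num_measure.
  have sA : s A \is a fin_num by exact: fin_num_measure.
  have sA' : s (circle_exp N @^-1` A) \is a fin_num by exact: fin_num_measure.
  rewrite -(fineK hA) -(fineK sA) -(fineK sA') -EFinM -!EFinD => -[/addrI/(congr1 (@EFin R))].
  rewrite (fineK sA) (fineK sA'); exact.
by rewrite mulf_eq0 [N%:Z == 0](_ : _ = false) ?orbF// eqz_nat; case: (N) N0.
Qed.

Variables (N : nat) (c : int -> R[i]) (M : R).
Hypothesis cM : forall v, normc (c v) <= M.
Local Notation T := (taylor_part c).

Lemma taylor_part_cvg z : normc z < 1 ->
  cvgc (fun n => \sum_(i < n) c i.+1%:Z * z ^+ i.+1) (T z).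
Proof.
move=> z1; have [G hG] := taylor_cvg cM z1.
suff -> : T z = G by [].
have := (cvgc_series (fun k => c k.+1%:Z * z ^+ k.+1) G).1 hG; exact: cvg_lim.
Qed.

Lemma affine_taylor_cvg a k z : normc z < 1 ->
  cvgc (fun n => \sum_(i < n) (if val i is j.+1 then k * c j.+1%:Z else a) * z ^+ i)
    (a + k * T z).
Proof.
move=> z1; apply: cvgc_shiftS.
apply: eq_cvgc (cvgcD (cvgc_cst a) (cvgcMl k (taylor_part_cvg z1))) => n.
rewrite big_ord_recl/= mulr1 mulr_sumr; congr (_ + _).
by apply: eq_bigr => i _; rewrite mulrA.
Qed.

(** For eps = 2 the two functions differ by the constant factor exp(c_0). *)
Lemma exp_eps_of_exp_square_summable :
  exp_square_summable c -> exp_eps_square_summable c.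
Proof.
move=> [b [hb sb]]; exists 2; split => //; exists (fun n => cexp (c 0) * b n); split.
  move=> z z1; apply/cvgc_series.
  have -> : cexp (- (2 : R)%:C * T z) = cexp (c 0) * cexp (- c 0 - 2 * T z).
    by rewrite -cexpD; congr cexp; rewrite rmorph_nat; ring.
  have /cvgc_series h := hb z z1.
  apply: eq_cvgc (cvgcMl (cexp (c 0)) h) => n.
  by rewrite mulr_sumr; apply: eq_bigr => i _; rewrite mulrA.
rewrite /square_summable series_ord; move: sb; rewrite /square_summable series_ord => sb.
have e n : \sum_(i < n) normc (cexp (c 0) * b i) ^+ 2 =
   normc (cexp (c 0)) ^+ 2 * \sum_(i < n) normc (b i) ^+ 2.
  by rewrite mulr_sumr; apply: eq_bigr => i _; rewrite Normc.normcM exprMn.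
under eq_fun do rewrite e.
by apply: cvgP; apply: cvgM; [exact: cvg_cst|exact: sb].
Qed.

Lemma special_coef_exp_square_summable (mu : {charge set (circle R) -> \bar R}) :
  special mu -> (forall v, fourier_coef mu v = c v) -> exp_square_summable c.
Proof.
move=> [a [s [_ muE]]] hc.
have sT : (s setT < +oo)%E by rewrite -ge0_fin_numE// fin_num_measure.
have cE v : c v = measure_coef s v + a%:C * (v == 0)%:R by rewrite -hc (fourier_coef_affine _ sT muE).
have M0 : 0 <= M by rewrite (le_trans _ (cM 0)) ?normc_ge0.
pose f n := if n is j.+1 then - 2 * c j.+1%:Z else - c 0.
have fM n : normc (f n) <= 2 * M.
  case: n => [|n]; rewrite /f ?mulNr normcN.
    by rewrite (le_trans (cM _))// ler_peMl// ler1n.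
  by rewrite Normc.normcM normc_nat ler_wpM2l.
have [b hb] := cexp_of_power_series fM.
have hF z : normc z < 1 -> cvgc (fun n => \sum_(i < n) b i * z ^+ i) (cexp (- c 0 - 2 * T z)).
  by move=> z1; rewrite -mulNr; apply: (hb z z1).2; exact: affine_taylor_cvg.
exists b; split; first by move=> z /normc_lt1 z1; apply/cvgc_series; exact: hF.
(* The constant is exp(-a) because Re (c_0 + 2 T z) >= a. *)
apply: (square_summable_bounded (F := fun z => cexp (- c 0 - 2 * T z)) (K := expR (- a))) => // z z1.
  exact: (hb z z1).1.
rewrite -opprD; apply: normc_cexp_le; rewrite opprK.
have h : 0 <= Re (measure_coef s 0 + 2 * T z).
  apply: (herglotz_ge0 sT z1); apply: eq_cvgc (taylor_part_cvg z1) => n.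
  by apply: eq_bigr => i _; rewrite cE mulr0 addr0.
by rewrite cE eqxx mulr1 addrAC ReD lerDr.
Qed.

Lemma special_of_exp_eps_square_summable : (1 < N)%N ->
  (forall v, c (- v) = (c v)^*%C) -> (forall v, c (v * N%:Z) = c v) ->
  exp_eps_square_summable c ->
  exists mu : {charge set (circle R) -> \bar R}, special_invariant_with_coefs N c mu.
Proof.
move=> N1 cJ cN [e [e0 [b [hb sb]]]]; have N0 : (0 < N)%N by exact: ltnW.
have [S hS] : exists S : R, series (fun n => normc (b n) ^+ 2) @ \oo --> S by exists (limn (series (fun n => normc (b n) ^+ 2))).
have NZ v : (v * N%:Z == 0) = (v == 0).
  by rewrite mulf_eq0 [N%:Z == 0](_ : _ = false) ?orbF// eqz_nat; case: (N) N0.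
pose f n := if n is j.+1 then - e%:C * c j.+1%:Z else 0.
have hG z : normc z < 1 -> normc (cexp (- e%:C * T z)) ^+ 2 <= 2 * S.
  move=> z1; apply: (@h2_radial_bound _ f b (fun z => - e%:C * T z) S N z) => //.
  - by move=> w w1; rewrite -[X in cvgc _ X]add0r; exact: affine_taylor_cvg.
  - move=> w w1; apply: (cvgc_series (fun n => b n * w ^+ n) _).2; apply: hb.
    by rewrite normrcE -(ltcR _ 1) in w1 *.
  - have fE j : (0 < j)%N -> f j = - e%:C * c j%:Z by case: j.
    case=> [|n]; first by rewrite mul0n.
    by rewrite !fE ?muln_gt0// PoszM cN.
(* The logarithm of |exp(-eps T)|^2 <= 2 S, where 2 S is positive because it bounds an
   exponential. *)
have hT z : normc z < 1 -> - (ln (2 * S) / e) <= 2 * Re (T z).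
  move=> z1; have := hG z z1.
  rewrite normc_cexp -expRM_natr mulNr ReN Re_realM => h.
  have S0 : 0 < 2 * S by apply: lt_le_trans h; exact: expR_gt0.
  rewrite -[2 * S]lnK ?posrE// ler_expR in h.
  by rewrite lerNl ler_pdivlMr//; move: h; lra.
(* By [hT], a bounds Re (c_0 + 2 T) from below. Removing a haar changes only the coefficient at 0
   and leaves the positivity that [herglotz] needs. *)
pose a := Re (c 0) - ln (2 * S) / e.
pose c' v : R[i] := c v - a%:C * (v == 0)%:R.
have [|||m [mT mE]] := @herglotz R c' (M + `|a|).
- move=> v; rewrite /c' cJ oppr_eq0.
  have -> (x y : R[i]) : (x - y)^*%C = x^*%C - y^*%C by exact: rmorphB.
  by rewrite [in RHS]conjcM conjc_real conjc_nat.
- move=> v; rewrite (le_trans (le_normcB _ _))// lerD//.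
  rewrite Normc.normcM normc_real normc_nat ler_piMr//.
  by case: (v == 0).
- move=> z G z1 h.
  have -> : G = T z.
    apply: cvgc_unique h _; apply: eq_cvgc (taylor_part_cvg z1) => n.
    by apply: eq_bigr => i _; rewrite /c' mulr0 subr0.
  rewrite /c' eqxx mulr1 !ReD ReN.
  have -> : 2 * T z = 2%:C * T z by rewrite rmorph_nat.
  by rewrite Re_realM /= /a; have := hT z z1; lra.
have inv : forall A, measurable A -> m (circle_exp N @^-1` A) = m A.
  by apply: invariant_of_coef => // v; rewrite !mE /c' cN NZ.
have [k [s [sing msE]]] := invariant_decomposition N1 mT inv.
pose mu : {charge set (circle R) -> \bar R} :=
  cadd (cscale (a + k) (charge_of_finite_measure (haar R))) (charge_of_finite_measure s).
have muE A : mu A = ((a + k)%:E * haar R A + s A)%E by [].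
have muE' A : measurable A -> (mu A = a%:E * haar R A + m A)%E.
  move=> mA; rewrite muE msE//.
  have hA : haar R A \is a fin_num by exact: fin_num_measure.
  by rewrite -(fineK hA) addeA -!EFinM -EFinD mulrDl.
exists mu; split.
- by exists (a + k), s; split.
- move=> A mA; have mpA : measurable (circle_exp N @^-1` A).
    by rewrite -[X in measurable X]setTI; exact: measurable_circle_exp.
  by rewrite /pushforward !muE'// haar_invariant// inv.
- by move=> v; rewrite (fourier_coef_affine _ mT muE') mE /c' subrK.
Qed.

End exponential_criterion.

Theorem corollary9 (R : realType) (N : nat) (hN : (2 <= N)%N)
    (c : int -> R[i])
    (hc : exists M : R, forall nu : int, Normc.normc (c nu) <= M) :
  let conj_sym := forall nu : int, c (- nu) = (c nu)^* in
  let N_periodic := forall nu : int, c (nu * N%:Z) = c nu in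
  [/\ (exists mu : {charge set (circle R) -> \bar R},
         special_invariant_with_coefs N c mu) <->
        [/\ conj_sym, N_periodic & exp_square_summable c],
      (exists mu : {charge set (circle R) -> \bar R},
         special_invariant_with_coefs N c mu) <->
        [/\ conj_sym, N_periodic & exp_eps_square_summable c],
      (forall mu mu' : {charge set (circle R) -> \bar R},
         special_invariant_with_coefs N c mu ->
         special_invariant_with_coefs N c mu' ->
         forall A : set (circle R), measurable A -> mu A = mu' A) &
      (exp_square_summable c -> exp_eps_square_summable c)].
Proof.
move=> conj_sym N_periodic; have [M cM] := hc.
have fwd : (exists mu : {charge set (circle R) -> \bar R}, special_invariant_with_coefs N c mu) ->
    [/\ conj_sym, N_periodic & exp_square_summable c].
  move=> [mu [smu imu cE]]; split.
  - by move=> v; rewrite -!cE; exact: special_coef_conj.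
  - by move=> v; rewrite -!cE special_invariant_coef_periodic// ltnW.
  - exact: (special_coef_exp_square_summable cM smu) cE.
(* Both equivalences follow from the cycle: measure, condition (iii), condition (iii'), measure. *)
have weaken := @exp_eps_of_exp_square_summable R c.
have bwd : [/\ conj_sym, N_periodic & exp_eps_square_summable c] ->
    exists mu : {charge set (circle R) -> \bar R}, special_invariant_with_coefs N c mu.
  by move=> [cJ cN h]; exact: special_of_exp_eps_square_summable cM hN cJ cN h.
split=> //.
- by split=> // -[cJ cN /weaken h]; exact: bwd.
- by split=> // /fwd[cJ cN /weaken h]; split.
- move=> mu mu' [_ _ h] [_ _ h']; apply: fourier_coef_unique => v.
  by rewrite h h'.
Qed.
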